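(* Let $(A,[\,,\,]_A,a)$ be a Lie algebroid over a smooth manifold $M$ (not assumed orientable as a vector bundle) such that $\Gamma A^\ast$ is locally spanned by elements of the form $d_Af$, $f\in C^\infty(M)$. Let $\Pi\in\Gamma(\Lambda^nA)$ be a Nambu structure of order $n$ on $A$. For a positive density $\mu$ on $A$ let $\widetilde{\mathcal M}_\Pi^\mu\in\Gamma(\Lambda^{n-1}A)$ be the multisection determined by $\mathcal L^{t}_{\Pi(d_Af_1\wedge\cdots\wedge d_Af_{n-1})}\mu=\langle\widetilde{\mathcal M}_\Pi^\mu,d_Af_1\wedge\cdots\wedge d_Af_{n-1}\rangle\,\mu$ for all $f_1,\dots,f_{n-1}\in C^\infty(M)$. Then: (1) The mapping $\mathcal M_\Pi^\mu\colon\Gamma(\Lambda^{n-1}A^\ast)\to C^\infty(M)$, $\alpha\mapsto\iota_\alpha\widetilde{\mathcal M}_\Pi^\mu$, is a $1$-cocycle in the cohomology complex (with trivial coefficients) of the Leibniz algebroid $(\mathscr A=\Lambda^{n-1}A^\ast,\ll\,,\gg_\ast,a\circ\Pi_{n-1})$. (2) The cohomology class $\mathcal M_\Pi=[\mathcal M_\Pi^\mu]\in\mathcal HL^1(\mathscr A)$ is independent of the choice of the positive density $\mu$.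
   Context: $M$ is paracompact, $m=\operatorname{rank}A$, $n\le m$; $d_A$ is the Lie algebroid differential on $\Gamma(\Lambda^\bullet A^\ast)$ with trivial coefficients ($d_Af(X)=a(X)f$); $\mathcal L_X$ is the Lie derivative on $\Gamma(\Lambda^\bullet A^\ast)$. $[\,,\,]_A$ also denotes the Schouten bracket; in particular $[X,Y_1\wedge\cdots\wedge Y_k]_A=\sum_iY_1\wedge\cdots\wedge[X,Y_i]_A\wedge\cdots\wedge Y_k$. Pairing: $\langle\phi_1\wedge\cdots\wedge\phi_k,X_1\wedge\cdots\wedge X_k\rangle=\det(\phi_i(X_j))$. Contraction: for $\phi\in\Gamma(\Lambda^iA^\ast)$, $\xi\in\Gamma(\Lambda^kA)$, $\iota_\phi\xi\in\Gamma(\Lambda^{k-i}A)$ is given by $\langle\psi,\iota_\phi\xi\rangle=\langle\phi\wedge\psi,\xi\rangle$; $\iota_X$ ($X\in\Gamma A$) is interior multiplication on forms. Write $\Pi\alpha=\Pi(\alpha):=\iota_\alpha\Pi$ and $\Pi_k(\alpha)=\iota_\alpha\Pi$ for $\alpha\in\Lambda^kA^\ast$. Nambu structure of order $n$: $\Pi\in\Gamma(\Lambda^nA)$ with $\iota_\beta[\Pi\alpha,\Pi]_A=-\Pi(\iota_{\Pi\beta}d_A\alpha)$ for all $\alpha,\beta\in\Gamma(\Lambda^{n-1}A^\ast)$. Densities: the orientation bundle $O(A)$ is the flat real line bundle over $M$ whose transition functions are the signs of the determinants of the transition functions of $A$; over each trivializing open set $U$ of $A$ with local frame $X_1,\dots,X_m$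 it has a canonical flat local frame $o_U$. The density bundle is $D(A)=\Lambda^mA^\ast\otimes O(A)$, and a positive density is a section $\mu$ of $D(A)$ which in each such trivialization has the form $g\,X_1^\ast\wedge\cdots\wedge X_m^\ast\otimes o_U$ with $g>0$ (positive densities always exist). For $X\in\Gamma A$, $\mathcal L^t_X\colon\Gamma(\Lambda^kA^\ast\otimes O(A))\to\Gamma(\Lambda^kA^\ast\otimes O(A))$ is defined locally by $\mathcal L^t_X(e\otimes o)=\mathcal L_X(e)\otimes o$ for $o$ a flat local section of $O(A)$. Under the stated hypotheses, the map $(f_1,\dots,f_{n-1})\mapsto\mathcal M^\mu(f_1,\dots,f_{n-1})$ defined by $\mathcal L^t_{\Pi(d_Af_1\wedge\cdots\wedge d_Af_{n-1})}\mu=\mathcal M^\mu(f_1,\dots,f_{n-1})\mu$ is induced by a unique $\widetilde{\mathcal M}_\Pi^\mu\in\Gamma(\Lambda^{n-1}A)$. Leibniz algebroid $\mathscr A$: the bundle $\Lambda^{n-1}A^\ast$ with anchor $a\circ\Pi_{n-1}$ and bracket $\ll\alpha,\beta\gg_\ast=\mathcal L_{\Pi\alpha}\beta-\iota_{\Pi\beta}d_A\alpha$ on sections. Its cohomology $\mathcal HL^\bullet(\mathscr A)$ is that of the complex with $C^0=C^\infty(M)$ and $C^k$ the $\mathbb R$-multilinear maps $\Gamma(\mathscr A)^k\to C^\infty(M)$, with $d_{\mathscr A}\phi(\alpha_1,\dots,\alpha_{k+1})=\sum_r(-1)^{r+1}a(\Pi\alpha_r)\big(\phi(\dots,\widehat{\alpha_r},\dots)\big)+\sum_{r<s}(-1)^r\phi(\alpha_1,\dots,\widehat{\alpha_r},\dots,\ll\alpha_r,\alpha_s\gg_\ast,\dots,\alpha_{k+1})$,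 the bracket being in the position of $\alpha_s$. *)

(* Defs.v *)
From HB Require Import structures.
From mathcomp Require Import all_boot all_order all_algebra all_fingroup.
From mathcomp Require Import all_classical all_reals all_analysis.

Set Implicit Arguments.
Unset Strict Implicit.
Unset Printing Implicit Defensive.
Import Order.TTheory GRing.Theory Num.Theory.
Import numFieldNormedType.Exports.
Local Open Scope classical_set_scope.
Local Open Scope ring_scope.

(* Throughout, sections, forms, multisections and cochains are plain functions,
   and the predicates [smooth_sec], [is_form], [is_msec], [cochain], ...
   single out the genuine ones. *)

(* [Ck_on k U f], for [U] open: all iterated partial derivatives of [f] of
   order at most [k] exist and are continuous on [U]. *)
Fixpoint Ck_on (R : realType) (d k : nat) (U : set 'rV[R]_d)
    (f : 'rV[R]_d -> R^o) : Prop :=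
  (forall z, U z -> {for z, continuous f}) /\
  if k is k'.+1 then
    forall i : 'I_d,
      (forall z, U z -> derivable f z (delta_mx 0 i)) /\
      Ck_on k' U (fun z => 'D_(delta_mx 0 i) f z)
  else True.

Definition Cinf_on (R : realType) (d : nat) (U : set 'rV[R]_d)
    (f : 'rV[R]_d -> R^o) : Prop := forall k, Ck_on k U f.

(* Every open cover has a locally finite open refinement (covering again). *)
Definition paracompact (T : topologicalType) : Prop :=
  forall (J : Type) (U : J -> set T),
    (forall j, open (U j)) -> \bigcup_j U j = setT ->
    exists (K : Type) (V : K -> set T),
      [/\ forall k, open (V k),
          \bigcup_k V k = setT,
          forall k, exists j, V k `<=` U j &
          forall x : T, exists2 N : set T, nbhs x N &
            finite_set [set k | V k `&` N !=set0]].

Record chart (R : realType) (d : nat) (T : topologicalType) := Chart {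
  cdom : set T;
  cmap : T -> 'rV[R]_d;
  cinv : 'rV[R]_d -> T;
  cdom_open : open cdom;
  cimg_open : open (cmap @` cdom);
  cmapK : forall x, cdom x -> cinv (cmap x) = x;
  cmap_continuous : forall x, cdom x -> {for x, continuous cmap};
  cinv_continuous : forall z, (cmap @` cdom) z -> {for z, continuous cinv}
}.

(* [chart_at x] is a preferred chart around [x]; it serves to represent the
   tangent space at [x] by R^d. *)
Record manifold (R : realType) (d : nat) := Manifold {
  mcarrier :> topologicalType;
  chart_idx : Type;
  charts : chart_idx -> chart R d mcarrier;
  chart_at : mcarrier -> chart_idx;
  chart_at_dom : forall x, cdom (charts (chart_at x)) x;
  chart_change_smooth : forall (i j : chart_idx) (k : 'I_d),
    Cinf_on (cmap (charts i) @` (cdom (charts i) `&` cdom (charts j)))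
            (fun z => cmap (charts j) (cinv (charts i) z) 0 k);
  manifold_hausdorff : hausdorff_space mcarrier;
  manifold_paracompact : paracompact mcarrier
}.

Section Functions.
Variables (R : realType) (d : nat) (M : manifold R d).

Definition smooth_on (W : set M) (f : M -> R) : Prop :=
  forall i : chart_idx M,
    Cinf_on (cmap (charts i) @` (cdom (charts i) `&` W))
            (fun z => f (cinv (charts i) z)).

Definition smooth (f : M -> R) : Prop := smooth_on setT f.

(* Derivative at [x] of [f], smooth near [x], along the tangent vector with
   components [v] in the chart [chart_at x]; it depends only on the germ of
   [f] at [x]. *)
Definition tderive (x : M) (v : 'rV[R]_d) (f : M -> R) : R :=
  'D_v (fun z => f (cinv (charts (chart_at x)) z) : R^o)
    (cmap (charts (chart_at x)) x).

End Functions.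

Definition upd (T : Type) (k : nat) (s : 'I_k -> T) (i : 'I_k) (t : T) :
    'I_k -> T := fun j => if j == i then t else s j.

Section Exterior.
Variables (R : realType) (V : vectType R).

(* Lambda^k V^* is modelled by the alternating k-linear forms on V. *)
Definition mform (k : nat) := ('I_k -> V) -> R.

Definition alternating (k : nat) (w : mform k) : Prop :=
  (forall v i (a : R) (u u' : V),
     w (upd v i (a *: u + u')) = a * w (upd v i u) + w (upd v i u')) /\
  (forall v i j, i != j -> v i = v j -> w v = 0).

(* Lambda^k V is modelled by the linear functionals on Lambda^k V^*, the
   pairing < w , xi > being [xi w]; values off the alternating forms are
   irrelevant.  The element X_1 /\ .. /\ X_k is [fun w => w X]. *)
Definition mvec (k : nat) := mform k -> R.

Definition mvec_linear (k : nat) (xi : mvec k) : Prop :=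
  forall (a : R) (w w' : mform k), alternating w -> alternating w' ->
    xi (fun v => a * w v + w' v) = a * xi w + xi w'.

(* phi_1 /\ .. /\ phi_k, normalised by
   < phi_1 /\ .. /\ phi_k , X_1 /\ .. /\ X_k > = det (phi_i (X_j)). *)
Definition wedge1 (k : nat) (phi : 'I_k -> mform 1) : mform k :=
  fun v => \det (\matrix_(i < k, j < k) phi i (fun _ => v j)).

(* The factor 1 / (p! q!) is the one compatible with [wedge1]. *)
Definition wedge (p q : nat) (a : mform p) (b : mform q) : mform (p + q) :=
  fun v => ((p`! * q`!)%N%:R)^-1 *
    \sum_(s : 'S_(p + q)) (-1) ^+ s *
      (a (fun i => v (s (lshift q i))) * b (fun j => v (s (rshift p j)))).

(* Inverse of the isomorphism V -> Lambda^1 V, X |-> (phi |-> phi X). *)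
Definition vec_of_mvec (eta : mvec 1) : V :=
  \sum_(j < \dim {:V})
    eta (fun v => coord (vbasis {:V}) j (v ord0)) *: (vbasis {:V})`_j.

End Exterior.

(* A vector bundle of rank m: fibres together with local frames over an open
   cover whose transition functions are smooth. *)
Record vbundle (R : realType) (d : nat) (M : manifold R d) (m : nat) :=
  VBundle {
  fib : M -> vectType R;
  triv_idx : Type;
  tdom : triv_idx -> set M;
  frame : triv_idx -> forall x : M, m.-tuple (fib x);
  tdom_open : forall i, open (tdom i);
  tdom_cover : forall x, exists i, tdom i x;
  frame_basis : forall i x, tdom i x -> basis_of {:fib x} (frame i x);
  frame_change_smooth : forall i j (k l : 'I_m),
    smooth_on (tdom i `&` tdom j)
      (fun x => coord (frame j x) k (tnth (frame i x) l))
}.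

Unset Implicit Arguments.

Section Sections.
Context {R : realType} {d : nat} {M : manifold R d} {m : nat}.
Variable A : vbundle M m.

Definition section := forall x : M, fib A x.
Definition form (k : nat) := forall x : M, mform (fib A x) k.
Definition msec (k : nat) := forall x : M, mvec (fib A x) k.

(* A section of Lambda^k A^* (x) O(A), given by its local representatives:
   over [tdom i] it is [w i (x) o_i], with [o_i] the flat frame of O(A) over
   [tdom i]. *)
Definition tform (k : nat) := triv_idx A -> form k.

End Sections.

Section Operations.
Context {R : realType} {d : nat} {M : manifold R d} {m : nat}.
Context {A : vbundle M m}.

Definition smooth_sec (X : section A) : Prop :=
  forall (i : triv_idx A) (k : 'I_m),
    smooth_on (tdom i) (fun x => coord (frame i x) k (X x)).

Definition smooth_coefs {k : nat} (i : triv_idx A) (w : form A k) : Prop :=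
  forall J : 'I_k -> 'I_m,
    smooth_on (tdom i) (fun x => w x (fun a => tnth (frame i x) (J a))).

Definition is_form {k : nat} (w : form A k) : Prop :=
  (forall x, alternating (w x)) /\ (forall i, smooth_coefs i w).

Definition is_msec {k : nat} (xi : msec A k) : Prop :=
  (forall x, mvec_linear (xi x)) /\
  (forall (i : triv_idx A) (J : 'I_k -> 'I_m),
     smooth_on (tdom i) (fun x =>
       xi x (wedge1 (fun a v => coord (frame i x) (J a) (v ord0))))).

Definition eval {k : nat} (w : form A k) (X : 'I_k -> section A) : M -> R :=
  fun x => w x (fun i => X i x).

Definition pairing {k : nat} (w : form A k) (xi : msec A k) : M -> R :=
  fun x => xi x (w x).

(* < psi , iota_phi xi > = < phi /\ psi , xi > *)
Definition contract {i j : nat} (phi : form A i) (xi : msec A (i + j)) :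
    msec A j :=
  fun x psi => xi x (wedge (phi x) psi).

Definition interior {k : nat} (X : section A) (w : form A k.+1) : form A k :=
  fun x v => w x (fun i => oapp v (X x) (unlift ord0 i)).

(* Pi alpha = iota_alpha Pi, as a section of Lambda^1 A = A. *)
Definition sharp {p : nat} (Pi : msec A (p + 1)) (alpha : form A p) :
    section A :=
  fun x => vec_of_mvec (contract alpha Pi x).

(* Some global smooth section with value [v] at [x].  It is only used to
   evaluate tensorial expressions at [x], which do not depend on the choice. *)
Definition extend (x : M) (v : fib A x) : section A :=
  xget (fun y => 0 : fib A y) [set X | smooth_sec X /\ X x = v].

Definition frame_change (i j : triv_idx A) (x : M) : 'M[R]_m :=
  \matrix_(k, l) coord (frame j x) k (tnth (frame i x) l).

Definition is_tform {k : nat} (w : tform A k) : Prop :=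
  [/\ forall i x, tdom i x -> alternating (w i x),
      forall i, smooth_coefs i (w i) &
      forall i j x, tdom i x -> tdom j x ->
        forall v, w i x v = Num.sg (\det (frame_change i j x)) * w j x v].

Definition positive_density (mu : tform A m) : Prop :=
  is_tform mu /\
  forall i x, tdom i x -> 0 < mu i x (fun k => tnth (frame i x) k).

End Operations.

Set Implicit Arguments.

(* The anchor is A_x -> T_x M, with T_x M represented in [chart_at x]; its
   smoothness says that a(X) has smooth components in every chart. *)
Record lie_algebroid (R : realType) (d : nat) (M : manifold R d) (m : nat)
    (A : vbundle M m) := LieAlgebroid {
  bracket : section A -> section A -> section A;
  anchor : forall x : M, {linear fib A x -> 'rV[R]_d};
  anchor_smooth : forall X, smooth_sec X ->
    forall (i : chart_idx M) (k : 'I_d),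
      smooth_on (cdom (charts i))
        (fun x => tderive x (anchor x (X x))
                    (fun y => cmap (charts i) y 0 k));
  bracket_smooth : forall X Y, smooth_sec X -> smooth_sec Y ->
    smooth_sec (bracket X Y);
  bracket_linear : forall (c : R) X Y Z,
    smooth_sec X -> smooth_sec Y -> smooth_sec Z ->
    forall x, bracket (fun y => c *: X y + Y y) Z x =
              c *: bracket X Z x + bracket Y Z x;
  bracket_antisym : forall X Y, smooth_sec X -> smooth_sec Y ->
    forall x, bracket X Y x = - bracket Y X x;
  bracket_jacobi : forall X Y Z,
    smooth_sec X -> smooth_sec Y -> smooth_sec Z ->
    forall x, bracket X (bracket Y Z) x =
              bracket (bracket X Y) Z x + bracket Y (bracket X Z) x;
  bracket_leibniz : forall X Y (f : M -> R),
    smooth_sec X -> smooth_sec Y -> smooth f ->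
    forall x, bracket X (fun y => f y *: Y y) x =
              f x *: bracket X Y x + tderive x (anchor x (X x)) f *: Y x;
  anchor_bracket : forall X Y (f : M -> R),
    smooth_sec X -> smooth_sec Y -> smooth f ->
    forall x, tderive x (anchor x (bracket X Y x)) f =
      tderive x (anchor x (X x)) (fun y => tderive y (anchor y (Y y)) f) -
      tderive x (anchor x (Y x)) (fun y => tderive y (anchor y (X y)) f)
}.

(* The differential
     d phi (s_0, .., s_k) = sum_r (-1)^r s_r . phi (.., ^s_r, ..)
       + sum_(r < t) (-1)^(r+1) phi (.., ^s_r, .., [s_r, s_t], ..),
   with the bracket in the position of s_t (indices starting at 0).  When the
   bracket is skew and phi alternating, moving it to the front turns this into
   the Chevalley-Eilenberg formula. *)
Definition leibniz_diff (R : realType) (d : nat) (M : manifold R d)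
    (S : Type) (act : S -> (M -> R) -> M -> R) (br : S -> S -> S) (k : nat)
    (phi : ('I_k -> S) -> M -> R) : ('I_k.+1 -> S) -> M -> R :=
  fun s x =>
    \sum_(r < k.+1) (-1) ^+ r * act (s r) (phi (fun i => s (lift r i))) x +
    \sum_(r < k.+1) \sum_(t < k.+1 | (r < t)%N)
      (-1) ^+ r.+1 * phi (fun i => upd s t (br (s r) (s t)) (lift r i)) x.

Unset Implicit Arguments.

Section Calculus.
Context {R : realType} {d : nat} {M : manifold R d} {m : nat}.
Context {A : vbundle M m} (L : lie_algebroid A).

Definition act (X : section A) (f : M -> R) : M -> R :=
  fun x => tderive x (anchor L x (X x)) f.

Definition dfun (f : M -> R) : form A 1 :=
  fun x v => tderive x (anchor L x (v ord0)) f.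

Definition wedge_dfun {k : nat} (f : 'I_k -> M -> R) : form A k :=
  fun x => wedge1 (fun i => dfun (f i) x).

Definition dform {k : nat} (w : form A k) : form A k.+1 :=
  fun x v => leibniz_diff act (bracket L) (eval w) (fun i => extend x (v i)) x.

(* The value at [x] depends only on the germ of [w] at [x], so this also
   applies to forms defined over an open set. *)
Definition lie_form {k : nat} (X : section A) (w : form A k) : form A k :=
  fun x v =>
    let Y := fun i => extend x (v i) in
    act X (eval w Y) x - \sum_(i < k) w x (upd v i (bracket L X (Y i) x)).

Definition lie_tform {k : nat} (X : section A) (w : tform A k) : tform A k :=
  fun i => lie_form X (w i).

(* Schouten bracket [X, xi] of a section and a multisection.  Writing
   xi = sum_r c_r Y_r1 /\ .. /\ Y_rk near x, its value at x is
   sum_r (a(X) c_r) Y_r1 /\ .. /\ Y_rk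
     + sum_r c_r sum_i Y_r1 /\ .. /\ [X, Y_ri] /\ .. /\ Y_rk;
   this does not depend on the decomposition. *)
Definition schouten_value {k : nat} (X : section A) (xi : msec A k) (x : M)
    (eta : mvec (fib A x) k) : Prop :=
  exists (N : nat) (c : 'I_N -> M -> R) (Y : 'I_N -> 'I_k -> section A),
    [/\ forall r, smooth (c r),
        forall r i, smooth_sec (Y r i),
        \forall y \near x, forall w, alternating w ->
          xi y w = \sum_(r < N) c r y * w (fun i => Y r i y) &
        forall w, eta w =
          \sum_(r < N) (act X (c r) x * w (fun i => Y r i x) +
            c r x * \sum_(i < k)
              w (upd (fun j => Y r j x) i (bracket L X (Y r i) x)))].

Definition schouten {k : nat} (X : section A) (xi : msec A k) : msec A k :=
  fun x => xget (fun _ => 0) [set eta | schouten_value X xi x eta].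

Definition dual_locally_spanned_by_differentials : Prop :=
  forall x : M, exists U : set M,
    [/\ open U, U x &
        forall alpha : form A 1, is_form alpha ->
          exists (N : nat) (f h : 'I_N -> M -> R),
            [/\ forall r, smooth (f r),
                forall r, smooth_on U (h r) &
                forall y, U y -> forall v,
                  alpha y v = \sum_(r < N) h r y * dfun (f r) y v]].

(* Nambu structure of order n = p + 1. *)
Definition nambu {p : nat} (Pi : msec A (p + 1)) : Prop :=
  is_msec Pi /\
  forall alpha beta : form A p, is_form alpha -> is_form beta ->
    forall x,
      vec_of_mvec (contract beta (schouten (sharp Pi alpha) Pi) x) =
      - sharp Pi (interior (sharp Pi beta) (dform alpha)) x.

Section LeibnizAlgebroid.
Context {p : nat} (Pi : msec A (p + 1)).

Definition lbracket (alpha beta : form A p) : form A p :=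
  fun x v => lie_form (sharp Pi alpha) beta x v -
             interior (sharp Pi beta) (dform alpha) x v.

Definition lact (alpha : form A p) (f : M -> R) : M -> R :=
  act (sharp Pi alpha) f.

(* [cochain 0] amounts to C^oo(M). *)
Definition cochain {k : nat} (phi : ('I_k -> form A p) -> M -> R) : Prop :=
  (forall s, (forall i, is_form (s i)) -> smooth (phi s)) /\
  (forall s i (c : R) (alpha beta : form A p),
     (forall j, is_form (s j)) -> is_form alpha -> is_form beta ->
     forall x, phi (upd s i (fun y v => c * alpha y v + beta y v)) x =
               c * phi (upd s i alpha) x + phi (upd s i beta) x).

Definition lie_diff {k : nat} (phi : ('I_k -> form A p) -> M -> R) :
    ('I_k.+1 -> form A p) -> M -> R := leibniz_diff lact lbracket phi.

Definition cocycle {k : nat} (phi : ('I_k -> form A p) -> M -> R) : Prop :=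
  cochain phi /\
  forall s, (forall i, is_form (s i)) -> forall x, lie_diff phi s x = 0.

(* The class of [phi] in HL^(k+1), as a set of cocycles. *)
Definition HLclass {k : nat} (phi : ('I_k.+1 -> form A p) -> M -> R) :
    set (('I_k.+1 -> form A p) -> M -> R) :=
  [set psi | cocycle psi /\
     exists2 chi : ('I_k -> form A p) -> M -> R, cochain chi &
       forall s, (forall i, is_form (s i)) ->
         forall x, psi s x - phi s x = lie_diff chi s x].

(* [Mt] is the multisection determined by
   L^t_(Pi (d f_1 /\ .. /\ d f_(n-1))) mu
     = < Mt , d f_1 /\ .. /\ d f_(n-1) > mu. *)
Definition is_modular_msec (mu : tform A m) (Mt : msec A p) : Prop :=
  is_msec Mt /\
  forall f : 'I_p -> M -> R, (forall i, smooth (f i)) ->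
    forall (i : triv_idx A) (x : M), tdom i x -> forall v,
      lie_tform (sharp Pi (wedge_dfun f)) mu i x v =
      pairing (wedge_dfun f) Mt x * mu i x v.

End LeibnizAlgebroid.

Definition modular_cochain {p : nat} (Mt : msec A p) :
    ('I_1 -> form A p) -> M -> R := fun s => pairing (s ord0) Mt.

End Calculus.

(* Main.v *)
Require Import Defs.
From HB Require Import structures.
From mathcomp Require Import all_boot all_order all_algebra all_fingroup.
From mathcomp Require Import all_classical all_reals all_analysis.
From mathcomp Require Import ring lra.
(* [act] is otherwise the action of a group. *)
Import Defs.
Set Implicit Arguments.
Unset Strict Implicit.
Unset Printing Implicit Defensive.
Import Order.TTheory GRing.Theory Num.Theory.
Import numFieldNormedType.Exports.
Local Open Scope classical_set_scope.
Local Open Scope ring_scope.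

(* Near every point the spanning hypothesis yields functions f_1, .., f_m and
   sections e_1, .., e_m with a(e_k) f_l = delta_kl.  The flat connection
   for which the e_k are parallel is torsion-free, so the e_k act as commuting
   derivations D_k and d_A, the Lie derivatives and the brackets have the same
   coordinate expressions as on R^m.  With X = Pi alpha and
   M^J = sum_k (D_k Pi^(Jk) + Pi^(Jk) D_k log rho), rho being the coefficient
   of mu, one finds
     M(alpha) = div X - (1/p!) sum Pi^(Jk) D_k alpha_J,   p = n - 1.
   The Nambu identity gives Pi <<alpha, beta>> = [Pi alpha, Pi beta], and div is
   a cocycle on vector fields; what is left of the cocycle condition is the
   symmetry in alpha, beta of sum (L_(Pi alpha) Pi)^(Jl) D_l beta_J.  It holds
   because the Nambu identity, applied to both dF and f_a dF with
   dF = df_(i_1) /\ .. /\ df_(i_p), forces a quadratic relation on Pi.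
   For the second part, replacing mu by h mu changes M(alpha) by
   a(Pi alpha) (ln h), the coboundary of ln h. *)

(** * Functions of class C^k *)

(** The algebroid axioms, the Nambu condition and the modular multisection concern global sections
    and functions, while the computation is local. Bump functions bridge the gap: the f_l and e_k
    are global, only their duality is confined to an open set W. This duality makes the anchor
    injective over W, so vectors are compared through their action on the f_l; brackets are then
    computed from the anchor alone, without a separate locality argument. Formulas that extend
    vectors to sections by an arbitrary choice lose that choice through torsion-freeness, which
    cancels the derivatives of the extensions. Once everything is expressed by coefficients, the
    identity lives in the commutative ring of smooth functions on W and is proved for an abstract
    ring with commuting derivations. Multi-indices are arbitrary maps into ['I_m], not increasing
    ones: replacing an entry of J by k then stays in the index set, at the price of factors 1/p! and
    of generalised Kronecker symbols. In the symmetry to be shown, the Nambu identity produces two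
    sums; one is symmetric by relabelling, the other by the quadratic relation. *)

Section LineDerivative.
Context {R : realType} {d : nat}.
Implicit Types (f : 'rV[R]_d -> R^o) (a v : 'rV[R]_d).

Lemma is_derive_line f a v (t : R) :
  derivable f (a + t *: v) v ->
  is_derive t 1 (fun s : R => f (a + s *: v) : R^o) ('D_v f (a + t *: v)).
Proof.
move=> df.
have E : (fun h : R => h^-1 *: (((fun s : R => f (a + s *: v) : R^o) \o shift t) (h *: (1:R^o)) -
   f (a + t *: v))) = (fun h : R => h^-1 *: ((f \o shift (a + t *: v)) (h *: v) - f (a + t *: v))).
  apply/funext => h /=; congr (_ *: (f _ - _)).
  by rewrite [_%:A]mulr1 scalerDl addrCA.
split; first by rewrite /derivable E.
by rewrite /derive E.
Qed.

Lemma is_derive_line_scale f a v (c t : R) :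
  derivable f (a + (t * c) *: v) v ->
  is_derive t 1 (fun s : R => f (a + (s * c) *: v) : R^o)
    (c * 'D_v f (a + (t * c) *: v)).
Proof.
move=> df.
have h1 := is_derive_line df.
have h2 : is_derive t (1 : R^o) (fun s : R => s * c : R^o) c.
  have H := @is_deriveM _ R^o id (cst c) t 1 1 0 (is_derive_id _ _) (is_derive_cst _ _ _).
  by apply: (is_derive_eq H); rewrite scaler0 add0r /GRing.scale/= mulr1.
have := @is_derive1_comp _ (fun s : R => f (a + s *: v) : R^o)
  (fun s : R => s * c : R^o) t _ _ h1 h2.
by rewrite mulrC.
Qed.

(** The segment is parametrised by [0, 1] with the increment c as a factor, so that c may have
    either sign. *)
Lemma mean_value_coord f a v (c : R) :
  (forall t : R, 0 <= t <= 1 -> derivable f (a + (t * c) *: v) v) ->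
  exists2 t : R, 0 <= t <= 1 &
    f (a + c *: v) - f a = c * 'D_v f (a + (t * c) *: v).
Proof.
move=> df; pose g := fun s : R => f (a + (s * c) *: v) : R^o.
have [] := @MVT_segment R g (fun s => c * 'D_v f (a + (s * c) *: v)) 0 1 ler01.
- move=> x; rewrite in_itv /= => /andP[x0 x1].
  by apply: is_derive_line_scale; apply: df; rewrite !ltW.
- apply: derivable_within_continuous => x; rewrite in_itv/= => x01.
  by have [] := is_derive_line_scale (df x x01).
move=> t; rewrite in_itv/= => t01; rewrite /g mul1r mul0r scale0r addr0 subr0 mulr1 => ->.
by exists t.
Qed.

End LineDerivative.

Section ContinuouslyDifferentiable.
Context {R : realType} {d : nat}.
Implicit Types (f : 'rV[R]_d -> R^o) (z v h : 'rV[R]_d).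

Definition gradient_map (J : 'I_d -> R) (h : 'rV[R]_d) : R^o :=
  \sum_k h 0 k * J k.

Lemma gradient_map_is_linear J : linear (gradient_map J).
Proof.
move=> a u v; rewrite /gradient_map scaler_sumr -big_split/=.
by apply: eq_bigr => k _; rewrite !mxE mulrDl /GRing.scale/= mulrA.
Qed.
HB.instance Definition _ J :=
  GRing.isLinear.Build R 'rV[R]_d R^o *:%R (gradient_map J)
    (gradient_map_is_linear J).

Lemma gradient_map_continuous J : continuous (gradient_map J).
Proof.
move=> h; rewrite /gradient_map.
pose F := \sum_k ((fun h0 : 'rV[R]_d => h0 0 k * J k : R^o)).
suff : {for h, continuous F}.
  by rewrite /F; congr ({for h, continuous _}); apply/funext => x; rewrite fct_sumE.
rewrite /F; elim/big_ind : _ => [|u v cu cv|k _]; first exact: cst_continuous.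
  exact: continuousD.
apply: continuousM; last exact: cst_continuous.
exact: coord_continuous.
Qed.

(** Vertices of the path from 0 to h that changes one coordinate at a time. *)
Definition row_trunc (k : nat) (h : 'rV[R]_d) : 'rV[R]_d :=
  \row_j (if (j < k)%N then h 0 j else 0).

Lemma row_truncS (k : 'I_d) h :
  row_trunc k.+1 h = row_trunc k h + h 0 k *: delta_mx 0 k.
Proof.
apply/rowP => j; rewrite !mxE eqxx /= ltnS leq_eqVlt.
have [->|jk] := eqVneq j k; first by rewrite eqxx ltnn add0r mulr1.
by rewrite (inj_eq val_inj) (negbTE jk)/= mulr0 addr0.
Qed.

(** The increment f (z + h) - f z is telescoped along the path of the [row_trunc k h]. On each edge
    the mean value theorem gives a partial derivative at a point near z, which is close to its value
    at z. *)
Lemma C1_differentiable f z :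
  (\forall y \near z, forall k : 'I_d, derivable f y (delta_mx 0 k)) ->
  (forall k : 'I_d, {for z, continuous ('D_(delta_mx 0 k) f)}) ->
  differentiable f z.
Proof.
move=> df cdf.
pose J (k : 'I_d) := 'D_(delta_mx 0 k) f z.
have key : f \o shift z = cst (f z) + gradient_map J +o_ (0 : 'rV[R]_d) id.
  apply/eqaddoP => _/posnumP[e].
  (* There are d edges, each with an error of at most e / (d + 1) times the norm of h; the
     denominator d + 1 is nonzero even if d = 0. *)
  have : \forall y \near z, (forall k : 'I_d, derivable f y (delta_mx 0 k)) /\
      forall k : 'I_d, `|'D_(delta_mx 0 k) f y - J k| <= e%:num / d.+1%:R.
    apply: filterI => //.
    have := @filter_forall _ 'I_d (fun k (y : 'rV[R]_d) =>
      `|'D_(delta_mx 0 k) f y - J k| <= e%:num / d.+1%:R) (nbhs z) _.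
    apply=> k.
    have /cvgrPdist_le/(_ (e%:num / d.+1%:R)) := cdf k.
    rewrite divr_gt0// => /(_ isT).
    by apply: filterS => y; rewrite distrC.
  move=> /nbhs_ballP[r /= r0 br].
  apply/nbhs_ballP; exists r => //= h.
  rewrite -ball_normE /ball_/= sub0r normrN => hr.
  pose T k := f (row_trunc k h + z).
  have -> : (f \o shift z - (cst (f z) + gradient_map J)) h =
     \sum_(k < d) (T k.+1 - T k - h 0 k * J k).
    rewrite big_split/= sumrN /=.
    rewrite -(big_mkord xpredT (fun k => T k.+1 - T k)) telescope_sumr//.
    rewrite /T.
    have -> : row_trunc d h = h by apply/rowP => j; rewrite !mxE ltn_ord.
    have -> : row_trunc 0 h = 0 by apply/rowP => j; rewrite !mxE.
    by rewrite add0r !fctE opprD addrA.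
  apply: (le_trans (ler_norm_sum _ _ _)).
  apply: (@le_trans _ _ (\sum_(k < d) (e%:num / d.+1%:R * `|h|))); last first.
    rewrite sumr_const card_ord -[leLHS]mulr_natl mulrA ler_wpM2r//.
    rewrite mulrCA ler_piMr//.
    by rewrite ler_pdivrMr ?mul1r ?ler_nat.
  apply: ler_sum => k _.
  have hk : `|h 0 k| <= `|h|.
    by rewrite [leRHS]/Num.Def.normr/= mx_normrE; exact: (le_bigmax _ _ (0,k)).
  (* In the sup norm, a point of the path is no farther from z than z + h. *)
  have inb (t : R) : 0 <= t <= 1 ->
      ball z r (z + row_trunc k h + (t * h 0 k) *: delta_mx 0 k).
    move=> /andP[t0 t1].
    rewrite -ball_normE /ball_/= opprD addrA opprD addrA subrr add0r -opprD normrN.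
    apply: le_lt_trans hr.
    rewrite [leLHS]/Num.Def.normr/= mx_normrE bigmax_le//= => -[i j] _ /=.
    rewrite !mxE ord1 eqxx /=.
    have [->|jk] := eqVneq j k.
      rewrite ltnn add0r mulr1 normrM ger0_norm//.
      by apply: le_trans hk; rewrite ler_piMl.
    rewrite mulr0 addr0; case: ifP => _; last by rewrite normr0.
    by rewrite [leRHS]/Num.Def.normr/= mx_normrE; exact: (le_bigmax _ _ (0,j)).
  have [t t01] := @mean_value_coord R d f (z + row_trunc k h) (delta_mx 0 k) (h 0 k)
    (fun t t01 => (br _ (inb t t01)).1 k).
  rewrite /T row_truncS ![_ + z]addrC addrA => ->.
  rewrite -mulrBr normrM mulrC.
  by apply: ler_pM => //; exact: (br _ (inb t t01)).2.
have dE := diff_unique (@gradient_map_continuous J) key.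
apply/diff_locallyP; split; last by rewrite dE.
by rewrite dE; exact: gradient_map_continuous.
Qed.

End ContinuouslyDifferentiable.

Section CkCalculus.
Context {R : realType} {d : nat}.
Implicit Types (f g : 'rV[R]_d -> R^o) (z v h : 'rV[R]_d) (U V : set 'rV[R]_d).

(** Each clause of [Ck_on] is a condition at one point and derivatives are taken in the whole space;
    hence the sets V may be arbitrary. *)
Lemma Ck_on_local k U f :
  (forall z, U z -> exists2 V, V z & Ck_on k V f) -> Ck_on k U f.
Proof.
elim: k f => [|k IH] f H; split => //.
- by move=> z /H[V Vz [+ _]]; apply.
- by move=> z /H[V Vz [+ _]]; apply.
move=> i; split => [z /H[V Vz [_ /(_ i)[+ _]]]|]; first exact.
by apply: IH => z /H[V Vz [_ /(_ i)[_ ?]]]; exists V.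
Qed.

Lemma Ck_on_sub k U V f : V `<=` U -> Ck_on k U f -> Ck_on k V f.
Proof. by move=> VU Uf; apply: Ck_on_local => z /VU Uz; exists U. Qed.

Lemma Ck_onS k U f : Ck_on k.+1 U f -> Ck_on k U f.
Proof.
elim: k f => [|k IH] f [cf H]; split => // i; split; first by have [] := H i.
by apply: IH; have [] := H i.
Qed.

Lemma open_near_eq U f g z : open U -> U z -> (forall y, U y -> f y = g y) ->
  \near z, f z = g z.
Proof.
move=> oU Uz fg; apply: filterS (open_nbhs_nbhs (conj oU Uz)) => y; exact: fg.
Qed.

Lemma near_eq_continuous f g z : (\near z, f z = g z) ->
  {for z, continuous f} -> {for z, continuous g}.
Proof.
move=> fg cf; rewrite /prop_for /continuous_at -(nbhs_singleton fg).
by apply: cvg_trans cf; exact: near_eq_cvg fg.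
Qed.

Lemma Ck_on_ext k U f g : open U -> (forall z, U z -> f z = g z) ->
  Ck_on k U f -> Ck_on k U g.
Proof.
move=> oU; elim: k f g => [|k IH] f g fg [cf H].
  split=> // z Uz; apply: near_eq_continuous (cf _ Uz).
  exact: open_near_eq oU Uz fg.
split=> [z Uz|i].
  by apply: near_eq_continuous (cf _ Uz); exact: open_near_eq oU Uz fg.
have [df Df] := H i; split=> [z Uz|].
  by apply: near_eq_derivable (df _ Uz); apply: open_near_eq oU Uz fg.
apply: IH Df => z Uz.
by apply: near_eq_derive; apply: open_near_eq oU Uz fg.
Qed.

Lemma Ck_on_cst k U (c : R) : Ck_on k U (cst c : 'rV[R]_d -> R^o).
Proof.
elim: k c => [|k IH] c; split=> //; try by move=> z _; exact: cst_continuous.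
move=> i; split=> [z _|]; first exact: derivable_cst.
rewrite (_ : (fun z => _) = cst 0); first exact: IH.
by apply/funext => z; rewrite derive_cst.
Qed.

Lemma Ck_onD k U f g : open U -> Ck_on k U f -> Ck_on k U g ->
  Ck_on k U (fun z => f z + g z).
Proof.
move=> oU; elim: k f g => [|k IH] f g [cf H] [cg G].
  by split=> // z Uz; apply: continuousD; [exact: cf|exact: cg].
split=> [z Uz|i]; first by apply: continuousD; [exact: cf|exact: cg].
have [df Df] := H i; have [dg Dg] := G i; split=> [z Uz|].
  by apply: derivableD; [exact: df|exact: dg].
apply: Ck_on_ext oU _ (IH _ _ Df Dg) => z Uz.
by rewrite [RHS](deriveD (df _ Uz) (dg _ Uz)).
Qed.

Lemma Ck_onM k U f g : open U -> Ck_on k U f -> Ck_on k U g ->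
  Ck_on k U (fun z => f z * g z).
Proof.
move=> oU; elim: k f g => [|k IH] f g.
  move=> [cf H] [cg G].
  by split=> // z Uz; apply: continuousM; [exact: cf|exact: cg].
move=> Cf Cg; have [cf H] := Cf; have [cg G] := Cg.
split=> [z Uz|i]; first by apply: continuousM; [exact: cf|exact: cg].
have [df Df] := H i; have [dg Dg] := G i; split=> [z Uz|].
  by apply: derivableM; [exact: df|exact: dg].
have C := Ck_onD oU (IH _ _ (Ck_onS Cf) Dg) (IH _ _ (Ck_onS Cg) Df).
apply: Ck_on_ext oU _ C => z Uz.
by rewrite [RHS](deriveM (df _ Uz) (dg _ Uz)).
Qed.

(* The members of such a family [G] are smooth on [I]. *)
Definition derivation_closed (I : set R) (G : set (R -> R)) :=
  forall g : R -> R, G g -> exists2 g', G g' &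
    forall t : R, I t -> is_derive (t : R^o) 1 (g : R^o -> R^o) (g' t).

Lemma is_derive_comp f (g : R -> R) z v (b : R) :
  derivable f z v -> is_derive (f z : R^o) 1 (g : R^o -> R^o) b ->
  is_derive z v (fun y => g (f y) : R^o) (b * 'D_v f z).
Proof.
move=> df dg.
have h1 : is_derive (0 : R^o) 1 (fun s : R^o => f (z + s *: v) : R^o) ('D_v f z).
  by have := @is_derive_line _ _ f z v 0; rewrite scale0r addr0; apply.
have dg0 : is_derive (f (z + (0:R) *: v)) 1 (g : R^o -> R^o) b.
  by rewrite scale0r addr0.
pose l := fun s : R^o => f (z + s *: v) : R^o.
have [D1 D2] := @is_derive1_comp _ (g : R^o -> R^o) l 0 _ _ dg0 h1.
have E : (fun h : R => h^-1 *: ((((fun y => g (f y) : R^o)) \o shift z) (h *: v) - g (f z))) =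
   (fun h : R => h^-1 *: (((g \o l) \o shift (0:R^o)) (h *: (1:R^o)) - (g \o l) 0)).
  apply/funext => h /=; congr (_ *: (g (f _) - g (f _))).
    by rewrite [_%:A]mulr1 addr0 addrC.
  by rewrite scale0r addr0.
split; first by rewrite /derivable E.
by rewrite -D2 /derive E.
Qed.

(** The induction on k ranges over all members of G: the chain rule gives the product of g' o f and
    a derivative of f, with g' again in G. *)
Lemma Ck_on_comp k U f (I : set R) (G : set (R -> R)) (g : R -> R) :
  open U -> derivation_closed I G -> G g -> (forall z, U z -> I (f z)) ->
  Ck_on k U f -> Ck_on k U (fun z => g (f z)).
Proof.
move=> oU dG Gg UI; elim: k g Gg => [|k IH] g Gg Cf.
  split=> // z Uz; have [g' Gg' dg] := dG _ Gg.
  apply: continuous_comp; first by have [+ _] := Cf; apply.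
  apply/differentiable_continuous/derivable1_diffP.
  by have [] := dg _ (UI _ Uz).
have [g' Gg' dg] := dG _ Gg.
have [cf H] := Cf; split=> [z Uz|i].
  apply: continuous_comp; first exact: cf.
  apply/differentiable_continuous/derivable1_diffP.
  by have [] := dg _ (UI _ Uz).
have [df Df] := H i.
have D z : U z -> is_derive z (delta_mx 0 i) (fun y => g (f y) : R^o)
    (g' (f z) * 'D_(delta_mx 0 i) f z).
  by move=> Uz; apply: is_derive_comp; [exact: df|exact: dg (UI _ Uz)].
split=> [z /D[]//|].
have C := Ck_onM oU (IH _ Gg' (Ck_onS Cf)) Df.
by apply: Ck_on_ext oU _ C => z /D[].
Qed.

Lemma Cinf_on_derive U f (i : 'I_d) : Cinf_on U f ->
  Cinf_on U (fun z => 'D_(delta_mx 0 i) f z).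
Proof. by move=> Cf k; have [_ /(_ i)[]] := Cf k.+1. Qed.

Lemma Cinf_on_differentiable U f z : open U -> Cinf_on U f -> U z ->
  differentiable f z.
Proof.
move=> oU Cf Uz; apply: C1_differentiable.
  apply: filterS (open_nbhs_nbhs (conj oU Uz)) => y Uy k.
  by have [_ /(_ k)[+ _]] := Cf 1; apply.
by move=> k; have [_ /(_ k)[_ [+ _]]] := Cf 1; apply.
Qed.

Lemma derive_coord f z v : differentiable f z ->
  'D_v f z = \sum_k v 0 k * 'D_(delta_mx 0 k) f z.
Proof.
move=> df; rewrite deriveE// {1}(row_sum_delta v) linear_sum/=.
by apply: eq_bigr => k _; rewrite linearZ/= deriveE.
Qed.

End CkCalculus.

(** * Functions of one real variable: inverse powers, logarithm, flat functions *)

Section OneVariable.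
Context {R : realType}.

Definition inv_pow (c : R) (n : nat) : R -> R := fun t => c * t^-1 ^+ n.

Lemma is_derive_inv_pow c n (t : R) : t != 0 ->
  is_derive (t : R^o) 1 (inv_pow c n : R^o -> R^o) (inv_pow (- (c *+ n)) n.+1 t).
Proof.
move=> t0.
have h1 := is_deriveV (f := id) t0 (is_derive_id (t : R^o) (1 : R^o)).
have h2 := @is_deriveX R R^o _ n _ _ _ h1.
have h3 := @is_deriveZ R R^o R^o _ c _ _ _ h2.
have E : (c \*: ((fun y : R^o => y^-1 : R^o) ^+ n)) = (inv_pow c n : R^o -> R^o).
  by apply/funext => y; rewrite /inv_pow fctE.
rewrite -[X in is_derive _ _ X _]E; apply: (is_derive_eq h3).
rewrite /inv_pow /GRing.scale/= mulr1 -exprVn.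
case: n {h2 h3 E} => [|n]; first by rewrite mulr0n !mul0r mulr0 oppr0 mul0r.
by rewrite /= !exprS expr0 -mulr_natl; ring.
Qed.

Lemma inv_pow_closed :
  derivation_closed [set t : R | t != 0] [set g | exists c n, g = inv_pow c n].
Proof.
move=> _ [c [n ->]]; exists (inv_pow (- (c *+ n)) n.+1); first by exists (- (c *+ n)), n.+1.
by move=> t /= t0; exact: is_derive_inv_pow.
Qed.

Lemma ln_closed : derivation_closed [set t : R | 0 < t]
  [set g | g = (@ln R) \/ exists c n, g = inv_pow c n].
Proof.
move=> g [->|[c [n ->]]].
  exists (inv_pow 1 1); first by right; exists 1, 1%N.
  by move=> t /= t0; rewrite /inv_pow mul1r expr1; exact: is_derive1_ln.
exists (inv_pow (- (c *+ n)) n.+1); first by right; exists (- (c *+ n)), n.+1.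
by move=> t /= t0; apply: is_derive_inv_pow; rewrite gt_eqF.
Qed.

(* The flat function [flat_exp 0] is the usual [exp (- 1 / t)], extended by
   [0]; its derivatives are combinations of the [flat_exp n]. *)
Definition flat_exp (n : nat) : R -> R :=
  fun t => if 0 < t then t^-1 ^+ n * expR (- t^-1) else 0.

(** The exponential series bounds exp (1 / t) below by its term of degree n + 2. The spare factor t
    ^ 2 makes the difference quotient of [flat_exp n] at 0 tend to 0. *)
Lemma flat_exp_le n (t : R) : 0 < t -> flat_exp n t <= (n.+2)`!%:R * t ^+ 2.
Proof.
move=> t0; rewrite /flat_exp t0 expRN.
rewrite ler_pdivrMr ?expR_gt0//.
have := @expR_ge1Dxn R t^-1 n.+1 (ltW _); rewrite invr_gt0 => /(_ t0) h.
have {}h : t^-1 ^+ n.+2 / (n.+2)`!%:R <= expR t^-1.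
  by apply: le_trans h; rewrite lerDr.
have f0 : (0 : R) < (n.+2)`!%:R by rewrite ltr0n fact_gt0.
rewrite ler_pdivrMr// in h.
have -> : t^-1 ^+ n = t ^+ 2 * t^-1 ^+ n.+2.
  by rewrite !exprS; field; rewrite gt_eqF.
rewrite [leRHS](_ : _ = t ^+ 2 * (expR t^-1 * (n.+2)`!%:R)); last by ring.
by rewrite ler_wpM2l// exprn_ge0// ltW.
Qed.

Lemma is_derive_flat_exp n (t : R) :
  is_derive (t : R^o) 1 (flat_exp n : R^o -> R^o)
    (- n%:R * flat_exp n.+1 t + flat_exp n.+2 t).
Proof.
have [t0|t0|<-] := ltgtP 0 t.
- have h1 := is_derive_inv_pow 1 n (lt0r_neq0 t0).
  have hv := is_deriveV (f := id) (lt0r_neq0 t0) (is_derive_id (t : R^o) (1 : R^o)).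
  have hn := is_deriveN hv.
  have h2 := @is_derive1_comp R expR _ t _ _ (is_derive_expR _) hn.
  have h3 := @is_deriveM R R^o _ _ _ _ _ _ h1 h2.
  apply: (near_eq_is_derive _ (is_derive_eq h3 _)).
    apply: filterS (lt_nbhsr t0) => y y0.
    by rewrite /flat_exp y0 /= fctE /inv_pow mul1r.
  rewrite /inv_pow /flat_exp t0 /GRing.scale /= !mulr1 !mul1r.
  rewrite -[- n%:R]/(- (n%:R : R)) opprK !exprS exprVn.
  have -> : (- [eta GRing.inv : R^o -> R^o]) t = - t^-1 by [].
  move: (expR _) => e; rewrite expr0; field.
  by rewrite expf_neq0 ?gt_eqF.
- have -> : - n%:R * flat_exp n.+1 t + flat_exp n.+2 t = 0.
    by rewrite /flat_exp ltNge ltW// mulr0 addr0.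
  apply: (near_eq_is_derive _ (is_derive_cst (0 : R^o) _ _)).
  apply: filterS (lt_nbhsl t0) => y y0.
  by rewrite /flat_exp ltNge ltW.
have -> : - n%:R * flat_exp n.+1 0 + flat_exp n.+2 0 = 0.
  by rewrite /flat_exp ltxx mulr0 addr0.
(* At 0 the quotient vanishes for h < 0 and is at most (n + 2)! h for h > 0. *)
have H : (fun h : R => h^-1 *: (((flat_exp n : R^o -> R^o) \o shift (0:R^o)) (h *: (1:R^o)) -
   flat_exp n 0)) @ 0^' --> (0 : R^o).
  apply/cvgrPdist_le => /= e e0.
  have c0 : 0 < e / (n.+2)`!%:R by rewrite divr_gt0// ltr0n fact_gt0.
  have := @dnbhs0_lt R R^o _ c0; apply: filterS => h hc.
  rewrite sub0r normrN /= addr0 [_%:A]mulr1 {2}/flat_exp ltxx subr0.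
  rewrite /GRing.scale/= /flat_exp; case: ifPn => h0; last by rewrite mulr0 normr0 ltW.
  rewrite ger0_norm; last first.
    rewrite mulr_ge0 ?invr_ge0 ?ltW// -/(flat_exp n h).
    by rewrite mulr_gt0 ?exprn_gt0 ?invr_gt0 ?expR_gt0.
  rewrite ler_pdivrMl//.
  have := flat_exp_le n h0; rewrite /flat_exp h0 => /le_trans; apply.
  rewrite expr2 mulrA mulrC ler_wpM2l ?(ltW h0)//.
  by rewrite -ler_pdivlMl ?ltr0n ?fact_gt0// mulrC ltW// -(gtr0_norm h0).
split; first by apply/cvg_ex; exists 0.
exact: cvg_lim H.
Qed.

(** The derivative of one [flat_exp] is a combination of two others, so a set that is closed under
    derivation has to contain linear combinations. *)
Inductive flat_span : set (R -> R) :=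
| flat_span_base n : flat_span (flat_exp n)
| flat_span_comb c g h :
    flat_span g -> flat_span h -> flat_span (fun t => c * g t + h t).

Lemma flat_span_closed : derivation_closed setT flat_span.
Proof.
move=> g; elim=> [n|c g1 h _ [g' Gg' dg] _ [h' Gh' dh]].
  exists (fun t => - n%:R * flat_exp n.+1 t + flat_exp n.+2 t).
    by apply: flat_span_comb; exact: flat_span_base.
  by move=> t _; exact: is_derive_flat_exp.
exists (fun t => c * g' t + h' t); first exact: flat_span_comb.
move=> t _; have d1 := dg t I; have d2 := dh t I.
exact: (is_deriveD (is_deriveZ c d1) d2).
Qed.

End OneVariable.

(** * Smooth functions and bump functions on a manifold *)

Section SmoothFunctions.
Context {R : realType} {d : nat} {M : manifold R d}.
Implicit Types (f g : M -> R) (x y : M) (V W : set M) (i : chart_idx M)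
  (u v : 'rV[R]_d).

Lemma chart_image_open i W : open W ->
  open (cmap (charts i) @` (cdom (charts i) `&` W)).
Proof.
move=> oW; rewrite openE => _ [x [ix Wx] <-].
have ic : (cmap (charts i) @` cdom (charts i)) (cmap (charts i) x) by exists x.
have n1 := open_nbhs_nbhs (conj (@cimg_open _ _ _ (charts i)) ic).
have /cinv_continuous c := ic.
have n2 : nbhs (cmap (charts i) x) (cinv (charts i) @^-1` W).
  by apply: c; rewrite cmapK//; exact: open_nbhs_nbhs.
apply: filterS2 n1 n2 => _ [y iy <-] /=; rewrite cmapK// => Wy.
by exists y.
Qed.

Lemma smooth_on_local W f :
  (forall x, W x -> exists2 V, V x & smooth_on V f) -> smooth_on W f.
Proof.
move=> H i k; apply: Ck_on_local => _ [x [ix Wx] <-].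
have [V Vx Vf] := H _ Wx.
exists (cmap (charts i) @` (cdom (charts i) `&` V)); first by exists x.
exact: Vf.
Qed.

Lemma smooth_on_sub V W f : V `<=` W -> smooth_on W f -> smooth_on V f.
Proof. by move=> VW Wf; apply: smooth_on_local => x /VW Wx; exists W. Qed.

Lemma smooth_smooth_on W f : smooth f -> smooth_on W f.
Proof. exact: smooth_on_sub. Qed.

Lemma smooth_on_ext W f g : open W -> (forall x, W x -> f x = g x) ->
  smooth_on W f -> smooth_on W g.
Proof.
move=> oW fg Wf i k.
apply: Ck_on_ext (@chart_image_open i W oW) _ (Wf i k) => _ [x [ix Wx] <-].
by rewrite cmapK// fg.
Qed.

Lemma smooth_on_cst W (c : R) : smooth_on W (fun=> c).
Proof. by move=> i k; exact: Ck_on_cst. Qed.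

Lemma smooth_onD W f g : open W -> smooth_on W f -> smooth_on W g ->
  smooth_on W (fun x => f x + g x).
Proof.
by move=> oW Wf Wg i k; exact: Ck_onD (@chart_image_open i W oW) (Wf i k) (Wg i k).
Qed.

Lemma smooth_onM W f g : open W -> smooth_on W f -> smooth_on W g ->
  smooth_on W (fun x => f x * g x).
Proof.
by move=> oW Wf Wg i k; exact: Ck_onM (@chart_image_open i W oW) (Wf i k) (Wg i k).
Qed.

Lemma smooth_onZ W (c : R) f : open W -> smooth_on W f ->
  smooth_on W (fun x => c * f x).
Proof. by move=> oW; apply: smooth_onM => //; exact: smooth_on_cst. Qed.

Lemma smooth_onN W f : open W -> smooth_on W f -> smooth_on W (fun x => - f x).
Proof.
move=> oW /(smooth_onZ (-1) oW); apply: smooth_on_ext => // x _.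
by rewrite mulN1r.
Qed.

Lemma smooth_onB W f g : open W -> smooth_on W f -> smooth_on W g ->
  smooth_on W (fun x => f x - g x).
Proof. by move=> oW Wf Wg; apply: smooth_onD => //; exact: smooth_onN. Qed.

Lemma smooth_on_sum W (I : Type) (r : seq I) (P : pred I) (F : I -> M -> R) :
  open W -> (forall j, P j -> smooth_on W (F j)) ->
  smooth_on W (fun x => \sum_(j <- r | P j) F j x).
Proof.
move=> oW WF; elim: r => [|j r IH].
  rewrite (_ : (fun x => _) = fun=> 0); first exact: smooth_on_cst.
  by apply/funext => x; rewrite big_nil.
case Pj : (P j); last first.
  rewrite (_ : (fun x => _) = fun x => \sum_(j <- r | P j) F j x)//.
  by apply/funext => x; rewrite big_cons Pj.
rewrite (_ : (fun x => _) = fun x => F j x + \sum_(j <- r | P j) F j x).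
  by apply: smooth_onD => //; exact: WF.
by apply/funext => x; rewrite big_cons Pj.
Qed.

Lemma smooth_on_prod W (I : Type) (r : seq I) (P : pred I) (F : I -> M -> R) :
  open W -> (forall j, P j -> smooth_on W (F j)) ->
  smooth_on W (fun x => \prod_(j <- r | P j) F j x).
Proof.
move=> oW WF; elim: r => [|j r IH].
  rewrite (_ : (fun x => _) = fun=> 1); first exact: smooth_on_cst.
  by apply/funext => x; rewrite big_nil.
case Pj : (P j); last first.
  rewrite (_ : (fun x => _) = fun x => \prod_(j <- r | P j) F j x)//.
  by apply/funext => x; rewrite big_cons Pj.
rewrite (_ : (fun x => _) = fun x => F j x * \prod_(j <- r | P j) F j x).
  by apply: smooth_onM => //; exact: WF.
by apply/funext => x; rewrite big_cons Pj.
Qed.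

Lemma smooth_on_comp W f (I : set R) (G : set (R -> R)) (h : R -> R) :
  open W -> derivation_closed I G -> G h -> (forall x, W x -> I (f x)) ->
  smooth_on W f -> smooth_on W (fun x => h (f x)).
Proof.
move=> oW dG Gh WI Wf i k; apply: (Ck_on_comp _ dG Gh) (Wf i k).
  exact: chart_image_open.
by move=> _ [x [ix Wx] <-]; rewrite cmapK//; exact: WI.
Qed.

Lemma smooth_onV W f : open W -> (forall x, W x -> f x != 0) ->
  smooth_on W f -> smooth_on W (fun x => (f x)^-1).
Proof.
move=> oW f0 Wf; apply: (smooth_on_comp oW inv_pow_closed (h := fun t => t^-1)) f0 Wf.
by exists 1, 1%N; apply/funext => t; rewrite /inv_pow mul1r expr1.
Qed.

Lemma smooth_on_ln W f : open W -> (forall x, W x -> 0 < f x) ->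
  smooth_on W f -> smooth_on W (fun x => ln (f x)).
Proof.
move=> oW f0 Wf; apply: (smooth_on_comp oW ln_closed (h := @ln R)) f0 Wf.
by left.
Qed.

Lemma cinv_cvg x : cinv (charts (chart_at x)) z @[z --> cmap (charts (chart_at x)) x] --> x.
Proof.
have ic : (cmap (charts (chart_at x)) @` cdom (charts (chart_at x)))
   (cmap (charts (chart_at x)) x) by exists x => //; exact: chart_at_dom.
have /cinv_continuous := ic.
by rewrite /prop_for /continuous_at cmapK//; exact: chart_at_dom.
Qed.

Lemma smooth_on_continuous W f x : open W -> smooth_on W f -> W x ->
  {for x, continuous f}.
Proof.
move=> oW Wf Wx; pose c := charts (chart_at x).
have cx : cdom c x := chart_at_dom x.
have [H _] := Wf (chart_at x) 0%N.
have {}H := H (cmap c x) (ex_intro2 _ _ x (conj cx Wx) erefl).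
have C := continuous_comp (cmap_continuous cx) H.
rewrite /prop_for /continuous_at.
rewrite -[X in _ --> X](_ : f (cinv c (cmap c x)) = f x); last by rewrite cmapK.
apply: cvg_trans C; apply: near_eq_cvg.
apply: filterS (open_nbhs_nbhs (conj (cdom_open c) cx)) => y cy /=.
by rewrite cmapK.
Qed.

Definition smooth_near x f := exists2 W, open_nbhs x W & smooth_on W f.

Lemma smooth_near_on W x f : open W -> W x -> smooth_on W f -> smooth_near x f.
Proof. by move=> oW Wx Wf; exists W. Qed.

Lemma smooth_smooth_near x f : smooth f -> smooth_near x f.
Proof. by exists setT => //; split => //; exact: openT. Qed.

Lemma smooth_on_near W f : (forall x, W x -> smooth_near x f) -> smooth_on W f.
Proof.
move=> H; apply: smooth_on_local => x /H[V [_ Vx] Vf]; by exists V.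
Qed.

Lemma smooth_near_ext x f g : smooth_near x f -> (\near x, f x = g x) ->
  smooth_near x g.
Proof.
move=> [W [oW Wx] Wf] fg.
have : nbhs x [set y | f y = g y] by exact: fg.
rewrite nbhsE => -[V [oV Vx] {}fg].
exists (W `&` V); first by split; [exact: openI|].
apply: (@smooth_on_ext _ f); first exact: openI.
  by move=> y [_ /fg].
by apply: smooth_on_sub Wf => y [].
Qed.

Lemma smooth_nearI x f g : smooth_near x f -> smooth_near x g ->
  exists2 W, open_nbhs x W & smooth_on W f /\ smooth_on W g.
Proof.
move=> [V [oV Vx] Vf] [W [oW Wx] Wg]; exists (V `&` W).
  by split=> //; exact: openI.
by split; [apply: smooth_on_sub Vf|apply: smooth_on_sub Wg] => y [].
Qed.

Lemma smooth_near_differentiable x f : smooth_near x f ->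
  differentiable (fun z => f (cinv (charts (chart_at x)) z) : R^o)
    (cmap (charts (chart_at x)) x).
Proof.
move=> [W [oW Wx] Wf].
apply: (Cinf_on_differentiable (@chart_image_open (chart_at x) W oW)).
  exact: Wf.
by exists x => //; split => //; exact: chart_at_dom.
Qed.

Lemma near_eq_tderive x v f g : (\near x, f x = g x) ->
  tderive x v f = tderive x v g.
Proof. by move=> fg; apply: near_eq_derive; exact: (@cinv_cvg x _ fg). Qed.

Lemma tderive_cst x v (c : R) : tderive x v (fun=> c) = 0.
Proof. exact: derive_cst. Qed.

Lemma tderiveD x v f g : smooth_near x f -> smooth_near x g ->
  tderive x v (fun y => f y + g y) = tderive x v f + tderive x v g.
Proof.
move=> /smooth_near_differentiable df /smooth_near_differentiable dg.
by rewrite /tderive; apply: deriveD; exact: diff_derivable.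
Qed.

Lemma tderiveM x v f g : smooth_near x f -> smooth_near x g ->
  tderive x v (fun y => f y * g y) = f x * tderive x v g + g x * tderive x v f.
Proof.
move=> /smooth_near_differentiable df /smooth_near_differentiable dg.
rewrite {1}/tderive deriveM; [|exact: diff_derivable..].
by rewrite cmapK//; exact: chart_at_dom.
Qed.

Lemma tderive_comp x v f (h : R -> R) b : smooth_near x f ->
  is_derive (f x : R^o) 1 (h : R^o -> R^o) b ->
  tderive x v (fun y => h (f y)) = b * tderive x v f.
Proof.
move=> /smooth_near_differentiable df dh.
rewrite -(cmapK (chart_at_dom x)) in dh.
have [_ +] := is_derive_comp (diff_derivable (v := v) df) dh.
by move=> <-.
Qed.

Lemma tderive_linear x a u v f : smooth_near x f ->
  tderive x (a *: u + v) f = a * tderive x u f + tderive x v f.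
Proof.
move=> /smooth_near_differentiable df.
by rewrite /tderive !deriveE// linearP.
Qed.

Lemma tderive0 x f : tderive x 0 f = 0.
Proof. exact: derive0. Qed.

(** The composite is restricted to the curve s |-> G (z + s v), for which derivability in one
    variable already gives differentiability; this avoids assembling a differential of G from its
    coordinates. *)
Lemma derive_chain (n p : nat) (F : 'rV[R]_p -> R^o) (G : 'rV[R]_n -> 'rV[R]_p)
    (z v : 'rV[R]_n) :
  differentiable F (G z) -> (forall k, differentiable (fun y : 'rV[R]_n => G y 0 k : R^o) z) ->
  'D_v (F \o G : _ -> R^o) z =
  \sum_k 'D_v (fun y : 'rV[R]_n => G y 0 k : R^o) z * 'D_(delta_mx 0 k) F (G z).
Proof.
move=> dF dG.
have dGv : derivable G z v.
  by apply/derivable_mxP => i k; rewrite ord1; exact: diff_derivable.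
pose c (s : R^o) := G (s *: v + z).
have c0 : c 0 = G z by rewrite /c scale0r add0r.
have dc : differentiable c (0 : R^o).
  by apply/derivable1_diffP; move/derivable1P : dGv.
have Dc : 'd c (0:R^o) (1:R) = 'D_v G z.
  rewrite -deriveE// /derive; congr lim.
  rewrite (_ : (fun h => _) = fun h : R => h^-1 *: ((G \o shift z) (h *: v) - G z))//.
  by apply/funext => h /=; rewrite c0 /c addr0 [_%:A]mulr1.
have dFc : differentiable F (c 0) by rewrite c0.
have E : 'D_v (F \o G : _ -> R^o) z = 'D_1 (F \o c : R^o -> R^o) 0.
  rewrite /derive; congr lim.
  rewrite [in RHS](_ : (fun h => _) =
    fun h : R => h^-1 *: ((F \o G \o shift z) (h *: v) - (F \o G) z))//.
  by apply/funext => h /=; rewrite c0 /c addr0 [_%:A]mulr1.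
rewrite E deriveE; last exact: differentiable_comp.
rewrite diff_comp//= Dc c0 -deriveE// derive_coord//.
by apply: eq_bigr => k _; rewrite derive_mx// !mxE.
Qed.

(** [tderive] uses the chart [chart_at x], which may jump as x varies; to see smoothness in x, the
    derivative must be written in one fixed chart. The components of v there are its derivatives of
    the coordinate functions. *)
Lemma tderive_chart x v f i : cdom (charts i) x -> smooth_near x f ->
  tderive x v f = \sum_k tderive x v (fun y => cmap (charts i) y 0 k) *
    'D_(delta_mx 0 k) (fun z => f (cinv (charts i) z) : R^o) (cmap (charts i) x).
Proof.
move=> ix [W [oW Wx] Wf].
pose c := charts (chart_at x).
have cx : cdom c x := chart_at_dom x.
pose F z := f (cinv (charts i) z) : R^o.
pose G z := cmap (charts i) (cinv c z).
have Gx : G (cmap c x) = cmap (charts i) x by rewrite /G cmapK.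
transitivity ('D_v (F \o G : _ -> R^o) (cmap c x)).
  apply: near_eq_derive.
  have := @cinv_cvg x _ (open_nbhs_nbhs (conj (cdom_open (charts i)) ix)).
  by apply: (@filterS _ (nbhs (cmap c x))) => z iz; rewrite /F /G /= cmapK.
rewrite derive_chain ?Gx//.
  apply: (Cinf_on_differentiable (@chart_image_open i W oW)) (Wf i) _.
  by exists x.
move=> k; have oci := @chart_image_open (chart_at x) _ (cdom_open (charts i)).
apply: (Cinf_on_differentiable oci (@chart_change_smooth R d M (chart_at x) i k)).
by exists x.
Qed.

Lemma smooth_on_chart i k : smooth_on (cdom (charts i)) (fun y => cmap (charts i) y 0 k).
Proof. by move=> j; exact: chart_change_smooth. Qed.

End SmoothFunctions.

Section Bump.
Context {R : realType} {d : nat} {M : manifold R d}.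
Implicit Types (f g : M -> R) (x y : M) (V W N : set M).

Lemma flat_exp0_ge0 (t : R) : 0 <= flat_exp 0 t.
Proof. by rewrite /flat_exp; case: ifP => // t0; rewrite expr0 mul1r expR_ge0. Qed.

Lemma flat_exp0_gt0 (t : R) : 0 < t -> 0 < flat_exp 0 t.
Proof. by move=> t0; rewrite /flat_exp t0 expr0 mul1r expR_gt0. Qed.

Lemma flat_exp0_le0 (t : R) : t <= 0 -> flat_exp 0 t = 0.
Proof. by move=> t0; rewrite /flat_exp ltNge t0. Qed.

Definition smooth_step (t : R) : R :=
  flat_exp 0 t * (flat_exp 0 t + flat_exp 0 (1 - t))^-1.

Lemma smooth_step_den (t : R) : flat_exp 0 t + flat_exp 0 (1 - t) != 0.
Proof.
rewrite gt_eqF//; have [t0|t0] := ltP 0 t.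
  by rewrite ltr_pwDl ?flat_exp0_gt0// flat_exp0_ge0.
by rewrite ltr_wpDl ?flat_exp0_ge0// flat_exp0_gt0// subr_gt0 (le_lt_trans t0).
Qed.

Lemma smooth_step_le0 (t : R) : t <= 0 -> smooth_step t = 0.
Proof. by move=> t0; rewrite /smooth_step flat_exp0_le0// mul0r. Qed.

Lemma smooth_step_ge1 (t : R) : 1 <= t -> smooth_step t = 1.
Proof.
move=> t1; rewrite /smooth_step.
have := smooth_step_den t; rewrite [flat_exp 0 (1 - t)]flat_exp0_le0 ?subr_le0// addr0.
by move=> ?; rewrite divff.
Qed.

Lemma smooth_on_step W f : open W -> smooth_on W f ->
  smooth_on W (fun x => smooth_step (f x)).
Proof.
move=> oW Wf.
have h1 : smooth_on W (fun x => flat_exp 0 (f x)).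
  by apply: (smooth_on_comp oW flat_span_closed) Wf => //; exact: flat_span_base.
have h2 : smooth_on W (fun x => flat_exp 0 (1 - f x)).
  apply: (smooth_on_comp oW flat_span_closed) => //; first exact: flat_span_base.
  by apply: smooth_onB => //; exact: smooth_on_cst.
apply: smooth_onM => //; apply: smooth_onV => //.
  by move=> x _; exact: smooth_step_den.
exact: smooth_onD.
Qed.

Lemma compact_box (z : 'rV[R]_d) (r : R) :
  compact [set v : 'rV[R]_d | forall i, `|v 0 i - z 0 i| <= r].
Proof.
have := @rV_compact R^o d (fun i => `[z 0 i - r, z 0 i + r]%classic)
  (fun i => @segment_compact R _ _).
congr compact; apply/seteqP; split=> v /= H i; have := H i.
  by rewrite in_itv/= ler_norml => /andP[? ?]; apply/andP; split; lra.
by rewrite in_itv/= ler_norml => /andP[? ?]; apply/andP; split; lra.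
Qed.

(** The function is supported in a compact set K of the chart domain. As M is Hausdorff, K is
    closed, so the extension by 0 is smooth on the open complement of K. *)
Lemma bump_exists x N : open_nbhs x N ->
  exists chi : M -> R, exists K : set M,
    [/\ smooth chi, \forall y \near x, chi y = 1, closed K, K `<=` N &
        forall y, ~ K y -> chi y = 0].
Proof.
move=> [oN Nx].
pose c := charts (chart_at x); pose z0 := cmap c x.
have cx : cdom c x := chart_at_dom x.
have : nbhs z0 (cmap c @` (cdom c `&` N)).
  apply: open_nbhs_nbhs; split; first exact: chart_image_open.
  by exists x.
move=> /nbhs_ballP[r /= r0 br].
pose B := [set v : 'rV[R]_d | forall i, `|v 0 i - z0 0 i| <= r / 2].
have BN v : B v -> (cmap c @` (cdom c `&` N)) v.
  move=> Bv; apply: br; rewrite -ball_normE /ball_/=.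
  apply: (@le_lt_trans _ _ (r / 2)); last by lra.
  rewrite [leLHS]/Num.Def.normr/= mx_normrE bigmax_le//=; first lra.
  by move=> -[i j] _ /=; rewrite !mxE ord1 distrC.
pose K := cinv c @` B.
have KN y : K y -> cdom c y /\ N y.
  by move=> [v /BN[y' [cy' Ny'] <-] <-]; rewrite cmapK.
have cK : closed K.
  apply: compact_closed; first exact: manifold_hausdorff.
  apply: continuous_compact; last exact: compact_box.
  apply: continuous_in_subspaceT => v; rewrite inE => /BN[y [cy Ny] <-].
  by apply: cinv_continuous; exists y.
(* Since s (r / 2) ^ 2 = 2, a point with one coordinate farther than r / 2 from [z0] has q <= 0,
   where the step is 0; and q x = 2 > 1, so the step is 1 near x. *)
pose s := 8 / r ^+ 2.
have s0 : 0 < s by rewrite divr_gt0// exprn_gt0.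
pose q y := 2 - s * \sum_k (cmap c y 0 k - z0 0 k) * (cmap c y 0 k - z0 0 k).
have qs : smooth_on (cdom c) q.
  apply: smooth_onB; [exact: cdom_open|exact: smooth_on_cst|].
  apply: smooth_onZ; first exact: cdom_open.
  apply: smooth_on_sum => [|k _]; first exact: cdom_open.
  have h : smooth_on (cdom c) (fun y => cmap c y 0 k - z0 0 k).
    apply: smooth_onB; [exact: cdom_open|exact: smooth_on_chart|exact: smooth_on_cst].
  by apply: smooth_onM => //; exact: cdom_open.
pose chi y : R := if y \in cdom c then smooth_step (q y) else 0.
have chiK y : ~ K y -> chi y = 0.
  rewrite /chi; case: ifPn => // /set_mem cy Ky.
  rewrite smooth_step_le0//.
  have [i hi] : exists i, r / 2 < `|cmap c y 0 i - z0 0 i|.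
    apply/not_existsP => H; apply: Ky; exists (cmap c y); last by rewrite cmapK.
    by move=> i; rewrite leNgt; apply/negP/H.
  rewrite /q subr_le0 (bigD1 i)//=.
  apply: (@le_trans _ _ (s * (r / 2) ^+ 2)).
    by rewrite /s le_eqVlt; apply/orP; left; apply/eqP; field; rewrite gt_eqF.
  rewrite ler_wpM2l ?(ltW s0)// -expr2 -(real_normK (num_real (_ - _))).
  rewrite ler_wpDr//; last by rewrite lerXn2r ?nnegrE ?normr_ge0 ?ltW// divr_gt0.
  by apply: sumr_ge0 => k _; rewrite -expr2 sqr_ge0.
exists chi, K; split=> //; last by move=> y /KN[].
- apply: smooth_on_local => y _; have [cy|ncy] := pselect (cdom c y).
    exists (cdom c) => //.
    apply: (@smooth_on_ext _ _ _ _ (fun y => smooth_step (q y))).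
    + exact: cdom_open.
    + by move=> z cz; rewrite /chi mem_set.
    + by apply: smooth_on_step => //; exact: cdom_open.
  exists (~` K); first by move=> /KN[].
  apply: (@smooth_on_ext _ _ _ _ (fun=> 0)); first exact: closed_openC.
    by move=> z /chiK.
  exact: smooth_on_cst.
- have cq : {for x, continuous q}.
    by apply: (smooth_on_continuous (cdom_open c) qs).
  have qx : q x = 2.
    by rewrite /q big1 ?mulr0 ?subr0// => k _; rewrite subrr mulr0.
  have h1 : \forall y \near x, 1 < q y.
    have q1 : (1 : R) < q x by rewrite qx ltrDl.
    exact: (cq _ (lt_nbhsr q1)).
  apply: filterS2 h1 (open_nbhs_nbhs (conj (cdom_open c) cx)) => y qy cy.
  by rewrite /chi mem_set// smooth_step_ge1// ltW.
Qed.

Lemma cutoff_smooth_on (chi : M -> R) (K N V : set M) f :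
  smooth chi -> closed K -> open N -> K `<=` N -> (forall y, ~ K y -> chi y = 0) ->
  open V -> smooth_on (N `&` V) f -> smooth_on V (fun y => chi y * f y).
Proof.
move=> sc cK oN KN cK0 oV Vf; apply: smooth_on_local => y Vy.
have [Ny|nNy] := pselect (N y).
  exists (N `&` V) => //; apply: smooth_onM => //; first exact: openI.
  exact: smooth_smooth_on.
exists (~` K); first by move=> /KN.
apply: (@smooth_on_ext _ _ _ _ (fun=> 0)); first exact: closed_openC.
  by move=> z /cK0 ->; rewrite mul0r.
exact: smooth_on_cst.
Qed.

(** Lets axioms stated for globally smooth functions be applied to germs. *)
Lemma smooth_extension x f : smooth_near x f ->
  exists2 g : M -> R, smooth g & \near x, f x = g x.
Proof.
move=> [N oN Nf]; have [chi [K [sc c1 cK KN c0]]] := bump_exists oN.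
exists (fun y => chi y * f y).
  apply: (cutoff_smooth_on sc cK oN.1 KN c0 openT).
  by apply: smooth_on_sub Nf => y [].
by apply: filterS c1 => y ->; rewrite mul1r.
Qed.

End Bump.

(** * Functions differentiated along sections *)

Section Actions.
Context {R : realType} {d : nat} {M : manifold R d} {m : nat}.
Context {A : vbundle M m} (L : lie_algebroid A).
Implicit Types (f g : M -> R) (x y : M) (V W N : set M) (X Y : section A).

Lemma Ck_on_sum k (U : set 'rV[R]_d) (I : finType) (F : I -> 'rV[R]_d -> R^o) :
  open U -> (forall j, Ck_on k U (F j)) -> Ck_on k U (fun z => \sum_j F j z).
Proof.
move=> oU UF; elim: (index_enum I) => [|j r IH].
  rewrite (_ : (fun z => _) = cst 0); first exact: Ck_on_cst.
  by apply/funext => z; rewrite big_nil.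
rewrite (_ : (fun z => _) = fun z => F j z + \sum_(j <- r) F j z).
  exact: Ck_onD.
by apply/funext => z; rewrite big_cons.
Qed.

Lemma smooth_on_act W X f : open W -> smooth_sec X -> smooth_on W f ->
  smooth_on W (act L X f).
Proof.
move=> oW sX Wf i k; set U := cmap _ @` _.
have oU : open U by exact: chart_image_open.
pose F (z : 'rV[R]_d) : R^o := f (cinv (charts i) z).
apply: (@Ck_on_ext _ _ k U (fun z => \sum_(l < d) tderive (cinv (charts i) z)
    (anchor L _ (X (cinv (charts i) z))) (fun y => cmap (charts i) y 0 l) *
    'D_(delta_mx 0 l) F z)) => //.
  move=> _ [x [ix Wx] <-].
  rewrite /act cmapK// (tderive_chart _ ix); last exact: smooth_near_on Wf.
  by [].
apply: Ck_on_sum => // l; apply: Ck_onM => //.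
  have := @anchor_smooth _ _ _ _ _ L X sX i l i k; apply: Ck_on_sub => _ [x [ix Wx] <-].
  by exists x.
exact: Cinf_on_derive (Wf i) k.
Qed.

Lemma smooth_act X f : smooth_sec X -> smooth f -> smooth (act L X f).
Proof. by apply: smooth_on_act; exact: openT. Qed.

Lemma near_eq_act x X f g : (\near x, f x = g x) ->
  act L X f x = act L X g x.
Proof. exact: near_eq_tderive. Qed.

Lemma near_eq_act_near x X f g : (\near x, f x = g x) ->
  \near x, act L X f x = act L X g x.
Proof.
move=> fg; have : nbhs x (fun y => f y = g y)°.
  by apply/nbhs_interior; exact: fg.
by apply: filterS => y; exact: near_eq_act.
Qed.

Lemma act_bracket x X Y f : smooth_sec X -> smooth_sec Y -> smooth_near x f ->
  act L (bracket L X Y) f x = act L X (act L Y f) x - act L Y (act L X f) x.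
Proof.
move=> sX sY /smooth_extension[g sg fg].
rewrite (near_eq_act _ fg) (near_eq_act X (near_eq_act_near Y fg)).
rewrite (near_eq_act Y (near_eq_act_near X fg)).
exact: anchor_bracket.
Qed.

End Actions.

(** * Alternating forms *)

Section UpdTheory.
Variables (T : Type) (k : nat).
Implicit Types (v : 'I_k -> T) (i j : 'I_k).

Lemma upd_same v i t : upd v i t i = t.
Proof. by rewrite /upd eqxx. Qed.

Lemma upd_other v i j t : j != i -> upd v i t j = v j.
Proof. by rewrite /upd => /negbTE->. Qed.

Lemma upd_id v i : upd v i (v i) = v.
Proof. by apply/funext => j; rewrite /upd; case: eqP => // ->. Qed.

Lemma upd_upd v i s t : upd (upd v i s) i t = upd v i t.
Proof. by apply/funext => j; rewrite /upd; case: eqP. Qed.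

Lemma updC v i j s t : i != j -> upd (upd v i s) j t = upd (upd v j t) i s.
Proof.
move=> ij; apply/funext => l; rewrite /upd.
have [->|//] := eqVneq l j; by rewrite eq_sym (negbTE ij).
Qed.

Lemma upd_one (v : 'I_1 -> T) t : upd v ord0 t = fun=> t.
Proof. by apply/funext => l; rewrite /upd ord1. Qed.

End UpdTheory.

(** The multi-index (J, l). J comes first because [contract] puts its form before the remaining
    argument. *)
Definition snoc (T : Type) (p : nat) (J : 'I_p -> T) (l : T) : 'I_(p + 1) -> T :=
  fun i => match fintype.split i with inl a => J a | inr _ => l end.

Section SnocTheory.
Variables (T : Type) (p : nat).
Implicit Types (J : 'I_p -> T) (l : T).

Lemma snoc_lshift J l a : snoc J l (lshift 1 a) = J a.
Proof. by rewrite /snoc; have := unsplitK (inl a : 'I_p + 'I_1) => /= ->. Qed.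

Lemma snoc_rshift J l a : snoc J l (rshift p a) = l.
Proof. by rewrite /snoc; have := unsplitK (inr a : 'I_p + 'I_1) => /= ->. Qed.

Lemma snoc_upd_l J l a t :
  upd (snoc J l) (lshift 1 a) t = snoc (upd J a t) l.
Proof.
apply/funext => i; rewrite /upd; case: (splitP i) => j ij.
  have -> : i = lshift 1 j by apply: val_inj.
  by rewrite !snoc_lshift (inj_eq (@lshift_inj _ _)).
have -> : i = rshift p j by apply: val_inj.
by rewrite !snoc_rshift eq_rlshift.
Qed.

Lemma snoc_upd_r J l a t : upd (snoc J l) (rshift p a) t = snoc J t.
Proof.
apply/funext => i; rewrite /upd; case: (splitP i) => j ij.
  have -> : i = lshift 1 j by apply: val_inj.
  by rewrite !snoc_lshift eq_lrshift.
have -> : i = rshift p j by apply: val_inj.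
by rewrite !snoc_rshift !ord1 eqxx.
Qed.

Lemma snoc_comp (T' : Type) (g : T -> T') J l :
  (fun i => g (snoc J l i)) = snoc (fun a => g (J a)) (g l).
Proof. by apply/funext => i; rewrite /snoc; case: fintype.split. Qed.

End SnocTheory.

Section Multilinear.
Variables (R : realType) (V : vectType R).

Definition multilinear (k : nat) (w : mform V k) : Prop :=
  forall v i (a : R) (u u' : V),
     w (upd v i (a *: u + u')) = a * w (upd v i u) + w (upd v i u').

Variables (k : nat).
Implicit Types (w : mform V k) (v : 'I_k -> V).

Lemma multilinear0 w v i : multilinear w -> w (upd v i 0) = 0.
Proof.
move=> mw; have := mw v i 1 0 0; rewrite scaler0 addr0 mul1r => /eqP.
by rewrite -subr_eq subrr eq_sym => /eqP.
Qed.

Lemma multilinearD w v i u u' : multilinear w ->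
  w (upd v i (u + u')) = w (upd v i u) + w (upd v i u').
Proof. by move=> mw; rewrite -[u]scale1r mw mul1r scale1r. Qed.

Lemma multilinearZ w v i a u : multilinear w ->
  w (upd v i (a *: u)) = a * w (upd v i u).
Proof. by move=> mw; rewrite -[a *: u]addr0 mw multilinear0// addr0. Qed.

Lemma multilinear_sum w v i (I : Type) (r : seq I) (P : pred I) (a : I -> R) (u : I -> V) :
  multilinear w ->
  w (upd v i (\sum_(j <- r | P j) a j *: u j)) =
  \sum_(j <- r | P j) a j * w (upd v i (u j)).
Proof.
move=> mw; elim: r => [|j r IH]; first by rewrite !big_nil multilinear0.
by rewrite !big_cons; case: ifP => // _; rewrite mw IH.
Qed.

Variables (m : nat) (b : m.-tuple V).
Hypothesis hb : basis_of {:V} b.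

Lemma coord_expand (u : V) : u = \sum_j coord b j u *: tnth b j.
Proof.
rewrite {1}(coord_basis hb (memvf u)).
by apply: eq_bigr => j _; rewrite (tnth_nth 0).
Qed.

Lemma coord_tnth i j : coord b i (tnth b j) = (i == j)%:R.
Proof. by rewrite (tnth_nth 0) coord_free ?(basis_free hb)// eq_sym. Qed.

Lemma multilinear_eq0 w : multilinear w ->
  (forall J : {ffun 'I_k -> 'I_m}, w (fun i => tnth b (J i)) = 0) ->
  forall v, w v = 0.
Proof.
move=> mw w0.
(* Induction on the number n of leading arguments that are still arbitrary; each step expands the
   last of them in the basis. *)
suff H n : (n <= k)%N -> forall v,
    (forall i : 'I_k, (n <= i)%N -> exists j, v i = tnth b j) -> w v = 0.
  by move=> v; apply: (H k) => // i; rewrite leqNgt ltn_ord.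
elim: n => [_ v /(_ _ (leq0n _))|n IH nk v vb].
  move=> /choice[J vJ]; have := w0 [ffun i => J i].
  by congr (_ = _); congr w; apply/funext => i; rewrite ffunE vJ.
pose i := Ordinal nk.
rewrite -(upd_id v i) (coord_expand (v i)) multilinear_sum//.
rewrite big1// => j _; rewrite IH ?mulr0 ?(ltnW nk)// => l nl.
have [->|li] := eqVneq l i; first by exists j; rewrite upd_same.
rewrite upd_other//; apply: vb; rewrite ltn_neqAle nl andbT.
by apply: contra li => /eqP e; apply/eqP/val_inj.
Qed.

Lemma multilinear_ext w w' : multilinear w -> multilinear w' ->
  (forall J : {ffun 'I_k -> 'I_m},
     w (fun i => tnth b (J i)) = w' (fun i => tnth b (J i))) -> w = w'.
Proof.
move=> mw mw' H; apply/funext => v; apply/eqP; rewrite -subr_eq0; apply/eqP.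
apply: (@multilinear_eq0 (fun v => w v - w' v)) => [u i a x y|J].
  by rewrite mw mw' mulrBr opprD addrACA.
by rewrite H subrr.
Qed.

Lemma multilinear_sum_form (I : Type) (r : seq I) (P : pred I) (c : I -> R)
    (F : I -> mform V k) :
  (forall j, P j -> multilinear (F j)) ->
  multilinear (fun v => \sum_(j <- r | P j) c j * F j v).
Proof.
move=> mF v i a u u'; rewrite mulr_sumr -big_split/=.
by apply: eq_bigr => j Pj; rewrite mF// mulrDr mulrCA.
Qed.

Lemma multilinear_prod_coord (J : 'I_k -> 'I_m) :
  multilinear (fun v => \prod_i coord b (J i) (v i)).
Proof.
move=> v i a u u'; rewrite (bigD1 i)//= [X in _ = a * X + _](bigD1 i)//=.
rewrite [X in _ = _ + X](bigD1 i)//= !upd_same linearP mulrDl mulrA.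
by congr (_ * _ + _ * _); apply: eq_bigr => j ji; rewrite !upd_other.
Qed.

Lemma prod_coord_tnth (J J' : {ffun 'I_k -> 'I_m}) :
  \prod_i coord b (J i) (tnth b (J' i)) = (J == J')%:R.
Proof.
have [->|neq] := eqVneq J J'; first by rewrite big1// => i _; rewrite coord_tnth eqxx.
have [i hi] : exists i, J i != J' i.
  apply/existsP; apply: contraNT neq => /existsPn H; apply/eqP/ffunP => i.
  by have := H i; rewrite negbK => /eqP.
by rewrite (bigD1 i)//= coord_tnth (negbTE hi) mul0r.
Qed.

Lemma multilinear_expand w v : multilinear w ->
  w v = \sum_(J : {ffun 'I_k -> 'I_m})
    w (fun i => tnth b (J i)) * \prod_i coord b (J i) (v i).
Proof.
move=> mw.
suff {v} : w = fun v => \sum_(J : {ffun 'I_k -> 'I_m})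
    w (fun i => tnth b (J i)) * \prod_i coord b (J i) (v i).
  by move=> E; rewrite {1}E.
apply: multilinear_ext => //.
  by apply: multilinear_sum_form => J _; exact: multilinear_prod_coord.
move=> J; rewrite (bigD1 J)//= prod_coord_tnth eqxx mulr1 big1 ?addr0// => J' J'J.
by rewrite prod_coord_tnth (negbTE J'J) mulr0.
Qed.

End Multilinear.

Section Alternating.
Variables (R : realType) (V : vectType R).

(** Polarisation: w vanishes when both slots hold v i + v j. *)
Lemma alternating_swap k (w : mform V k) (v : 'I_k -> V) (i j : 'I_k) : alternating w -> i != j ->
  w (fun l => v (tperm i j l)) = - w v.
Proof.
move=> aw ij; have mw := aw.1.
have -> : (fun l => v (tperm i j l)) = upd (upd v i (v j)) j (v i).
  apply/funext => l; rewrite /upd; case: tpermP => [->|->|/eqP/negbTE-> /eqP/negbTE->]//.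
    by rewrite (negbTE ij) eqxx.
  by rewrite eqxx.
have dbl u : w (upd (upd v i u) j u) = 0.
  by apply: (aw.2 _ i j ij); rewrite upd_same upd_other// upd_same.
have D u s t : w (upd (upd v i (s + t)) j u) =
    w (upd (upd v i s) j u) + w (upd (upd v i t) j u).
  by rewrite !(updC _ _ _ ij) multilinearD.
have := dbl (v i + v j); rewrite D !multilinearD// !dbl add0r addr0.
by rewrite upd_id upd_id => /eqP; rewrite addrC addr_eq0 => /eqP.
Qed.

Lemma alternating_perm k (w : mform V k) v (s : 'S_k) : alternating w ->
  w (fun l => v (s l)) = (-1) ^+ s * w v.
Proof.
move=> aw; have [ts -> _] := prod_tpermP s.
elim: ts v => [|t ts IH] v.
  rewrite big_nil odd_perm1 expr0 mul1r; congr w.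
  by apply/funext => l; rewrite perm1.
rewrite big_cons odd_permM signr_addb -mulrA [_ * (_ * w v)]mulrCA.
have -> : (fun l => v ((tperm t.1 t.2 * \prod_(t <- ts) tperm t.1 t.2)%g l)) =
   (fun l => (fun l' => v ((\prod_(t <- ts) tperm t.1 t.2)%g l')) (tperm t.1 t.2 l)).
  by apply/funext => l; rewrite permM.
have [e|ne] := eqVneq t.1 t.2.
  rewrite e tperm1 odd_perm1 expr0 mul1r -IH; congr w.
  by apply/funext => l; rewrite perm1.
rewrite (alternating_swap (fun l => v ((\prod_(t <- ts) tperm t.1 t.2)%g l)) aw ne).
by rewrite IH odd_tperm ne expr1 mulN1r mulrN.
Qed.

(* Deleting one or the other of two equal arguments gives the same value up to
   sign: the two lists differ by the permutation that [lift_perm] turns into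
   a transposition. *)
Lemma alternating_delete k (w : mform V k) (u : 'I_k.+1 -> V) (r t : 'I_k.+1) :
  alternating w -> r != t -> u r = u t ->
  (-1) ^+ r * w (fun i => u (lift r i)) + (-1) ^+ t * w (fun i => u (lift t i)) = 0.
Proof.
move=> aw rt urt.
have H i : tperm r t (lift r i) != t.
  rewrite -[X in _ != X](tpermL r t) (inj_eq perm_inj) eq_sym; exact: neq_lift.
pose sg i := odflt i (unlift t (tperm r t (lift r i))).
have sgE i : lift t (sg i) = tperm r t (lift r i).
  by rewrite /sg; case: unliftP (H i) => [j ->|->]//=; rewrite eqxx.
have sgI : injective sg.
  move=> i j /(congr1 (lift t)); rewrite !sgE => /perm_inj; exact: lift_inj.
pose s := perm sgI.
have Es : lift_perm r t s = tperm r t.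
  apply/permP => i; have [->|ir] := eqVneq i r; first by rewrite lift_perm_id tpermL.
  have /unlift_some[j -> _] : r != i by rewrite eq_sym.
  by rewrite lift_perm_lift permE sgE.
have uE : (fun i => u (lift r i)) = (fun i => (fun j => u (lift t j)) (s i)).
  apply/funext => i; rewrite permE sgE.
  by case: tpermP => [->|->|//]; rewrite urt.
rewrite uE (alternating_perm (fun j => u (lift t j)) s aw).
have := odd_lift_perm r t s; rewrite Es odd_tperm rt => e.
have -> : (-1) ^+ r * ((-1) ^+ s * w (fun j => u (lift t j))) =
   (-1) ^+ (odd r (+) s) * w (fun j => u (lift t j)).
  by rewrite signr_addb signr_odd mulrA.
have -> : odd r (+) s = ~~ odd t.
  by move: e; case: (odd r); case: (odd t); case: (s : bool).
by rewrite signrN signr_odd mulNr addNr.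
Qed.

End Alternating.

(** * Wedge products of covectors as determinants *)

Section Wedge.
Variables (R : realType) (V : vectType R).

Definition covec (phi : V -> R) : mform V 1 := fun v => phi (v ord0).

Lemma covec_alternating (phi : V -> R) :
  (forall a u v, phi (a *: u + v) = a * phi u + phi v) -> alternating (covec phi).
Proof.
move=> lphi; split=> [v i a u u'|v i j]; last by rewrite !ord1.
by rewrite /covec !ord1 !upd_same.
Qed.

Lemma wedge1_upd_row k (phi : 'I_k -> mform V 1) (v : 'I_k -> V) i (psi : mform V 1) :
  wedge1 (upd phi i psi) v =
  \det (\matrix_(a, j) (if a == i then psi (fun=> v j) else phi a (fun=> v j))).
Proof.
congr (\det _); apply/matrixP => a j; rewrite !mxE /upd.
by case: ifP.
Qed.

Lemma wedge1_sum k (phi : 'I_k -> mform V 1) (v : 'I_k -> V) i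
    (I : finType) (c : I -> R) (psi : I -> mform V 1) :
  wedge1 (upd phi i (fun u => \sum_l c l * psi l u)) v =
  \sum_l c l * wedge1 (upd phi i (psi l)) v.
Proof.
rewrite wedge1_upd_row (expand_det_row _ i).
under eq_bigr do rewrite mxE eqxx mulr_suml.
rewrite exchange_big/=; apply: eq_bigr => l _.
rewrite wedge1_upd_row (expand_det_row _ i) mulr_sumr; apply: eq_bigr => j _.
rewrite [X in c l * (X * _)]mxE eqxx mulrA; congr (_ * _).
congr (_ * \det _); apply/matrixP => a b; rewrite !mxE.
by rewrite eq_sym (negbTE (neq_lift _ _)).
Qed.

Lemma wedge1_alternating k (phi : 'I_k -> mform V 1) :
  (forall i, alternating (phi i)) -> alternating (wedge1 phi).
Proof.
move=> aphi; split=> [v i a u u'|v i j ij vij].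
  pose Mx (t : V) := \matrix_(j < k, l < k) phi l (fun=> upd v i t j).
  have E t : wedge1 phi (upd v i t) = \det (Mx t).
    by rewrite /wedge1 -det_tr; congr (\det _); apply/matrixP => x y; rewrite !mxE.
  rewrite E (E u) (E u') -[\det (Mx u')]mul1r.
  apply: (@determinant_multilinear _ _ _ _ _ i).
  - apply/rowP => j; rewrite !mxE !upd_same mul1r.
    have := (aphi j).1 (fun=> u) ord0 a u u'.
    by rewrite !upd_one.
  - apply/matrixP => l j.
    by rewrite !mxE /upd eq_sym (negbTE (neq_lift _ _)).
  - apply/matrixP => l j.
    by rewrite !mxE /upd eq_sym (negbTE (neq_lift _ _)).
rewrite /wedge1 -det_tr; apply: (determinant_alternate ij) => l.
by rewrite !mxE vij.
Qed.

Lemma wedge1_swap k (phi : 'I_k -> mform V 1) i j : i != j ->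
  wedge1 (fun l => phi (tperm i j l)) = fun v => - wedge1 phi v.
Proof.
move=> ij; apply/funext => v.
rewrite /wedge1 (_ : \matrix_(_, _) _ =
  row_perm (tperm i j) (\matrix_(i0, j0) phi i0 (fun=> v j0))); last first.
  by apply/matrixP => a b; rewrite !mxE.
by rewrite row_permE det_mulmx det_perm odd_tperm ij expr1 mulN1r.
Qed.

Variables (m : nat) (b : m.-tuple V).
Hypothesis hb : basis_of {:V} b.

Definition dual (j : 'I_m) : mform V 1 := covec (coord b j).

Lemma dual_alternating j : alternating (dual j).
Proof. by apply: covec_alternating => a u v; rewrite linearP. Qed.

Definition wdual k (J : 'I_k -> 'I_m) : mform V k := wedge1 (fun i => dual (J i)).

Lemma wdual_alternating k (J : 'I_k -> 'I_m) : alternating (wdual J).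
Proof. by apply: wedge1_alternating => i; exact: dual_alternating. Qed.

(** A generalised Kronecker symbol. Entries may repeat, so the signs of all permutations carrying J'
    to J are added, and they cancel in that case. *)
Lemma wdual_tnth k (J J' : {ffun 'I_k -> 'I_m}) :
  wdual J (fun i => tnth b (J' i)) =
  \sum_(s : 'S_k) (-1) ^+ s * (J == [ffun i => J' (s i)])%:R.
Proof.
apply: eq_bigr => s _; congr (_ * _).
rewrite -(prod_coord_tnth hb); apply: eq_bigr => i _.
by rewrite mxE ffunE.
Qed.

(** The sum runs over all multi-indices, hence the factor 1/k!. On a basis tuple J', each
    permutation s contributes only through J = J' o s, and the sign from permuting the arguments of
    w cancels that of s. *)
Lemma alternating_expand k (w : mform V k) : alternating w ->
  w = fun v => \sum_(J : {ffun 'I_k -> 'I_m})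
    (k`!%:R^-1 * w (fun i => tnth b (J i))) * wdual J v.
Proof.
move=> aw; apply: (multilinear_ext hb).
- exact: aw.1.
- apply: multilinear_sum_form => J _; exact: (wdual_alternating J).1.
move=> J'; under eq_bigr do rewrite wdual_tnth mulr_sumr.
rewrite exchange_big/=.
under eq_bigr => s _.
  rewrite (bigD1 [ffun i => J' (s i)])//= eqxx mulr1 big1 ?addr0; last first.
    by move=> J /negbTE->; rewrite !mulr0.
  have -> : w (fun i => tnth b ([ffun i => J' (s i)] i)) =
     w (fun i => (fun l => tnth b (J' l)) (s i)).
    by congr w; apply/funext => i; rewrite ffunE.
  rewrite (alternating_perm (fun l => tnth b (J' l)) s aw).
  rewrite -mulrA [X in _ * X]mulrC [X in _ * X]mulrA -signr_addb addbb mul1r.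
  over.
rewrite /= sumr_const card_Sn -[RHS]mulr_natl mulrA divff ?mul1r//.
Qed.

End Wedge.

(** * Pairings and contractions in a basis *)

Section Pairing.
Variables (R : realType) (V : vectType R).

Lemma alternating_sum k (I : Type) (r : seq I) (P : pred I) (c : I -> R)
    (F : I -> mform V k) : (forall j, P j -> alternating (F j)) ->
  alternating (fun v => \sum_(j <- r | P j) c j * F j v).
Proof.
move=> aF; split.
  by apply: multilinear_sum_form => j /aF[].
by move=> v i j ij vij; rewrite big1// => l /aF[_ H]; rewrite (H _ _ _ ij vij) mulr0.
Qed.

Lemma alternating_comb k a (w w' : mform V k) : alternating w -> alternating w' ->
  alternating (fun v => a * w v + w' v).
Proof.
move=> aw aw'; split=> [v i c u u'|v i j ij vij].
  rewrite aw.1 aw'.1 !mulrDr [a * (c * _)]mulrCA !addrA; congr (_ + _).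
  by rewrite -!addrA; congr (_ + _); rewrite addrC.
by rewrite (aw.2 _ _ _ ij vij) (aw'.2 _ _ _ ij vij) mulr0 addr0.
Qed.

Lemma mvec_linear_sum k (xi : mvec V k) (I : Type) (r : seq I) (P : pred I)
    (c : I -> R) (F : I -> mform V k) :
  mvec_linear xi -> (forall j, P j -> alternating (F j)) ->
  xi (fun v => \sum_(j <- r | P j) c j * F j v) =
  \sum_(j <- r | P j) c j * xi (F j).
Proof.
move=> lxi aF; elim: r => [|j r IH].
  rewrite big_nil.
  have a0 : alternating (fun _ : 'I_k -> V => 0 : R).
    by split=> // v i a u u'; rewrite mulr0 addr0.
  rewrite (_ : (fun v => _) = fun=> 0); last by apply/funext => v; rewrite big_nil.
  have := lxi 1 _ _ a0 a0; rewrite (_ : (fun v => _) = fun=> 0); last first.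
    by apply/funext => v; rewrite mulr0 addr0.
  by rewrite mul1r => /eqP; rewrite -subr_eq subrr eq_sym => /eqP.
rewrite big_cons; case Pj : (P j); last first.
  by rewrite -IH; congr xi; apply/funext => v; rewrite big_cons Pj.
rewrite -IH -lxi; [|exact: aF|exact: alternating_sum].
by congr xi; apply/funext => v; rewrite big_cons Pj.
Qed.

Variable p : nat.

Definition block_perm_fun (t : 'S_p) (i : 'I_(p + 1)) : 'I_(p + 1) :=
  match fintype.split i with inl a => lshift 1 (t a) | inr b => rshift p b end.

Lemma block_perm_fun_l t a : block_perm_fun t (lshift 1 a) = lshift 1 (t a).
Proof. by rewrite /block_perm_fun; have := unsplitK (inl a : 'I_p + 'I_1) => /= ->. Qed.

Lemma block_perm_fun_r t a : block_perm_fun t (rshift p a) = rshift p a.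
Proof. by rewrite /block_perm_fun; have := unsplitK (inr a : 'I_p + 'I_1) => /= ->. Qed.

Lemma block_perm_inj t : injective (block_perm_fun t).
Proof.
move=> i j; rewrite -[i]splitK -[j]splitK.
case: (fintype.split i) => a; case: (fintype.split j) => b /=;
  rewrite ?block_perm_fun_l ?block_perm_fun_r.
- by move=> /lshift_inj/perm_inj ->.
- by move=> /eqP; rewrite eq_lrshift.
- by move=> /eqP; rewrite eq_rlshift.
- by [].
Qed.

Definition block_perm t : 'S_(p + 1) := perm (@block_perm_inj t).

(** Both signs are determinants of permutation matrices, and that of [block_perm t] is block
    diagonal with blocks that of t and 1. *)
Lemma odd_block_perm t : (-1) ^+ (block_perm t) = (-1) ^+ t :> R.
Proof.
rewrite -!det_perm.
have -> : perm_mx (block_perm t) = block_mx (perm_mx t) 0 0 (1%:M : 'M[R]_1).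
  apply/matrixP => i j; rewrite -[i]splitK -[j]splitK.
  case: (fintype.split i) => a; case: (fintype.split j) => b /=.
  - by rewrite block_mxEul !mxE permE block_perm_fun_l (inj_eq (@lshift_inj _ _)).
  - by rewrite block_mxEur !mxE permE block_perm_fun_l eq_lrshift.
  - by rewrite block_mxEdl !mxE permE block_perm_fun_r eq_rlshift.
  - by rewrite block_mxEdr !mxE permE block_perm_fun_r (inj_eq (@rshift_inj _ _)).
by rewrite det_lblock det1 mulr1.
Qed.

(** For each t in the expansion of the inner determinant, translating the sum over permutations of p
    + 1 elements by [block_perm t] absorbs t and its sign. The p! equal contributions cancel the
    normalisation of [wedge]. *)
Lemma wedge_wedge1 (phi : 'I_p -> mform V 1) (psi : mform V 1) :
  wedge (wedge1 phi) psi = wedge1 (snoc phi psi).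
Proof.
apply/funext => v; rewrite /wedge.
under eq_bigr => s _ do rewrite mulr_suml mulr_sumr.
rewrite exchange_big/=.
under eq_bigr => t _.
  rewrite (reindex_inj (mulgI (block_perm t)^-1)%g)/=.
  under eq_bigr => s _.
    rewrite odd_permM odd_permV signr_addb odd_block_perm.
    rewrite (_ : _ * _ = (-1) ^+ s * \prod_i snoc phi psi i (fun=> v (s i))).
      over.
    rewrite big_split_ord/= big_ord1 snoc_rshift !mulrA.
    rewrite (mulrAC _ _ ((-1) ^+ t)) -signr_addb addbb mul1r; congr (_ * _ * _).
      apply: eq_bigr => i _; rewrite mxE snoc_lshift; congr (phi _ _).
      apply/funext => _; rewrite permM; congr (v (s _)).
      apply: (@perm_inj _ (block_perm t)); rewrite permKV.
      by rewrite permE block_perm_fun_l.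
    congr psi; apply/funext => j; rewrite permM ord1; congr (v (s _)).
    apply: (@perm_inj _ (block_perm t)); rewrite permKV.
    by rewrite permE block_perm_fun_r.
  over.
rewrite /= sumr_const card_Sn -[X in _ * X]mulr_natl mulrA muln1 mulVf ?mul1r.
  apply: eq_bigr => s _; congr (_ * _); apply: eq_bigr => i _.
  by rewrite mxE.
by rewrite pnatr_eq0 -lt0n fact_gt0.
Qed.

Lemma wedge_suml q (I : finType) (c : I -> R) (F : I -> mform V p) (psi : mform V q) :
  wedge (fun v => \sum_j c j * F j v) psi = fun v => \sum_j c j * wedge (F j) psi v.
Proof.
apply/funext => v; rewrite /wedge.
under eq_bigr do rewrite mulr_suml mulr_sumr.
rewrite exchange_big/= mulr_sumr; apply: eq_bigr => j _.
rewrite [RHS]mulrCA; congr (_ * _); rewrite mulr_sumr; apply: eq_bigr => s _.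
by rewrite -!mulrA [LHS]mulrCA.
Qed.

Lemma wedge_combr q a (w : mform V p) (psi psi' : mform V q) :
  wedge w (fun v => a * psi v + psi' v) =
  fun v => a * wedge w psi v + wedge w psi' v.
Proof.
apply/funext => v; rewrite /wedge [X in X + _]mulrCA -mulrDr; congr (_ * _).
rewrite mulr_sumr -big_split/=; apply: eq_bigr => s _.
by rewrite !mulrDr; congr (_ + _); rewrite [w _ * (a * _)]mulrCA [LHS]mulrCA.
Qed.

Variables (m : nat) (b : m.-tuple V).
Hypothesis hb : basis_of {:V} b.

Lemma snoc_alternating (J : 'I_p -> 'I_m) (psi : mform V 1) : alternating psi ->
  forall i, alternating (snoc (fun a => dual b (J a)) psi i).
Proof.
by move=> apsi i; rewrite /snoc; case: fintype.split => // a; exact: dual_alternating.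
Qed.

Lemma wedge_expand (w : mform V p) (psi : mform V 1) : alternating w ->
  wedge w psi = fun v => \sum_(J : {ffun 'I_p -> 'I_m})
    (p`!%:R^-1 * w (fun i => tnth b (J i))) *
    wedge1 (snoc (fun a => dual b (J a)) psi) v.
Proof.
move=> aw; rewrite {1}(alternating_expand hb aw) wedge_suml.
by apply/funext => v; apply: eq_bigr => J _; rewrite wedge_wedge1.
Qed.

Lemma wedge_alternating (w : mform V p) (psi : mform V 1) :
  alternating w -> alternating psi -> alternating (wedge w psi).
Proof.
move=> aw apsi; rewrite (wedge_expand _ aw); apply: alternating_sum => J _.
by apply: wedge1_alternating; exact: snoc_alternating.
Qed.

(** Removes the basis chosen in the definition of [vec_of_mvec]: the vector is characterised by its
    values under linear functionals. *)
Lemma vec_of_mvecE (eta : mvec V 1) (phi : V -> R) : mvec_linear eta ->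
  (forall a u v, phi (a *: u + v) = a * phi u + phi v) ->
  phi (vec_of_mvec eta) = eta (covec phi).
Proof.
move=> leta lphi; pose B := vbasis {:V}; have hB : basis_of {:V} B := vbasisP _.
have phi0 : phi 0 = 0.
  by have := lphi 1 0 0; rewrite scaler0 addr0 mul1r => /eqP;
     rewrite -subr_eq subrr eq_sym => /eqP.
have phi_sum (c : 'I_(\dim {:V}) -> R) (u : 'I_(\dim {:V}) -> V) :
    phi (\sum_j c j *: u j) = \sum_j c j * phi (u j).
  elim: (index_enum _) => [|j r IH]; first by rewrite !big_nil.
  by rewrite !big_cons lphi IH.
rewrite /vec_of_mvec phi_sum.
have -> : covec phi = fun v => \sum_j phi (tnth B j) * dual B j v.
  apply/funext => v; rewrite /covec {1}(coord_expand hB (v ord0)) phi_sum.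
  by apply: eq_bigr => j _; rewrite mulrC.
rewrite mvec_linear_sum//; last by move=> j _; exact: dual_alternating.
by apply: eq_bigr => j _; rewrite mulrC (tnth_nth 0).
Qed.

Lemma contract_mvec_linear (w : mform V p) (xi : mvec V (p + 1)) :
  alternating w -> mvec_linear xi -> mvec_linear (fun psi => xi (wedge w psi)).
Proof.
move=> aw lxi a psi psi' apsi apsi'; rewrite wedge_combr lxi//;
  exact: wedge_alternating.
Qed.

Lemma coord_contract (w : mform V p) (xi : mvec V (p + 1)) l :
  alternating w -> mvec_linear xi ->
  coord b l (vec_of_mvec (fun psi => xi (wedge w psi))) =
  p`!%:R^-1 * \sum_(J : {ffun 'I_p -> 'I_m})
    w (fun i => tnth b (J i)) * xi (wdual b (snoc J l)).
Proof.
move=> aw lxi; rewrite vec_of_mvecE; last 2 first.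
- exact: contract_mvec_linear.
- by move=> a u v; rewrite linearP.
rewrite wedge_expand// mvec_linear_sum//; last first.
  move=> J _; apply: wedge1_alternating; apply: snoc_alternating.
  exact: dual_alternating.
rewrite mulr_sumr; apply: eq_bigr => J _; rewrite mulrA; congr (_ * xi _).
by rewrite /wdual (snoc_comp (dual b)).
Qed.

(** In top degree an injective multi-index is a permutation of the basis, and any other one repeats
    a vector. *)
Lemma top_form_eq0 (w : mform V m) : alternating w ->
  w (fun i => tnth b i) = 0 -> forall v, w v = 0.
Proof.
move=> aw w0; apply: (multilinear_eq0 hb aw.1) => J.
have [Jinj|] := boolP (injectiveb J).
  have := alternating_perm (fun i => tnth b i) (perm (injectiveP _ Jinj)) aw.
  rewrite w0 mulr0 => <-; congr w; apply/funext => i; by rewrite permE.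
by move=> /injectivePn[i [j ij Jij]]; apply: (aw.2 _ i j) => //; rewrite Jij.
Qed.

Lemma mvec_pairing k (w : mform V k) (xi : mvec V k) :
  alternating w -> mvec_linear xi ->
  xi w = k`!%:R^-1 * \sum_(J : {ffun 'I_k -> 'I_m})
    w (fun i => tnth b (J i)) * xi (wdual b J).
Proof.
move=> aw lxi; rewrite {1}(alternating_expand hb aw) mvec_linear_sum//.
  by rewrite mulr_sumr; apply: eq_bigr => J _; rewrite mulrA.
by move=> J _; exact: wdual_alternating.
Qed.

End Pairing.

(** Both sides equal the sum of the B i k times the cofactors of A. This transfers a derivation from
    the vectors (columns) to the covectors (rows) of a wedge product. *)
Lemma sum_det_replace_row_col (F : comPzRingType) n (A B : 'M[F]_n) :
  \sum_k \det (\matrix_(i, j) (if j == k then B i j else A i j)) =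
  \sum_k \det (\matrix_(i, j) (if i == k then B i j else A i j)).
Proof.
transitivity (\sum_k \sum_i B i k * cofactor A i k).
  apply: eq_bigr => k _; rewrite (expand_det_col _ k); apply: eq_bigr => i _.
  rewrite mxE eqxx; congr (_ * (_ * \det _)); apply/matrixP => a c.
  by rewrite !mxE eq_sym (negbTE (neq_lift _ _)).
rewrite exchange_big/=.
apply: eq_bigr => k _; rewrite (expand_det_row _ k); apply: eq_bigr => i _.
rewrite mxE eqxx; congr (_ * (_ * \det _)); apply/matrixP => a c.
by rewrite !mxE eq_sym (negbTE (neq_lift _ _)).
Qed.

(** * The cocycle identity over a ring with commuting derivations *)

Section NambuAlgebra.
Variables (F : comPzRingType) (m p : nat).
Notation idx := {ffun 'I_p -> 'I_m}.
Implicit Types (J : idx) (i : 'I_p) (k l : 'I_m) (x y : F) (Y Z : 'I_m -> F)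
  (alpha beta : idx -> F).

Definition fupd J i k : idx := [ffun j => if j == i then k else J j].

Lemma fupd_same J i k : fupd J i k i = k.
Proof. by rewrite ffunE eqxx. Qed.

Lemma fupd_fupd J i k l : fupd (fupd J i k) i l = fupd J i l.
Proof. by apply/ffunP => j; rewrite !ffunE; case: eqP. Qed.

Lemma fupd_id J i : fupd J i (J i) = J.
Proof. by apply/ffunP => j; rewrite ffunE; case: eqP => // ->. Qed.

(** Exchanging the i-th entry of J with k is an involution of the pairs (J, k). *)
Lemma sum_fupd_swap i (G : idx -> 'I_m -> idx -> 'I_m -> F) :
  \sum_J \sum_k G J k (fupd J i k) (J i) = \sum_J \sum_k G (fupd J i k) (J i) J k.
Proof.
rewrite !pair_big/=.
pose h (q : idx * 'I_m) := (fupd q.1 i q.2, q.1 i).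
have hK : involutive h.
  by move=> [J k]; rewrite /h/= fupd_fupd fupd_id fupd_same.
rewrite (reindex_inj (inv_inj hK))/=; apply: eq_bigr => -[J k] _ /=.
by rewrite fupd_fupd fupd_id fupd_same.
Qed.

Variable D : 'I_m -> {additive F -> F}.
Hypothesis DM : forall k x y, D k (x * y) = D k x * y + x * D k y.
Hypothesis DC : forall k l x, D k (D l x) = D l (D k x).
Hypothesis oppr_eq_id : forall x, x = - x -> x = 0.
Variable c : F.
Hypothesis Dc : forall k, D k c = 0.
Variable Pi : idx -> 'I_m -> F.
Hypothesis Pi_swap : forall J i k, Pi (fupd J i k) (J i) = - Pi J k.

Definition vact Y x : F := \sum_k Y k * D k x.

(** Components of [Pi alpha]; c stands for 1/p!, as J runs over all multi-indices. *)
Definition ham alpha l : F := c * \sum_J alpha J * Pi J l.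

(* [(iota_(e_k) d alpha)_J] in coordinates. *)
Definition dcoef alpha k J : F :=
  D k (alpha J) - \sum_i D (J i) (alpha (fupd J i k)).

(* Coefficients of the Schouten bracket [[Y, Pi]]. *)
Definition lie_Pi Y J l : F :=
  vact Y (Pi J l) - \sum_k Pi J k * D k (Y l) -
  \sum_i \sum_k Pi (fupd J i k) l * D k (Y (J i)).

(** The l-th component of the Nambu identity for alpha, with the J-th coframe element as beta. *)
Definition nambu_at alpha := forall J l, lie_Pi (ham alpha) J l =
  - (c * \sum_J' (\sum_k Pi J k * dcoef alpha k J') * Pi J' l).

Definition br alpha beta J : F :=
  vact (ham alpha) (beta J) +
  \sum_i \sum_k D (J i) (ham alpha k) * beta (fupd J i k) -
  \sum_k ham beta k * dcoef alpha k J.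

(** Up to the constant (-1)^p p!, the pairing of Pi with d alpha. *)
Definition dPi alpha : F := \sum_J \sum_k Pi J k * D k (alpha J).

Lemma vactM Y x y : vact Y (x * y) = vact Y x * y + x * vact Y y.
Proof.
rewrite /vact mulr_suml mulr_sumr -big_split/=; apply: eq_bigr => k _.
by rewrite DM; ring.
Qed.

Lemma vactD Y x y : vact Y (x + y) = vact Y x + vact Y y.
Proof. by rewrite /vact -big_split/=; apply: eq_bigr => k _; rewrite raddfD mulrDr. Qed.

Lemma vact_sum Y (I : finType) (G : I -> F) :
  vact Y (\sum_a G a) = \sum_a vact Y (G a).
Proof.
rewrite /vact exchange_big/=; apply: eq_bigr => k _.
by rewrite raddf_sum mulr_sumr.
Qed.

Lemma vact_c Y : vact Y c = 0.
Proof. by rewrite /vact big1// => k _; rewrite Dc mulr0. Qed.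

Lemma D_vact k Y x :
  D k (vact Y x) = vact Y (D k x) + \sum_l D k (Y l) * D l x.
Proof.
rewrite /vact raddf_sum -big_split/=; apply: eq_bigr => l _.
by rewrite DM DC addrC.
Qed.

(* Pi is antisymmetric and mixed derivatives are symmetric. *)
Lemma sum_Pi_DD i (g : idx -> F) (y : idx -> F) :
  (forall J k, y (fupd J i k) = y J) -> (forall J k, g (fupd J i k) = g J) ->
  \sum_J \sum_k Pi J k * (D k (D (J i) (y J)) * g J) = 0.
Proof.
move=> hy hg; apply: oppr_eq_id.
rewrite {1}(sum_fupd_swap i (fun J k J' k' => Pi J k * (D k (D k' (y J)) * g J))).
rewrite -sumrN; apply: eq_bigr => J _; rewrite -sumrN; apply: eq_bigr => k _.
by rewrite hy hg Pi_swap DC mulNr.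
Qed.

(** What the terms D Y beta of the Lie derivative of beta contribute to [dPi] when the derivation
    hits beta; the terms with second derivatives of Y drop out by [sum_Pi_DD]. *)
Definition Qterm Y beta : F := \sum_i \sum_l \sum_J \sum_k
  Pi J k * (D (J i) (Y l) * D k (beta (fupd J i l))).

Lemma lie_Pi_contract Y beta :
  \sum_J \sum_l lie_Pi Y J l * D l (beta J) =
  \sum_J \sum_l vact Y (Pi J l) * D l (beta J) -
  \sum_J \sum_k Pi J k * (\sum_l D k (Y l) * D l (beta J)) - Qterm Y beta.
Proof.
rewrite -!sumrB /Qterm.
have -> : \sum_i \sum_l \sum_J \sum_k Pi J k * (D (J i) (Y l) * D k (beta (fupd J i l)))
   = \sum_J \sum_l (\sum_i \sum_k Pi (fupd J i k) l * D k (Y (J i))) * D l (beta J).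
  transitivity (\sum_i \sum_J \sum_l \sum_k Pi (fupd J i k) l * D k (Y (J i)) * D l (beta J)).
    apply: eq_bigr => i _.
    rewrite (exchange_big_dep xpredT)//=.
    under [RHS]eq_bigr => J _ do rewrite exchange_big/=.
    rewrite (sum_fupd_swap i (fun J k J' k' => \sum_l Pi J' l * D k (Y k') * D l (beta J))).
    apply: eq_bigr => J _; apply: eq_bigr => k _; apply: eq_bigr => l _.
    by rewrite mulrA.
  rewrite exchange_big/=; apply: eq_bigr => J _.
  rewrite exchange_big/=; apply: eq_bigr => l _.
  by rewrite mulr_suml; apply: eq_bigr => i _; rewrite mulr_suml.
rewrite -sumrB; apply: eq_bigr => J _.
have -> : \sum_k Pi J k * (\sum_l D k (Y l) * D l (beta J)) =
          \sum_l (\sum_k Pi J k * D k (Y l)) * D l (beta J).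
  under eq_bigr do rewrite mulr_sumr.
  rewrite exchange_big/=; apply: eq_bigr => l _; rewrite mulr_suml.
  by apply: eq_bigr => k _; rewrite mulrA.
rewrite -!sumrB; apply: eq_bigr => l _.
by rewrite -!mulrBl.
Qed.

(** The Leibniz rule for L_Y on the pairing of Pi with d beta. The left side is [dPi] of L_Y beta
    without its vanishing second-order terms. *)
Lemma dPi_lie Y beta :
  \sum_J \sum_k Pi J k * D k (vact Y (beta J)) + Qterm Y beta =
  vact Y (dPi beta) - \sum_J \sum_l lie_Pi Y J l * D l (beta J).
Proof.
rewrite lie_Pi_contract /dPi vact_sum.
under [in RHS]eq_bigr => J _.
  rewrite vact_sum; under eq_bigr do rewrite vactM.
  rewrite big_split/=; over.
under [in LHS]eq_bigr => J _.
  under eq_bigr do rewrite D_vact mulrDr.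
  rewrite big_split/=; over.
rewrite !big_split/=; ring.
Qed.

Lemma sum_Pi_exchange (g : idx -> 'I_m -> 'I_p -> 'I_m -> F) :
  \sum_J \sum_k Pi J k * (\sum_i \sum_l g J k i l) =
  \sum_i \sum_l \sum_J \sum_k Pi J k * g J k i l.
Proof.
rewrite pair_big/= [RHS]pair_big/=.
transitivity (\sum_(q : idx * 'I_m) \sum_(r : 'I_p * 'I_m) Pi q.1 q.2 * g q.1 q.2 r.1 r.2).
  apply: eq_bigr => q _; rewrite mulr_sumr.
  by under eq_bigr do rewrite mulr_sumr; rewrite pair_big.
by rewrite exchange_big/=; apply: eq_bigr => r _; rewrite pair_big.
Qed.

Lemma brE alpha beta J : br alpha beta J =
  vact (ham alpha) (beta J) - vact (ham beta) (alpha J) +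
  \sum_i \sum_l (D (J i) (ham alpha l) * beta (fupd J i l) +
                 ham beta l * D (J i) (alpha (fupd J i l))).
Proof.
rewrite /br /dcoef.
under [X in _ - X]eq_bigr do rewrite mulrBr mulr_sumr.
rewrite sumrB [X in _ - (_ - X)]exchange_big/= -/(vact (ham beta) (alpha J)).
under [in RHS]eq_bigr do rewrite big_split/=.
by rewrite big_split/=; ring.
Qed.

(** By [brE], alpha and beta enter the bracket antisymmetrically except for the terms with a
    replaced index. Pairing these with Pi restores the antisymmetry, so [dPi_lie] applies once to
    each form. *)
Lemma dPi_br alpha beta : dPi (br alpha beta) =
  vact (ham alpha) (dPi beta) - vact (ham beta) (dPi alpha) -
  \sum_J \sum_l lie_Pi (ham alpha) J l * D l (beta J) +
  \sum_J \sum_l lie_Pi (ham beta) J l * D l (alpha J).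
Proof.
have -> : dPi (br alpha beta) =
    (\sum_J \sum_k Pi J k * D k (vact (ham alpha) (beta J)) + Qterm (ham alpha) beta) -
    (\sum_J \sum_k Pi J k * D k (vact (ham beta) (alpha J)) + Qterm (ham beta) alpha).
  (* The first two terms of g contain second derivatives and vanish by [sum_Pi_DD]. The other two
     give [Qterm (ham alpha) beta] and, after exchanging k with J i, minus
     [Qterm (ham beta) alpha]. *)
  pose g J k i l := D k (D (J i) (ham alpha l)) * beta (fupd J i l) +
    D k (D (J i) (alpha (fupd J i l))) * ham beta l +
    (D (J i) (ham alpha l) * D k (beta (fupd J i l)) +
     D k (ham beta l) * D (J i) (alpha (fupd J i l))).
  have -> : dPi (br alpha beta) =
      \sum_J \sum_k Pi J k * D k (vact (ham alpha) (beta J)) -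
      \sum_J \sum_k Pi J k * D k (vact (ham beta) (alpha J)) +
      \sum_J \sum_k Pi J k * \sum_i \sum_l g J k i l.
    rewrite -sumrB -big_split/=; apply: eq_bigr => J _.
    rewrite -sumrB -big_split/=; apply: eq_bigr => k _.
    rewrite brE raddfD raddfB mulrDr mulrBr; congr (_ + _ * _).
    rewrite raddf_sum; apply: eq_bigr => i _.
    rewrite raddf_sum; apply: eq_bigr => l _.
    rewrite raddfD (DM k (D (J i) (ham alpha l))) (DM k (ham beta l)) /g.
    rewrite [ham beta l * _]mulrC [X in _ + X = _]addrC.
    by rewrite addrACA.
  have -> : \sum_J \sum_k Pi J k * (\sum_i \sum_l g J k i l) =
      Qterm (ham alpha) beta - Qterm (ham beta) alpha.
    rewrite sum_Pi_exchange /Qterm -sumrB; apply: eq_bigr => i _.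
    rewrite -sumrB; apply: eq_bigr => l _.
    under eq_bigr => J _.
      under eq_bigr => k _ do rewrite /g !mulrDr.
      rewrite !big_split/=; over.
    rewrite !big_split/=.
    rewrite (@sum_Pi_DD i (fun J => beta (fupd J i l)) (fun=> ham alpha l))//; last first.
      by move=> J k; rewrite fupd_fupd.
    rewrite (@sum_Pi_DD i (fun=> ham beta l) (fun J => alpha (fupd J i l)))//; last first.
      by move=> J k; rewrite fupd_fupd.
    rewrite addr0 add0r; congr (_ + _).
    rewrite (sum_fupd_swap i (fun J k J' k' =>
      Pi J k * (D k (ham beta l) * D k' (alpha (fupd J i l))))).
    rewrite -sumrN; apply: eq_bigr => J _; rewrite -sumrN; apply: eq_bigr => k _.
    by rewrite fupd_fupd Pi_swap mulNr.
  ring.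
by rewrite !dPi_lie; ring.
Qed.

(** The Leibniz rule for L_(Pi alpha) applied to the contraction Pi beta. In E4 the Nambu identity
    for alpha turns the term iota_(Pi beta) d alpha of the bracket into the Lie derivative of Pi. *)
Lemma ham_br alpha beta l : nambu_at alpha ->
  ham (br alpha beta) l = vact (ham alpha) (ham beta l) - vact (ham beta) (ham alpha l).
Proof.
move=> Ha.
have E1 : vact (ham alpha) (ham beta l) = c * \sum_J (vact (ham alpha) (beta J) * Pi J l
     + beta J * vact (ham alpha) (Pi J l)).
  rewrite /ham vactM vact_c mul0r add0r vact_sum; congr (_ * _).
  by apply: eq_bigr => J _; rewrite vactM.
have E2 : vact (ham beta) (ham alpha l) = c * \sum_J beta J * (\sum_k Pi J k * D k (ham alpha l)).
  rewrite /vact /ham.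
  under eq_bigr do rewrite -mulrA mulr_suml.
  rewrite -mulr_sumr exchange_big/=; congr (_ * _); apply: eq_bigr => J _.
  by rewrite [RHS]mulr_sumr; apply: eq_bigr => k _; rewrite mulrA.
have E3 : \sum_(J : idx) (\sum_i \sum_k D (J i) (ham alpha k) * beta (fupd J i k)) * Pi J l =
   \sum_(J : idx) beta J * (\sum_i \sum_k Pi (fupd J i k) l * D k (ham alpha (J i))).
  under eq_bigr do rewrite mulr_suml.
  under [RHS]eq_bigr do rewrite mulr_sumr.
  rewrite exchange_big [RHS]exchange_big/=; apply: eq_bigr => i _.
  under eq_bigr do rewrite mulr_suml.
  under [RHS]eq_bigr do rewrite mulr_sumr.
  rewrite (sum_fupd_swap i (fun J k J' k' => D k' (ham alpha k) * beta J' * Pi J l)).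
  by apply: eq_bigr => J _; apply: eq_bigr => k _; ring.
have E4 : \sum_J (\sum_k ham beta k * dcoef alpha k J) * Pi J l =
    - \sum_J beta J * lie_Pi (ham alpha) J l.
  rewrite -sumrN.
  under [RHS]eq_bigr => J _ do rewrite Ha mulrN opprK mulr_sumr mulr_sumr.
  rewrite exchange_big/=; apply: eq_bigr => J _.
  rewrite mulr_suml.
  under [RHS]eq_bigr do rewrite mulr_suml mulr_sumr mulr_sumr.
  rewrite exchange_big/=; apply: eq_bigr => k _.
  rewrite /ham mulr_sumr !mulr_suml; apply: eq_bigr => J' _; ring.
rewrite E1 E2 -mulrBr {1}/ham; congr (_ * _).
rewrite /br.
under eq_bigr do rewrite mulrBl mulrDl.
rewrite sumrB big_split/= E3 E4 opprK -!big_split/= -sumrB.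
apply: eq_bigr => J _.
by rewrite /lie_Pi; ring.
Qed.

(** * Divergence with respect to a density with logarithmic derivatives sigma *)

Variable sigma : 'I_m -> F.
Hypothesis Dsigma : forall k l, D k (sigma l) = D l (sigma k).

Definition diverg Y : F := \sum_k (D k (Y k) + Y k * sigma k).

(** The terms D_k Y_l D_l Z_k are symmetric in Y and Z, and so are the terms Y_l Z_k D_l sigma_k
    because sigma is closed; both cancel in the difference. *)
Lemma diverg_br Y Z :
  diverg (fun l => vact Y (Z l) - vact Z (Y l)) =
  vact Y (diverg Z) - vact Z (diverg Y).
Proof.
have E Y' Z' : \sum_k D k (vact Y' (Z' k)) + \sum_k vact Y' (Z' k) * sigma k =
    vact Y' (diverg Z') + \sum_k \sum_l D k (Y' l) * D l (Z' k) -
    \sum_k \sum_l Y' l * Z' k * D l (sigma k).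
  rewrite /diverg vact_sum.
  under eq_bigr do rewrite D_vact.
  under [in RHS]eq_bigr do rewrite vactD vactM.
  rewrite !big_split/=.
  have -> : \sum_k \sum_l Y' l * Z' k * D l (sigma k) = \sum_k Z' k * vact Y' (sigma k).
    apply: eq_bigr => k _; rewrite /vact mulr_sumr; apply: eq_bigr => l _; ring.
  ring.
rewrite {1}/diverg big_split/=.
under eq_bigr do rewrite raddfB.
under [X in _ + X]eq_bigr do rewrite mulrBl.
rewrite !sumrB addrACA -opprD !E.
have -> : \sum_k \sum_l D k (Z l) * D l (Y k) = \sum_k \sum_l D k (Y l) * D l (Z k).
  by rewrite exchange_big/=; apply: eq_bigr => k _; apply: eq_bigr => l _; rewrite mulrC.
have -> : \sum_k \sum_l Z l * Y k * D l (sigma k) = \sum_k \sum_l Y l * Z k * D l (sigma k).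
  rewrite exchange_big/=; apply: eq_bigr => k _; apply: eq_bigr => l _.
  by rewrite Dsigma [Z _ * _]mulrC.
ring.
Qed.

Definition modular_coef J : F := \sum_k (D k (Pi J k) + Pi J k * sigma k).

Definition modular_fun alpha : F := c * \sum_J alpha J * modular_coef J.

Lemma modular_funE alpha : modular_fun alpha = diverg (ham alpha) - c * dPi alpha.
Proof.
rewrite /modular_fun /diverg /dPi big_split/=.
have -> : \sum_k D k (ham alpha k) =
    c * (\sum_J \sum_k (alpha J * D k (Pi J k))) + c * (\sum_J \sum_k Pi J k * D k (alpha J)).
  rewrite -mulrDr -big_split/=.
  under [in RHS]eq_bigr do rewrite -big_split/=.
  rewrite exchange_big/= mulr_sumr; apply: eq_bigr => k _.
  rewrite /ham DM Dc mul0r add0r raddf_sum; congr (_ * _).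
  by apply: eq_bigr => J _; rewrite DM; ring.
have -> : \sum_k ham alpha k * sigma k = c * \sum_J \sum_k alpha J * (Pi J k * sigma k).
  rewrite exchange_big/= mulr_sumr; apply: eq_bigr => k _.
  rewrite /ham -mulrA mulr_suml; congr (_ * _).
  by apply: eq_bigr => J _; rewrite mulrA.
transitivity (c * \sum_J \sum_k (alpha J * D k (Pi J k)) +
   c * \sum_J \sum_k alpha J * (Pi J k * sigma k)); last by ring.
rewrite -mulrDr -big_split/=; congr (_ * _).
apply: eq_bigr => J _; rewrite /modular_coef mulr_sumr -big_split/=.
by apply: eq_bigr => k _; rewrite mulrDr.
Qed.

(** * The quadratic relation and the cocycle identity *)

Variable f : 'I_m -> F.
Hypothesis Df : forall k l, D k (f l) = (k == l)%:R.
(** To be the coefficients of the coframe elements: generalised Kronecker symbols, as forms have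
    alternating coefficients. *)
Variable delta : idx -> idx -> F.
Hypothesis Ddelta : forall k I J, D k (delta I J) = 0.
Hypothesis ham_delta : forall I l, ham (delta I) l = Pi I l.
Hypothesis nambu_delta : forall I, nambu_at (delta I).
Hypothesis nambu_fdelta : forall a I, nambu_at (fun J => f a * delta I J).

Lemma hamZ x alpha l : ham (fun J => x * alpha J) l = x * ham alpha l.
Proof.
rewrite /ham mulrCA [X in _ = _ * X]mulr_sumr; congr (_ * _).
by apply: eq_bigr => J _; rewrite mulrA.
Qed.

(* The failure of [nambu_at] to be linear over functions is an algebraic
   identity for [Pi]. *)
Lemma nambu_quadratic a I J l :
  \sum_i Pi (fupd J i a) l * Pi I (J i) =
  - (c * \sum_K (\sum_i Pi (fupd K i a) l * Pi J (K i)) * delta I K).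
Proof.
have H1 := nambu_fdelta a I J l; have H0 := nambu_delta I J l.
have Dfa k y : D k (f a * y) = (k == a)%:R * y + f a * D k y by rewrite DM Df.
have L : lie_Pi (ham (fun J => f a * delta I J)) J l =
    f a * lie_Pi (ham (delta I)) J l - Pi J a * Pi I l -
    \sum_i Pi (fupd J i a) l * Pi I (J i).
  rewrite /lie_Pi !mulrBr.
  have -> : vact (ham (fun J0 => f a * delta I J0)) (Pi J l) =
      f a * vact (ham (delta I)) (Pi J l).
    by rewrite /vact mulr_sumr; apply: eq_bigr => k _; rewrite hamZ mulrA.
  have -> : \sum_k Pi J k * D k (ham (fun J0 => f a * delta I J0) l) =
      Pi J a * Pi I l + f a * \sum_k Pi J k * D k (ham (delta I) l).
    under eq_bigr do rewrite hamZ Dfa mulrDr.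
    rewrite big_split/= (bigD1 a)//= eqxx mul1r ham_delta big1 ?addr0; last first.
      by move=> k /negbTE->; rewrite mul0r mulr0.
    congr (_ + _); rewrite mulr_sumr; apply: eq_bigr => k _; by rewrite mulrCA ?ham_delta.
  have -> : \sum_i \sum_k Pi (fupd J i k) l * D k (ham (fun J0 => f a * delta I J0) (J i)) =
      \sum_i Pi (fupd J i a) l * Pi I (J i) +
      f a * \sum_i \sum_k Pi (fupd J i k) l * D k (ham (delta I) (J i)).
    rewrite mulr_sumr -big_split/=; apply: eq_bigr => i _.
    under eq_bigr do rewrite hamZ Dfa mulrDr.
    rewrite big_split/= (bigD1 a)//= eqxx mul1r ham_delta big1 ?addr0; last first.
      by move=> k /negbTE->; rewrite mul0r mulr0.
    congr (_ + _); rewrite mulr_sumr; apply: eq_bigr => k _; by rewrite mulrCA ?ham_delta.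
  ring.
have dE k K : dcoef (fun J => f a * delta I J) k K =
    f a * dcoef (delta I) k K + (k == a)%:R * delta I K -
    \sum_i (K i == a)%:R * delta I (fupd K i k).
  rewrite /dcoef Dfa Ddelta mulr0 addr0 sub0r mulrN mulr_sumr.
  rewrite [in X in - X + _]big1 ?oppr0 ?add0r; last by move=> i _; rewrite Ddelta mulr0.
  by congr (_ - _); apply: eq_bigr => i _; rewrite Dfa Ddelta mulr0 addr0.
have E1 : c * \sum_K Pi J a * delta I K * Pi K l = Pi J a * Pi I l.
  rewrite -[Pi I l]ham_delta /ham mulrCA; congr (_ * _).
  by rewrite mulr_sumr; apply: eq_bigr => K _; rewrite mulrA.
have E2 : \sum_(K : idx) (\sum_k Pi J k * \sum_i (K i == a)%:R * delta I (fupd K i k)) * Pi K l =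
    \sum_(K : idx) (\sum_i Pi (fupd K i a) l * Pi J (K i)) * delta I K.
  transitivity (\sum_i \sum_(K : idx) \sum_k
      Pi J k * ((K i == a)%:R * delta I (fupd K i k)) * Pi K l).
    rewrite exchange_big/=; apply: eq_bigr => K _; rewrite mulr_suml exchange_big/=.
    by apply: eq_bigr => k _; rewrite mulr_sumr mulr_suml.
  under [RHS]eq_bigr do rewrite mulr_suml.
  rewrite [RHS]exchange_big/=; apply: eq_bigr => i _.
  rewrite (sum_fupd_swap i (fun K k K' k' => Pi J k * ((k' == a)%:R * delta I K') * Pi K l)).
  apply: eq_bigr => K _; rewrite (bigD1 a)//= eqxx mul1r big1 ?addr0; last first.
    by move=> k /negbTE->; rewrite mul0r mulr0 mul0r.
  ring.
have R : c * \sum_K (\sum_k Pi J k * dcoef (fun J => f a * delta I J) k K) * Pi K l =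
   f a * (c * \sum_K (\sum_k Pi J k * dcoef (delta I) k K) * Pi K l) + Pi J a * Pi I l -
   c * \sum_K (\sum_i Pi (fupd K i a) l * Pi J (K i)) * delta I K.
  rewrite -E1 -E2 mulrCA -mulrDr -mulrBr; congr (_ * _).
  rewrite mulr_sumr -big_split/= -sumrB; apply: eq_bigr => K _.
  rewrite mulrA -!mulrDl -mulrBl; congr (_ * _).
  under eq_bigr do rewrite dE mulrBr mulrDr.
  rewrite sumrB big_split/=; congr (_ + _ - _).
    by rewrite mulr_sumr; apply: eq_bigr => k _; rewrite mulrCA.
  rewrite (bigD1 a)//= eqxx mul1r big1 ?addr0//.
  by move=> k /negbTE->; rewrite mul0r mulr0.
(* The multiples of f a agree by the identity for [delta I], and the product Pi J a * Pi I l occurs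
   on both sides; only the terms quadratic in Pi with a replaced index survive. *)
move: H1; rewrite L R H0 => H1.
have -> : \sum_i Pi (fupd J i a) l * Pi I (J i) =
   f a * - (c * (\sum_J' (\sum_k Pi J k * dcoef (delta I) k J') * Pi J' l)) -
   Pi J a * Pi I l - (f a * - (c * (\sum_J' (\sum_k Pi J k * dcoef (delta I) k J') * Pi J' l)) -
   Pi J a * Pi I l - \sum_i Pi (fupd J i a) l * Pi I (J i)) by ring.
rewrite H1; ring.
Qed.

(** With the intended c and delta: alpha equals its antisymmetrisation. *)
Definition expandable alpha := forall J, alpha J = c * \sum_I delta I J * alpha I.

(** As c and delta are constants, D_k alpha is expandable along with alpha, so contraction with it
    removes delta from the quadratic relation. *)
Lemma nambu_quadratic_contract alpha a k J l : expandable alpha ->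
  \sum_I D k (alpha I) * (\sum_i Pi (fupd J i a) l * Pi I (J i)) =
  - \sum_K (\sum_i Pi (fupd K i a) l * Pi J (K i)) * D k (alpha K).
Proof.
move=> ea.
under eq_bigr do rewrite nambu_quadratic mulrN mulr_sumr mulr_sumr.
rewrite sumrN exchange_big/=; congr (- _); apply: eq_bigr => K _.
rewrite [in RHS]ea DM Dc mul0r add0r raddf_sum mulr_sumr mulr_sumr.
by apply: eq_bigr => I _; rewrite DM Ddelta; ring.
Qed.

Lemma sum_transpose (g : idx -> 'I_m -> 'I_m -> idx -> F) :
  \sum_J \sum_l \sum_k \sum_K g J l k K = \sum_J \sum_l \sum_k \sum_K g K k l J.
Proof.
have E (h : idx -> 'I_m -> 'I_m -> idx -> F) : \sum_J \sum_l \sum_k \sum_K h J l k K =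
    \sum_(q : idx * 'I_m) \sum_(r : idx * 'I_m) h q.1 q.2 r.2 r.1.
  by rewrite pair_big/=; apply: eq_bigr => q _; rewrite exchange_big pair_big.
by rewrite !E exchange_big.
Qed.

(** Substituting the Nambu identity splits both sides into T1 and T2. T1 is symmetric under the
    exchange of (J, l) and (K, k). In T2 the quadratic relation attaches D alpha to the other factor
    Pi, and the antisymmetry of Pi in k and l then gives T2 with alpha and beta exchanged. *)
Lemma lie_Pi_sym alpha beta : nambu_at alpha -> nambu_at beta ->
  expandable alpha -> expandable beta ->
  \sum_J \sum_l lie_Pi (ham alpha) J l * D l (beta J) =
  \sum_J \sum_l lie_Pi (ham beta) J l * D l (alpha J).
Proof.
pose T1 (al be : idx -> F) := \sum_J \sum_l \sum_K \sum_k
   (Pi J k * D k (al K)) * (Pi K l * D l (be J)).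
pose T2 (al be : idx -> F) := \sum_J \sum_l \sum_k
   (\sum_K (\sum_i Pi (fupd K i k) l * Pi J (K i)) * D k (al K)) * D l (be J).
have E (al be : idx -> F) : nambu_at al -> \sum_J \sum_l lie_Pi (ham al) J l * D l (be J) =
    - (c * T1 al be) + c * T2 al be.
  move=> Ha; rewrite addrC -mulrBr -!sumrB mulr_sumr; apply: eq_bigr => J _.
  rewrite -sumrB mulr_sumr; apply: eq_bigr => l _; rewrite Ha mulNr -mulrN -mulrA; congr (_ * _).
  rewrite -[X in _ = X]opprB mulrN; congr (- _).
  have -> : \sum_K (\sum_k Pi J k * dcoef al k K) * Pi K l =
      \sum_K (\sum_k Pi J k * D k (al K)) * Pi K l -
      \sum_k \sum_(K : idx) (\sum_i Pi (fupd K i k) l * Pi J (K i)) * D k (al K).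
    have -> : \sum_k \sum_(K : idx) (\sum_i Pi (fupd K i k) l * Pi J (K i)) * D k (al K) =
       \sum_(K : idx) \sum_k (\sum_i Pi J k * D (K i) (al (fupd K i k))) * Pi K l.
      rewrite exchange_big/=.
      under eq_bigr => K _ do under eq_bigr => k _ do rewrite mulr_suml.
      under eq_bigr => K _ do rewrite exchange_big/=.
      under [RHS]eq_bigr => K _ do under eq_bigr => k _ do rewrite mulr_suml.
      under [RHS]eq_bigr => K _ do rewrite exchange_big/=.
      rewrite exchange_big [RHS]exchange_big/=; apply: eq_bigr => i _.
      rewrite (sum_fupd_swap i (fun K k K' k' => Pi K' l * Pi J k' * D k (al K))).
      by apply: eq_bigr => K _; apply: eq_bigr => k _; ring.
    rewrite -sumrB; apply: eq_bigr => K _; rewrite mulr_suml -mulr_suml -mulr_suml -mulrBl.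
    congr (_ * _); rewrite -sumrB; apply: eq_bigr => k _.
    by rewrite /dcoef mulrBr mulr_sumr.
  rewrite mulrBl; congr (_ - _); last by rewrite mulr_suml.
  rewrite mulr_suml; apply: eq_bigr => K _.
  by rewrite !mulr_suml; apply: eq_bigr => k _; rewrite !mulrA.
move=> Ha Hb ea eb; rewrite (E _ _ Ha) (E _ _ Hb).
have -> : T1 alpha beta = T1 beta alpha.
  rewrite /T1 pair_big/= [RHS]pair_big/=.
  under eq_bigr do rewrite pair_big/=.
  under [RHS]eq_bigr do rewrite pair_big/=.
  rewrite exchange_big/=; apply: eq_bigr => -[K k] _; apply: eq_bigr => -[J l] _ /=.
  by rewrite mulrC.
congr (- _ + _ * _).
pose T3 (al be : idx -> F) := \sum_J \sum_l \sum_k \sum_K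
   (D k (al K) * D l (be J)) * (\sum_i Pi (fupd J i k) l * Pi K (J i)).
have -> : T2 alpha beta = - T3 alpha beta.
  rewrite /T2 /T3 -sumrN; apply: eq_bigr => J _; rewrite -sumrN; apply: eq_bigr => l _.
  rewrite -sumrN; apply: eq_bigr => k _.
  rewrite -[X in X * _]opprK -nambu_quadratic_contract// mulNr mulr_suml; congr (- _).
  by apply: eq_bigr => K _; rewrite mulrAC.
rewrite /T2 /T3.
rewrite sum_transpose -sumrN; apply: eq_bigr => K _; rewrite -sumrN; apply: eq_bigr => k _.
rewrite -sumrN; apply: eq_bigr => l _; rewrite -sumrN mulr_suml; apply: eq_bigr => J _.
have -> : \sum_i Pi (fupd J i l) k * Pi K (J i) = - \sum_i Pi (fupd J i k) l * Pi K (J i).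
  rewrite -sumrN; apply: eq_bigr => i _; rewrite -mulNr; congr (_ * _).
  by have := Pi_swap (fupd J i l) i k; rewrite fupd_fupd fupd_same => ->; rewrite opprK.
by rewrite !mulNr; congr (- _); rewrite mulrC [D k _ * _]mulrC mulrA.
Qed.

Lemma modular_fun_br alpha beta : nambu_at alpha -> nambu_at beta ->
  expandable alpha -> expandable beta ->
  modular_fun (br alpha beta) =
  vact (ham alpha) (modular_fun beta) - vact (ham beta) (modular_fun alpha).
Proof.
move=> Ha Hb ea eb; rewrite !modular_funE.
have -> : ham (br alpha beta) =
    fun l => vact (ham alpha) (ham beta l) - vact (ham beta) (ham alpha l).
  by apply/funext => l; exact: ham_br.
rewrite diverg_br dPi_br (lie_Pi_sym Ha Hb ea eb) subrK.
have vactB Y x y : vact Y (x - c * y) = vact Y x - c * vact Y y.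
  by rewrite vactD -mulNr vactM /vact [X in X * y]big1 ?mul0r ?add0r ?mulNr// => k _;
     rewrite raddfN Dc oppr0 mulr0.
by rewrite !vactB; ring.
Qed.

End NambuAlgebra.

(** * Existence of adapted frames *)

Section BundleSmoothness.
Context {R : realType} {d : nat} {M : manifold R d} {m : nat}.
Context {A : vbundle M m}.
Implicit Types (f g : M -> R) (x y : M) (V W N : set M) (X Y : section A)
  (i j : triv_idx A).

Definition smooth_sec_on W X := forall j (k : 'I_m),
  smooth_on (W `&` tdom j) (fun x => coord (frame j x) k (X x)).

Lemma smooth_sec_on_triv i W X : open W -> W `<=` tdom i ->
  (forall k, smooth_on W (fun x => coord (frame i x) k (X x))) ->
  smooth_sec_on W X.
Proof.
move=> oW Wi sX j k.
have oWj : open (W `&` tdom j) by apply: openI => //; exact: tdom_open.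
apply: (@smooth_on_ext _ _ _ _ (fun x =>
  \sum_l coord (frame i x) l (X x) * coord (frame j x) k (tnth (frame i x) l))) => //.
  move=> x [/Wi ix jx]; rewrite [in RHS](coord_expand (frame_basis ix) (X x)).
  by rewrite linear_sum; apply: eq_bigr => l _; rewrite linearZ.
apply: smooth_on_sum => // l _; apply: smooth_onM => //.
  by apply: smooth_on_sub (sX l) => y [].
by apply: smooth_on_sub (@frame_change_smooth _ _ _ _ A i j k l) => y [/Wi].
Qed.

Lemma smooth_sec_extension W X x : open W -> smooth_sec_on W X -> W x ->
  exists2 X', smooth_sec X' & \forall y \near x, X' y = X y.
Proof.
move=> oW sX Wx; have [chi [K [sc c1 cK KW c0]]] := bump_exists (conj oW Wx).
exists (fun y => chi y *: X y).
  move=> j k.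
  rewrite (_ : (fun y => _) = fun y => chi y * coord (frame j y) k (X y)); last first.
    by apply/funext => y; rewrite linearZ.
  exact: (cutoff_smooth_on sc cK oW KW c0 (tdom_open j)) (sX j k).
by apply: filterS c1 => y ->; rewrite scale1r.
Qed.

Lemma frame_extension i (l : 'I_m) x : tdom i x ->
  exists2 X, smooth_sec X & \forall y \near x, X y = tnth (frame i y) l.
Proof.
move=> ix; apply: (@smooth_sec_extension (tdom i) (fun y => tnth (frame i y) l) x) => //.
  exact: tdom_open.
apply: (@smooth_sec_on_triv i) => // [|k]; first exact: tdom_open.
apply: (@smooth_on_ext _ _ _ _ (fun=> (k == l)%:R)); first exact: tdom_open.
  by move=> y iy; rewrite (coord_tnth (frame_basis iy)).
exact: smooth_on_cst.
Qed.

Lemma smooth_sec_comb f X Y : smooth f -> smooth_sec X -> smooth_sec Y ->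
  smooth_sec (fun y => f y *: X y + Y y).
Proof.
move=> sf sX sY j k.
rewrite (_ : (fun y => _) = fun y => f y * coord (frame j y) k (X y) +
   coord (frame j y) k (Y y)); last by apply/funext => y; rewrite linearP.
apply: smooth_onD => //; first exact: tdom_open.
apply: smooth_onM => //; first exact: tdom_open.
exact: smooth_smooth_on.
Qed.

Lemma smooth_sec0 : smooth_sec (fun y => 0 : fib A y).
Proof.
move=> j k; rewrite (_ : (fun y => _) = fun=> 0); first exact: smooth_on_cst.
by apply/funext => y; rewrite linear0.
Qed.

Lemma smooth_sec_sum (I : Type) (r : seq I) (P : pred I) (c : I -> M -> R)
    (F : I -> section A) :
  (forall a, P a -> smooth (c a)) -> (forall a, P a -> smooth_sec (F a)) ->
  smooth_sec (fun y => \sum_(a <- r | P a) c a y *: F a y).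
Proof.
move=> sc sF; elim: r => [|a r IH].
  rewrite (_ : (fun y => _) = fun y => 0); first exact: smooth_sec0.
  by apply: functional_extensionality_dep => y; rewrite big_nil.
case Pa : (P a); last first.
  rewrite (_ : (fun y => _) = fun y => \sum_(a <- r | P a) c a y *: F a y)//.
  by apply: functional_extensionality_dep => y; rewrite big_cons Pa.
rewrite (_ : (fun y => _) =
    fun y => c a y *: F a y + \sum_(a <- r | P a) c a y *: F a y).
  by apply: smooth_sec_comb => //; [exact: sc|exact: sF].
by apply: functional_extensionality_dep => y; rewrite big_cons Pa.
Qed.

Lemma smooth_on_eval k i (w : form A k) (Y : 'I_k -> section A) :
  (forall x, tdom i x -> alternating (w x)) -> smooth_coefs i w ->
  (forall a, smooth_sec (Y a)) -> smooth_on (tdom i) (eval w Y).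
Proof.
move=> aw sw sY; have oi := tdom_open i.
apply: (@smooth_on_ext _ _ _ _ (fun x => \sum_(J : {ffun 'I_k -> 'I_m})
   w x (fun a => tnth (frame i x) (J a)) * \prod_a coord (frame i x) (J a) (Y a x))) => //.
  by move=> x ix; rewrite /eval (multilinear_expand (frame_basis ix))//; case: (aw x ix).
apply: smooth_on_sum => // J _; apply: smooth_onM => //.
by apply: smooth_on_prod => // a _; exact: sY.
Qed.

Lemma smooth_eval k (w : form A k) (Y : 'I_k -> section A) :
  is_form w -> (forall a, smooth_sec (Y a)) -> smooth (eval w Y).
Proof.
move=> [aw sw] sY; apply: smooth_on_local => x _.
have [i ix] := tdom_cover A x; exists (tdom i) => //.
by apply: smooth_on_eval => // y _.
Qed.

Lemma smooth_pairing k (w : form A k) (xi : msec A k) :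
  is_form w -> is_msec xi -> smooth (pairing w xi).
Proof.
move=> [aw sw] [lxi sxi]; apply: smooth_on_local => x _.
have [i ix] := tdom_cover A x; exists (tdom i) => //; have oi := tdom_open i.
apply: (@smooth_on_ext _ _ _ _ (fun x => k`!%:R^-1 * \sum_(J : {ffun 'I_k -> 'I_m})
   w x (fun a => tnth (frame i x) (J a)) * xi x (wdual (frame i x) J))) => //.
  by move=> y iy; rewrite /pairing (mvec_pairing (frame_basis iy)).
apply: smooth_onZ => //; apply: smooth_on_sum => // J _.
apply: smooth_onM => //; [exact: sw|exact: sxi].
Qed.

Lemma coord_sharp p (Pi : msec A (p + 1)) (alpha : form A p) i x l :
  is_msec Pi -> tdom i x -> alternating (alpha x) ->
  coord (frame i x) l (sharp Pi alpha x) =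
  p`!%:R^-1 * \sum_(J : {ffun 'I_p -> 'I_m})
    alpha x (fun a => tnth (frame i x) (J a)) *
    Pi x (wdual (frame i x) (snoc J l)).
Proof.
move=> [lPi _] ix aa.
by rewrite /sharp -(coord_contract (frame_basis ix)).
Qed.

Lemma smooth_sharp p (Pi : msec A (p + 1)) (alpha : form A p) :
  is_msec Pi -> is_form alpha -> smooth_sec (sharp Pi alpha).
Proof.
move=> mPi [aa sa] i l; have oi := tdom_open i.
apply: (@smooth_on_ext _ _ _ _ (fun x => p`!%:R^-1 * \sum_(J : {ffun 'I_p -> 'I_m})
    alpha x (fun a => tnth (frame i x) (J a)) *
    Pi x (wdual (frame i x) (snoc J l)))) => //.
  by move=> x ix; rewrite coord_sharp.
apply: smooth_onZ => //; apply: smooth_on_sum => // J _.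
apply: smooth_onM => //; [exact: sa|exact: mPi.2].
Qed.

Context (L : lie_algebroid A).

Lemma dfun_covec f x : dfun L f x = covec (fun u => tderive x (anchor L x u) f).
Proof. by []. Qed.

Lemma tderive_anchor_linear f x : smooth_near x f ->
  forall a u v, tderive x (anchor L x (a *: u + v)) f =
    a * tderive x (anchor L x u) f + tderive x (anchor L x v) f.
Proof. by move=> sf a u v; rewrite linearP tderive_linear. Qed.

Lemma dfun_alternating f x : smooth f -> alternating (dfun L f x).
Proof.
move=> sf; rewrite dfun_covec; apply: covec_alternating.
by apply: tderive_anchor_linear; exact: smooth_smooth_near.
Qed.

Lemma smooth_on_dfun_frame f i l : smooth f ->
  smooth_on (tdom i) (fun x => dfun L f x (fun=> tnth (frame i x) l)).
Proof.
move=> sf; apply: smooth_on_near => x ix.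
have [X sX XE] := frame_extension l ix.
apply: (@smooth_near_ext _ _ _ _ (act L X f)).
  by apply: smooth_smooth_near; exact: smooth_act.
by apply: filterS XE => y yE; rewrite /act yE.
Qed.

Lemma wedge_dfun_is_form k (f : 'I_k -> M -> R) : (forall a, smooth (f a)) ->
  is_form (wedge_dfun L f).
Proof.
move=> sf; split=> [x|i J].
  by apply: wedge1_alternating => a; exact: dfun_alternating.
have oi := tdom_open i.
rewrite /wedge_dfun /wedge1 /determinant; apply: smooth_on_sum => // s _.
apply: smooth_onM => //; first exact: smooth_on_cst.
apply: smooth_on_prod => // a _.
apply: (@smooth_on_ext _ _ _ _ (fun x => dfun L (f a) x (fun=> tnth (frame i x) (J (s a))))) => //.
  by move=> x _; rewrite mxE.
exact: smooth_on_dfun_frame.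
Qed.

Lemma scale_is_form k g (w : form A k) : smooth g -> is_form w ->
  is_form (fun x v => g x * w x v).
Proof.
move=> sg [aw sw]; split=> [x|i J].
  split=> [v a c u u'|v a b ab vab].
    by rewrite (aw x).1 mulrDr mulrCA.
  by rewrite ((aw x).2 _ _ _ ab vab) mulr0.
apply: smooth_onM; [exact: tdom_open|exact: smooth_smooth_on|exact: sw].
Qed.


Lemma smooth_on_det n W (G : M -> 'M[R]_n) : open W ->
  (forall a b, smooth_on W (fun x => G x a b)) ->
  smooth_on W (fun x => \det (G x)).
Proof.
move=> oW sG; rewrite /determinant; apply: smooth_on_sum => // s _.
apply: smooth_onM => //; first exact: smooth_on_cst.
by apply: smooth_on_prod => // a _.
Qed.

Lemma smooth_on_invmx n W (G : M -> 'M[R]_n) : open W ->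
  (forall a b, smooth_on W (fun x => G x a b)) ->
  (forall x, W x -> G x \in unitmx) ->
  forall a b, smooth_on W (fun x => invmx (G x) a b).
Proof.
move=> oW sG uG a b.
apply: (@smooth_on_ext _ _ _ _ (fun x => (\det (G x))^-1 * cofactor (G x) b a)) => //.
  by move=> x Wx; rewrite /invmx uG// !mxE.
apply: smooth_onM => //.
  apply: smooth_onV => //; last exact: smooth_on_det.
  by move=> x Wx; rewrite -unitfE -unitmxE; exact: uG.
rewrite /cofactor; apply: smooth_onZ => //; apply: smooth_on_det => // k l.
apply: (@smooth_on_ext _ _ _ _ (fun x => G x (lift b k) (lift a l))) => //.
by move=> x _; rewrite !mxE.
Qed.

(** The spanning hypothesis concerns global forms; a coordinate covector has to be cut off to become
    one. *)
Lemma cutoff_coord_is_form (chi : M -> R) (K : set M) i (l : 'I_m) :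
  smooth chi -> closed K -> K `<=` tdom i -> (forall y, ~ K y -> chi y = 0) ->
  is_form ((fun x v => chi x * coord (frame i x) l (v ord0)) : form A 1).
Proof.
move=> sc cK Ki c0; split=> [x|j J].
  apply: (@covec_alternating _ _ (fun u => chi x * coord (frame i x) l u)) => a u v.
  by rewrite linearP mulrDr mulrCA.
apply: (cutoff_smooth_on sc cK (tdom_open i) Ki c0 (tdom_open j)).
by have := @frame_change_smooth _ _ _ _ A j i l (J ord0); rewrite setIC.
Qed.

Hypothesis hspan : dual_locally_spanned_by_differentials L.

(** At x0 the coordinate covectors are combinations of finitely many differentials, so the matrix C
    of these in the frame has a left inverse; m of its rows then form an invertible matrix. *)
Lemma differential_coframe i x0 : tdom i x0 ->
  exists f : 'I_m -> M -> R, (forall k, smooth (f k)) /\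
    \matrix_(k, l) dfun L (f k) x0 (fun=> tnth (frame i x0) l) \in unitmx.
Proof.
move=> ix.
have [chi [K [sc c1 cK Ki c0]]] := bump_exists (conj (tdom_open i) ix).
have [U [oU Ux HU]] := hspan x0.
have /choice[q qP] : forall k : 'I_m, exists q : {N : nat & (('I_N -> M -> R) * ('I_N -> R))%type},
    (forall r, smooth ((projT2 q).1 r)) /\
    forall u, coord (frame i x0) k u =
      \sum_r (projT2 q).2 r * dfun L ((projT2 q).1 r) x0 (fun=> u).
  move=> k; have [N [f [h [sf sh E]]]] := HU _ (cutoff_coord_is_form k sc cK Ki c0).
  exists (existT _ N (f, fun r => h r x0)); split=> // u /=.
  by rewrite -E// (nbhs_singleton c1) mul1r.
(* The differentials used for the various k are put into one family; B collects their
   coefficients. *)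
pose T := {k : 'I_m & 'I_(projT1 (q k))}.
pose F (a : T) := (projT2 (q (tag a))).1 (tagged a).
pose H (a : T) := (projT2 (q (tag a))).2 (tagged a).
pose B := \matrix_(k < m, b < #|{: T}|) ((tag (enum_val b) == k)%:R * H (enum_val b)).
pose C := \matrix_(b < #|{: T}|, l < m) dfun L (F (enum_val b)) x0 (fun=> tnth (frame i x0) l).
have BC : B *m C = 1%:M.
  apply/matrixP => k l; rewrite !mxE.
  transitivity (\sum_(a : T) (tag a == k)%:R * H a * dfun L (F a) x0 (fun=> tnth (frame i x0) l)).
    rewrite (reindex (@enum_val _ {: T})) /=; last first.
      by apply: onW_bij; exact: enum_val_bij.
    by apply: eq_bigr => b _; rewrite !mxE.
  transitivity (\sum_(k' < m) \sum_(r < projT1 (q k')) (k' == k)%:R * (projT2 (q k')).2 r *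
      dfun L ((projT2 (q k')).1 r) x0 (fun=> tnth (frame i x0) l)).
    by rewrite sig_big_dep.
  rewrite (bigD1 k)//= [X in _ + X]big1 ?addr0; last first.
    by move=> k' /negbTE kk; rewrite big1// => r _; rewrite kk !mul0r.
  under eq_bigr do rewrite eqxx mul1r.
  by rewrite -(qP k).2 (coord_tnth (frame_basis ix)).
have fC : row_full C by apply/row_fullP; exists B.
exists (fun k => F (enum_val (fullrankfun fC k))); split=> [k|].
  exact: (qP (tag (enum_val (fullrankfun fC k)))).1.
have := fullrowsub_unit fC; congr (_ \in unitmx).
by apply/matrixP => k l; rewrite !mxE.
Qed.

(** The f k and e k are global because brackets and modular multisections are specified on global
    arguments; W is where the duality holds. *)
Definition adapted (W : set M) (f : 'I_m -> M -> R) (e : 'I_m -> section A) i :=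
  [/\ open W, W `<=` tdom i, forall k, smooth (f k), forall k, smooth_sec (e k) &
      forall y, W y -> forall k l, act L (e k) (f l) y = (k == l)%:R].

Lemma adapted_exists i x0 : tdom i x0 -> exists W (f : 'I_m -> M -> R) e, adapted W f e i /\ W x0.
Proof.
move=> ix; have [f [sf uf]] := differential_coframe ix.
pose G x := \matrix_(k, l) dfun L (f k) x (fun=> tnth (frame i x) l).
have oi := tdom_open i.
have sG a b : smooth_on (tdom i) (fun x => G x a b).
  rewrite (_ : (fun x => _) = fun x => dfun L (f a) x (fun=> tnth (frame i x) b)).
    exact: smooth_on_dfun_frame.
  by apply/funext => x; rewrite mxE.
have dG : {for x0, continuous (fun x => \det (G x))}.
  by apply: (smooth_on_continuous oi) => //; exact: smooth_on_det.
have dG0 : \det (G x0) != 0 by rewrite -unitfE -unitmxE.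
have nG : \forall y \near x0, \det (G y) != 0.
  by apply: (dG [set t : R | t != 0]); apply: open_nbhs_nbhs; split=> //; exact: open_neq.
pose N := [set y | \det (G y) != 0]° `&` tdom i.
have oN : open N by apply: openI => //; exact: open_interior.
have uG y : N y -> G y \in unitmx.
  by move=> [/interior_subset /= h _]; rewrite unitmxE unitfE.
(* The columns of the inverse of the matrix of the d f_k form the dual frame, smooth where that
   matrix is invertible. *)
pose e0 k y := \sum_l invmx (G y) l k *: tnth (frame i y) l.
have se0 k : smooth_sec_on N (e0 k).
  apply: (@smooth_sec_on_triv i) => // [y []//|l].
  apply: (@smooth_on_ext _ _ _ _ (fun x => invmx (G x) l k)) => //.
    move=> y [_ iy]; rewrite /e0 linear_sum/= (bigD1 l)//= linearZ/= (coord_tnth (frame_basis iy)).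
    rewrite eqxx mulr1 big1 ?addr0// => l' ll'.
    by rewrite linearZ/= (coord_tnth (frame_basis iy)) eq_sym (negbTE ll') mulr0.
  apply: smooth_on_invmx => // a b; apply: smooth_on_sub (sG a b) => y []//.
have /choice[e eP] : forall k : 'I_m, exists e, smooth_sec e /\ \forall y \near x0, e y = e0 k y.
  move=> k; have [|X sX XE] := smooth_sec_extension oN (se0 k) (x := x0).
    by split.
  by exists X.
have nE : \forall y \near x0, forall k : 'I_m, e k y = e0 k y.
  have := @filter_forall _ 'I_m (fun k (y : M) => e k y = e0 k y) (nbhs x0) _.
  by apply=> k; exact: (eP k).2.
exists (N `&` [set y | forall k : 'I_m, e k y = e0 k y]°), f, e; split; last first.
  by split=> //; split.
split=> //; first by apply: openI => //; exact: open_interior.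
- by move=> y [[]].
- by move=> k; exact: (eP k).1.
move=> y [Ny /interior_subset /= yE] k l.
have -> : act L (e k) (f l) y = dfun L (f l) y (upd (fun=> 0) ord0 (e k y)).
  by rewrite upd_one.
rewrite yE /e0 multilinear_sum; last exact: (dfun_alternating _ (sf l)).1.
transitivity ((G y *m invmx (G y)) l k); last by rewrite mulmxV ?uG// mxE eq_sym.
by rewrite mxE; apply: eq_bigr => a _; rewrite upd_one !mxE mulrC.
Qed.

End BundleSmoothness.

(** * Derivatives of sums and products of germs *)

Section DerivationSums.
Context {R : realType} {d : nat} {M : manifold R d}.
Implicit Types (f g : M -> R) (x y : M) (v : 'rV[R]_d).

Lemma smooth_near_cst x (c : R) : smooth_near x (fun=> c).
Proof. by apply: smooth_smooth_near => i k; exact: smooth_on_cst. Qed.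

Lemma smooth_nearD x f g : smooth_near x f -> smooth_near x g ->
  smooth_near x (fun y => f y + g y).
Proof.
move=> sf sg; have [W [oW Wx] [Wf Wg]] := smooth_nearI sf sg.
by exists W => //; exact: smooth_onD.
Qed.

Lemma smooth_nearM x f g : smooth_near x f -> smooth_near x g ->
  smooth_near x (fun y => f y * g y).
Proof.
move=> sf sg; have [W [oW Wx] [Wf Wg]] := smooth_nearI sf sg.
by exists W => //; exact: smooth_onM.
Qed.

Lemma smooth_near_sum x (I : Type) (r : seq I) (P : pred I) (g : I -> M -> R) :
  (forall a, P a -> smooth_near x (g a)) -> smooth_near x (fun y => \sum_(a <- r | P a) g a y).
Proof.
move=> sg; elim: r => [|a r IH].
  by under eq_fun do rewrite big_nil; exact: smooth_near_cst.
case Pa : (P a).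
  by under eq_fun do rewrite big_cons Pa; apply: smooth_nearD => //; exact: sg.
by under eq_fun do rewrite big_cons Pa.
Qed.

Lemma smooth_near_prod x (I : Type) (r : seq I) (P : pred I) (g : I -> M -> R) :
  (forall a, P a -> smooth_near x (g a)) -> smooth_near x (fun y => \prod_(a <- r | P a) g a y).
Proof.
move=> sg; elim: r => [|a r IH].
  by under eq_fun do rewrite big_nil; exact: smooth_near_cst.
case Pa : (P a).
  by under eq_fun do rewrite big_cons Pa; apply: smooth_nearM => //; exact: sg.
by under eq_fun do rewrite big_cons Pa.
Qed.

Lemma tderive_sum x v (I : Type) (r : seq I) (P : pred I) (g : I -> M -> R) :
  (forall a, P a -> smooth_near x (g a)) ->
  tderive x v (fun y => \sum_(a <- r | P a) g a y) =
  \sum_(a <- r | P a) tderive x v (g a).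
Proof.
move=> sg; elim: r => [|a r IH].
  by under eq_fun do rewrite big_nil; rewrite big_nil; exact: tderive_cst.
rewrite big_cons; case Pa : (P a).
  under eq_fun do rewrite big_cons Pa; rewrite tderiveD ?IH//; first exact: sg.
  exact: smooth_near_sum.
by under eq_fun do rewrite big_cons Pa.
Qed.

Lemma tderive_prod x v k (g : 'I_k -> M -> R) :
  (forall a, smooth_near x (g a)) ->
  tderive x v (fun y => \prod_a g a y) =
  \sum_a tderive x v (g a) * \prod_(b | b != a) g b x.
Proof.
elim: k g => [|k IH] g sg.
  by under eq_fun do rewrite big_ord0; rewrite big_ord0; exact: tderive_cst.
under eq_fun do rewrite big_ord_recl.
rewrite tderiveM; [|exact: sg|by apply: smooth_near_prod => a _; exact: sg].
rewrite big_ord_recl addrC mulrC; congr (_ + _).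
  congr (_ * _); rewrite [RHS]big_mkcond/= big_ord_recl eqxx mul1r.
  by apply: eq_bigr.
rewrite (IH (fun a => g (lift ord0 a))); last by move=> a; exact: sg.
rewrite mulr_sumr.
apply: eq_bigr => a _; rewrite mulrCA; congr (_ * _).
rewrite [RHS]big_mkcond/= big_ord_recl neq_lift; congr (_ * _).
by rewrite big_mkcond; apply: eq_bigr => b _; rewrite (inj_eq lift_inj).
Qed.

End DerivationSums.

#[local] Opaque tderive.

Lemma sum_kronecker (R : pzRingType) m (F : 'I_m -> R) l :
  \sum_k F k * (k == l)%:R = F l.
Proof.
rewrite (bigD1 l)//= eqxx mulr1 big1 ?addr0// => k /negbTE->.
by rewrite mulr0.
Qed.

(** Sign bookkeeping for [dformE]: the first sum comes from the Leibniz rule, the other two from the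
    halves of the bracket. Terms with r < t cancel at once, those with t < r by the hypothesis. *)
Lemma sum_signed_pairs (R : pzRingType) n (G H : 'I_n -> 'I_n -> R) :
  (forall r t : 'I_n, (t < r)%N -> (-1) ^+ r * G r t + (-1) ^+ t * H t r = 0) ->
  \sum_(r < n) \sum_(t < n | t != r) (-1) ^+ r * G r t +
  (\sum_(r < n) \sum_(t < n | (r < t)%N) (-1) ^+ r.+1 * G r t +
   \sum_(r < n) \sum_(t < n | (r < t)%N) (-1) ^+ r * H r t) = 0.
Proof.
move=> GH.
have -> : \sum_(r < n) \sum_(t < n | t != r) (-1) ^+ r * G r t =
    \sum_(r < n) \sum_(t < n | (r < t)%N) (-1) ^+ r * G r t +
    \sum_(r < n) \sum_(t < n | (t < r)%N) (-1) ^+ r * G r t.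
  rewrite -big_split/=; apply: eq_bigr => r _.
  rewrite (bigID (fun t : 'I_n => (r < t)%N))/=; congr (_ + _); apply: eq_bigl => t.
    by rewrite -(inj_eq val_inj)/=; case: ltngtP.
  by rewrite -(inj_eq val_inj)/=; case: ltngtP.
have -> : \sum_(r < n) \sum_(t < n | (r < t)%N) (-1) ^+ r.+1 * G r t =
   - \sum_(r < n) \sum_(t < n | (r < t)%N) (-1) ^+ r * G r t.
  rewrite -sumrN; apply: eq_bigr => r _; rewrite -sumrN; apply: eq_bigr => t _.
  by rewrite exprS mulN1r mulNr.
have -> : \sum_(r < n) \sum_(t < n | (r < t)%N) (-1) ^+ r * H r t =
   - \sum_(r < n) \sum_(t < n | (t < r)%N) (-1) ^+ r * G r t.
  rewrite (exchange_big_dep xpredT)//= -sumrN; apply: eq_bigr => r _.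
  rewrite -sumrN; apply: eq_bigr => t tr.
  by have /eqP := GH _ _ tr; rewrite addrC addr_eq0 => /eqP.
by rewrite addrACA addrN add0r addrN.
Qed.

(** * The flat connection of an adapted frame *)

Section AdaptedFrame.
Context {R : realType} {d : nat} {M : manifold R d} {m : nat}.
Context {A : vbundle M m} (L : lie_algebroid A).
Variables (W : set M) (f : 'I_m -> M -> R) (e : 'I_m -> section A) (i : triv_idx A).
Hypothesis ad : adapted L W f e i.
Implicit Types (g : M -> R) (x y : M) (X Y Z : section A).

Let oW : open W. Proof. by case: ad. Qed.
Let Wi : W `<=` tdom i. Proof. by case: ad. Qed.
Let sf k : smooth (f k). Proof. by case: ad. Qed.
Let se k : smooth_sec (e k). Proof. by case: ad. Qed.
Let ef y : W y -> forall k l, act L (e k) (f l) y = (k == l)%:R.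
Proof. by case: ad => _ _ _ _; apply. Qed.

Definition etuple y : m.-tuple (fib A y) := [tuple e k y | k < m].

Lemma tnth_etuple y k : tnth (etuple y) k = e k y.
Proof. exact: tnth_mktuple. Qed.

(** The pointwise version of [act]: a connection is tensorial in its direction, which is therefore a
    vector and not a section. *)
Definition tact y (u : fib A y) g : R := tderive y (anchor L y u) g.

Lemma tact_linear y g : smooth_near y g -> forall a (u v : fib A y),
  tact (a *: u + v) g = a * tact u g + tact v g.
Proof. exact: tderive_anchor_linear. Qed.

Lemma tact_e y k l : W y -> tact (e k y) (f l) = (k == l)%:R.
Proof. by move=> Wy; exact: ef. Qed.

Lemma tactB y g (u v : fib A y) : smooth_near y g ->
  tact (u - v) g = tact u g - tact v g.
Proof.
move=> sg; have := tact_linear sg (-1) v u.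
by rewrite scaleN1r mulN1r addrC => ->; rewrite addrC.
Qed.

Lemma tact0 y g : tact (0 : fib A y) g = 0.
Proof. by rewrite /tact linear0 tderive0. Qed.

Lemma tact_sum y g (c : 'I_m -> R) (u : 'I_m -> fib A y) : smooth_near y g ->
  tact (\sum_k c k *: u k) g = \sum_k c k * tact (u k) g.
Proof.
move=> sg; elim: (index_enum _) => [|k r IH].
  by rewrite !big_nil /tact linear0 tderive0.
by rewrite !big_cons tact_linear// IH.
Qed.

(** Applying a linear relation to f_l isolates its l-th coefficient; the dimension is known from the
    trivialisation. *)
Lemma etuple_basis y : W y -> basis_of {:fib A y} (etuple y).
Proof.
move=> Wy.
have dm : \dim {:fib A y} = m by exact: size_basis (frame_basis (Wi Wy)).
rewrite basisEfree subvf size_tuple dm leqnn !andbT.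
apply/freeP => c c0 l.
have := @tact_sum y (f l) c (fun k => e k y) (smooth_smooth_near y (sf l)).
have -> : \sum_k c k *: e k y = 0.
  by rewrite -[RHS]c0; apply: eq_bigr => k _; rewrite -tnth_etuple (tnth_nth 0).
rewrite {1}/tact linear0 tderive0 => /esym.
rewrite (bigD1 l)//= (tact_e _ _ Wy) eqxx mulr1 big1 ?addr0// => k kl.
by rewrite (tact_e _ _ Wy) (negbTE kl) mulr0.
Qed.

Lemma coord_etuple y l (u : fib A y) : W y -> coord (etuple y) l u = tact u (f l).
Proof.
move=> Wy; rewrite {2}(coord_expand (etuple_basis Wy) u) tact_sum; last exact: smooth_smooth_near.
rewrite (bigD1 l)//= tnth_etuple (tact_e _ _ Wy) eqxx mulr1 big1 ?addr0// => k kl.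
by rewrite tnth_etuple (tact_e _ _ Wy) (negbTE kl) mulr0.
Qed.

Lemma etuple_expand y (u : fib A y) : W y -> u = \sum_k tact u (f k) *: e k y.
Proof.
move=> Wy; rewrite {1}(coord_expand (etuple_basis Wy) u).
by apply: eq_bigr => k _; rewrite tnth_etuple coord_etuple.
Qed.

Lemma tactE y (u : fib A y) g : W y -> smooth_near y g ->
  tact u g = \sum_k tact u (f k) * act L (e k) g y.
Proof. by move=> Wy sg; rewrite {1}(etuple_expand u Wy) tact_sum. Qed.

(** Injectivity of the anchor over W: equalities of vectors are tested on the f_l. *)
Lemma etuple_inj y (u u' : fib A y) : W y -> (forall l, tact u (f l) = tact u' (f l)) -> u = u'.
Proof.
move=> Wy H; rewrite (etuple_expand u Wy) (etuple_expand u' Wy).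
by apply: eq_bigr => k _; rewrite H.
Qed.

Lemma near_W x : W x -> \forall y \near x, W y.
Proof. by move=> Wx; apply: open_nbhs_nbhs. Qed.

Lemma smooth_act_f X k : smooth_sec X -> smooth (act L X (f k)).
Proof. by move=> sX; exact: smooth_act. Qed.

(* The flat connection for which the commuting frame [e] is parallel. *)
Definition nabla_sec x (u : fib A x) X : fib A x :=
  \sum_l tact u (act L X (f l)) *: e l x.

Lemma tact_nabla_sec x (u : fib A x) X l : W x ->
  tact (nabla_sec u X) (f l) = tact u (act L X (f l)).
Proof.
move=> Wx; rewrite /nabla_sec (tact_sum _ _ (smooth_smooth_near x (sf l))).
under eq_bigr => k _ do rewrite (tact_e _ _ Wx).
exact: sum_kronecker.
Qed.

Lemma act_tact X g x : act L X g x = tact (X x) g.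
Proof. by []. Qed.

Lemma dfun_tact g y : dfun L g y = covec (fun u => tact u g).
Proof. by []. Qed.

Lemma tactM y (u : fib A y) g h : smooth_near y g -> smooth_near y h ->
  tact u (fun z => g z * h z) = g y * tact u h + h y * tact u g.
Proof. exact: tderiveM. Qed.

Lemma tact_scale y (u : fib A y) (c : R) g : smooth_near y g ->
  tact u (fun z => c * g z) = c * tact u g.
Proof.
move=> sg; rewrite tactM//; last exact: smooth_near_cst.
by rewrite [X in _ + _ * X]tderive_cst mulr0 addr0.
Qed.

#[local] Opaque act tact nabla_sec.

(** Tested on the f_l, this is the compatibility of the anchor with brackets. *)
Lemma bracket_nabla X Y x : W x -> smooth_sec X -> smooth_sec Y ->
  bracket L X Y x = nabla_sec (X x) Y - nabla_sec (Y x) X.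
Proof.
move=> Wx sX sY; apply: etuple_inj => // l.
rewrite (tactB (nabla_sec (X x) Y) (nabla_sec (Y x) X) (smooth_smooth_near x (sf l))).
transitivity (tact (X x) (act L Y (f l)) - tact (Y x) (act L X (f l))).
  by rewrite -!act_tact; apply: act_bracket => //; exact: smooth_smooth_near.
by congr (_ - _); symmetry; exact: tact_nabla_sec.
Qed.

Section Forms.
Variable k : nat.
Implicit Types (w : form A k) (J : {ffun 'I_k -> 'I_m}).

Definition wcoef w J : M -> R := eval w (fun a => e (J a)).

(* Forms that are only given over [W], such as the representatives of a
   density, are allowed. *)
Definition local_form w :=
  (forall y, W y -> alternating (w y)) /\ forall J, smooth_on W (wcoef w J).

Lemma is_form_local w : is_form w -> local_form w.
Proof.
move=> fw; split=> [y _|J]; first by case: fw.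
by apply: smooth_smooth_on; apply: smooth_eval.
Qed.

(** Written as an expansion in the coframe, it is alternating for every w; the factor is that of
    [alternating_expand]. *)
Definition nabla w x (u : fib A x) : mform (fib A x) k :=
  fun v => \sum_J (k`!%:R^-1 * tact u (wcoef w J)) * wdual (etuple x) J v.

Lemma nabla_alternating w x (u : fib A x) : alternating (nabla w u).
Proof. by apply: alternating_sum => J _; exact: wdual_alternating. Qed.

(** Permuting J changes the coefficient of w by a sign throughout a neighbourhood of x, hence its
    derivative by the same sign; the k! permutations absorb the factor. *)
Lemma nabla_basis w x (u : fib A x) J : local_form w -> W x ->
  nabla w u (fun a => e (J a) x) = tact u (wcoef w J).
Proof.
move=> [aw sw] Wx; have hb := etuple_basis Wx.
rewrite /nabla.
have -> : (fun a => e (J a) x) = (fun a => tnth (etuple x) (J a)).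
  by apply/funext => a; rewrite tnth_etuple.
under eq_bigr do rewrite wdual_tnth// mulr_sumr.
rewrite exchange_big/=.
under eq_bigr => s _.
  rewrite (bigD1 [ffun a => J (s a)])//= eqxx mulr1 big1 ?addr0; last first.
    by move=> J' /negbTE->; rewrite !mulr0.
  have -> : tact u (wcoef w [ffun a => J (s a)]) = (-1) ^+ s * tact u (wcoef w J).
    transitivity (tact u (fun y => (-1) ^+ s * wcoef w J y)).
      apply: near_eq_tderive; apply: filterS (near_W Wx) => y Wy.
      rewrite /wcoef /eval -alternating_perm; last exact: aw.
      by congr (w y); apply/funext => a; rewrite ffunE.
    by apply: tact_scale; exact: smooth_near_on (sw J).
  rewrite -mulrA [X in _ * X]mulrC [X in _ * X]mulrA -signr_addb addbb mul1r.
  over.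
rewrite /= sumr_const card_Sn -[LHS]mulr_natl mulrA divff ?mul1r//.
Qed.

(** The product rule for w (Y) = sum_J w_J prod_a Y_a f_(J a), where the derivatives of Y_a f_l are
    the components of nabla_u Y_a. *)
Lemma act_eval w (Y : 'I_k -> section A) x (u : fib A x) : local_form w -> W x ->
  (forall a, smooth_sec (Y a)) ->
  tact u (eval w Y) = nabla w u (fun a => Y a x) +
    \sum_a w x (upd (fun b => Y b x) a (nabla_sec u (Y a))).
Proof.
move=> lw Wx sY; have [aw sw] := lw.
pose c J a y := act L (Y a) (f (J a)) y.
have sc J a : smooth_near x (c J a).
  by apply: smooth_smooth_near; exact: smooth_act_f.
have swx J : smooth_near x (wcoef w J) by apply: smooth_near_on (sw J).
have E : tact u (eval w Y) = tact u (fun y => \sum_J wcoef w J y * \prod_a c J a y).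
  apply: near_eq_tderive; apply: filterS (near_W Wx) => y Wy.
  rewrite /eval (multilinear_expand (etuple_basis Wy) _ (aw _ Wy).1).
  apply: eq_bigr => J _; congr (_ * _).
    by congr (w y); apply/funext => a; rewrite tnth_etuple.
  by apply: eq_bigr => a _; rewrite coord_etuple.
rewrite E {E} [LHS]tderive_sum; last first.
  by move=> J _; apply: smooth_nearM => //; apply: smooth_near_prod.
under eq_bigr => J _.
  rewrite tderiveM//; last by apply: smooth_near_prod.
  rewrite tderive_prod// mulr_sumr; over.
rewrite big_split/= addrC; congr (_ + _).
  rewrite (multilinear_expand (etuple_basis Wx) _ (nabla_alternating w u).1).
  apply: eq_bigr => J _; rewrite mulrC; congr (_ * _).
    transitivity (nabla w u (fun a => e (J a) x)); first by rewrite nabla_basis.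
    by congr (nabla w u); apply/funext => a; rewrite tnth_etuple.
  by apply: eq_bigr => a _; rewrite coord_etuple.
rewrite exchange_big/=; apply: eq_bigr => a _.
rewrite (multilinear_expand (etuple_basis Wx) _ (aw _ Wx).1).
apply: eq_bigr => J _; congr (_ * _).
  by rewrite /wcoef /eval; congr (w x); apply/funext => b; rewrite tnth_etuple.
rewrite [RHS](bigD1 a)//= upd_same coord_etuple// tact_nabla_sec//; congr (_ * _).
by apply: eq_bigr => b ba; rewrite upd_other// coord_etuple.
Qed.

(** A combination of the e_k with constant coefficients is an extension, so the default value in
    [extend] is never taken. *)
Lemma extend_spec x (v : fib A x) : W x -> smooth_sec (extend x v) /\ extend x v x = v.
Proof.
move=> Wx; rewrite /extend; case: xgetP => [X -> //|H].
exfalso; apply: (H (fun y => \sum_k0 tact v (f k0) *: e k0 y)); split.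
  by apply: smooth_sec_sum => // a _ j l; exact: smooth_on_cst.
by rewrite -etuple_expand.
Qed.

(** By torsion-freeness the derivatives of the extensions along X cancel; only derivatives of X
    remain, and the choice made by [extend] disappears. *)
Lemma lie_formE X w x v : local_form w -> W x -> smooth_sec X ->
  lie_form L X w x v = nabla w (X x) v +
    \sum_a w x (upd v a (nabla_sec (v a) X)).
Proof.
move=> lw Wx sX; rewrite /lie_form.
have sY a : smooth_sec (extend x (v a)) by have [] := extend_spec (v a) Wx.
have Yx : (fun a => extend x (v a) x) = v.
  by apply/funext => a; have [] := extend_spec (v a) Wx.
have -> : act L X (eval w (fun a => extend x (v a))) x =
    tact (X x) (eval w (fun a => extend x (v a))) by [].
rewrite act_eval// Yx -addrA; congr (_ + _).
rewrite -sumrB; apply: eq_bigr => a _.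
rewrite bracket_nabla// (extend_spec (v a) Wx).2.
have mw := (lw.1 _ Wx).1.
rewrite [X in _ - X](multilinearD _ _ _ _ mw).
rewrite -[- nabla_sec (v a) X]scaleN1r [X in _ - (_ + X)](multilinearZ _ _ _ _ mw) mulN1r.
by rewrite opprD opprK addrA addrN add0r.
Qed.

(** Only the terms c = a and c = b have no repeated argument; a transposition exchanges them. *)
Lemma alternating_derivation_term (V : vectType R) (w : mform V k) (v : 'I_k -> V)
    (g : V -> V) a b :
  alternating w -> a != b -> v a = v b -> \sum_c w (upd v c (g (v c))) = 0.
Proof.
move=> aw ab vab; rewrite (bigD1 a)//= (bigD1 b)/=; last by rewrite eq_sym.
rewrite big1 ?addr0; last first.
  by move=> c /andP[ca cb]; apply: (aw.2 _ a b ab); rewrite !upd_other// eq_sym.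
have -> : upd v b (g (v b)) = fun l => upd v a (g (v a)) (tperm a b l).
  apply/funext => l; rewrite /upd; case: tpermP => [->|->|/eqP/negbTE-> /eqP/negbTE->//].
    by rewrite (negbTE ab) eq_sym (negbTE ab).
  by rewrite !eqxx vab.
by rewrite (alternating_swap _ aw ab) addrN.
Qed.

Lemma lie_form_alternating X w x : local_form w -> W x -> smooth_sec X ->
  alternating (lie_form L X w x).
Proof.
move=> lw Wx sX.
have aw := lw.1 _ Wx.
have -> : lie_form L X w x = fun v => nabla w (X x) v +
    \sum_a w x (upd v a (nabla_sec (v a) X)).
  by apply/funext => v; exact: lie_formE.
have an := nabla_alternating w (X x).
split=> [v a c u u'|v a b ab vab]; last first.
  rewrite (an.2 _ _ _ ab vab) add0r.
  exact: (alternating_derivation_term (fun z => nabla_sec z X) aw ab vab).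
have nl (z z' : fib A x) : nabla_sec (c *: z + z') X = c *: nabla_sec z X + nabla_sec z' X.
  apply: etuple_inj => // l; have H := smooth_smooth_near x (sf l).
  rewrite (tact_linear H c (nabla_sec z X) (nabla_sec z' X)).
  transitivity (c * tact z (act L X (f l)) + tact z' (act L X (f l))); last first.
    by symmetry; congr (_ * _ + _); exact: tact_nabla_sec.
  transitivity (tact (c *: z + z') (act L X (f l))); first exact: tact_nabla_sec.
  by apply: tact_linear; apply: smooth_smooth_near; exact: smooth_act_f.
rewrite an.1 mulrDr addrACA; congr (_ + _).
rewrite mulr_sumr -big_split/=; apply: eq_bigr => b _.
have [->|ba] := eqVneq b a.
  by rewrite !upd_same !upd_upd nl aw.1.
have ab : a != b by rewrite eq_sym.
by rewrite !upd_other// !(updC _ _ _ ab) aw.1.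
Qed.

(** For a torsion-free connection d is the alternation of nabla. The derivatives of the extensions
    cancel against the brackets, half of them directly and half after moving an argument to another
    slot. *)
Lemma dformE w x v : is_form w -> W x ->
  dform L w x v = \sum_(r < k.+1) (-1) ^+ r * nabla w (v r) (fun a => v (lift r a)).
Proof.
move=> fw Wx; have lw := is_form_local fw; have aw := lw.1 _ Wx.
pose V r := extend x (v r).
have sV r : smooth_sec (V r) by have [] := extend_spec (v r) Wx.
have Vx r : V r x = v r by have [] := extend_spec (v r) Wx.
pose N r t := nabla_sec (v r) (V t).
pose B (r t : 'I_k.+1) u := w x (fun a => upd v t u (lift r a)).
have lB r t u u' : t != r -> B r t (u - u') = B r t u - B r t u'.
  move=> tr; have /unlift_some[a ta _] : r != t by rewrite eq_sym.
  have E z : (fun b => upd v t z (lift r b)) = upd (fun b => v (lift r b)) a z.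
    by apply/funext => b; rewrite /upd ta (inj_eq lift_inj).
  rewrite /B !E (multilinearD _ _ _ _ aw.1) -[- u']scaleN1r.
  by rewrite [X in _ + X](multilinearZ _ _ _ _ aw.1) mulN1r.
rewrite /dform /leibniz_diff -/V.
have -> : \sum_(r < k.+1) (-1) ^+ r * act L (V r) (eval w (fun a => V (lift r a))) x =
    \sum_(r < k.+1) (-1) ^+ r * nabla w (v r) (fun a => v (lift r a)) +
    \sum_(r < k.+1) \sum_(t < k.+1 | t != r) (-1) ^+ r * B r t (N r t).
  rewrite -big_split/=; apply: eq_bigr => r _.
  have -> : act L (V r) (eval w (fun a => V (lift r a))) x =
      tact (v r) (eval w (fun a => V (lift r a))) by rewrite act_tact Vx.
  rewrite act_eval// mulrDr; congr (_ * _ + _).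
    by congr (nabla w _); apply/funext => a; rewrite Vx.
  rewrite -mulr_sumr; congr (_ * _).
  rewrite [RHS](reindex_omap (lift r) (unlift r))/=; last first.
    by move=> t; rewrite eq_sym => /unlift_some[a -> ->].
  rewrite [RHS](eq_bigl xpredT); last first.
    by move=> a; rewrite eq_sym neq_lift liftK eqxx.
  apply: eq_bigr => a _; congr (w x); apply/funext => b.
  by rewrite /upd (inj_eq lift_inj) /N Vx.
have -> : \sum_(r < k.+1) \sum_(t < k.+1 | (r < t)%N) (-1) ^+ r.+1 *
     eval w (fun a => upd V t (bracket L (V r) (V t)) (lift r a)) x =
    \sum_(r < k.+1) \sum_(t < k.+1 | (r < t)%N) (-1) ^+ r.+1 * B r t (N r t) +
    \sum_(r < k.+1) \sum_(t < k.+1 | (r < t)%N) (-1) ^+ r * B r t (N t r).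
  rewrite -big_split/=; apply: eq_bigr => r _; rewrite -big_split/=; apply: eq_bigr => t rt.
  have tr : t != r by apply: contraTN rt => /eqP->; rewrite ltnn.
  have bE : bracket L (V r) (V t) x = N r t - N t r.
    by rewrite (bracket_nabla Wx (sV r) (sV t)) (Vx r) (Vx t).
  have -> : eval w (fun a => upd V t (bracket L (V r) (V t)) (lift r a)) x =
      B r t (N r t - N t r).
    rewrite /eval /B; congr (w x); apply/funext => a; rewrite /upd.
    by case: ifP => _; [exact: bE|exact: Vx].
  have sg (b1 b2 : R) : (-1) ^+ r.+1 * (b1 - b2) = (-1) ^+ r.+1 * b1 + (-1) ^+ r * b2.
    by rewrite mulrBr exprS mulN1r !mulNr opprK.
  transitivity ((-1) ^+ r.+1 * (B r t (N r t) - B r t (N t r))); last exact: sg.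
  by congr (_ * _); exact: (lB r t (N r t) (N t r) tr).
rewrite -[RHS]addr0 -addrA; congr (_ + _).
have := @sum_signed_pairs R k.+1 (fun r t => B r t (N r t)) (fun r t => B r t (N t r)).
apply=> r t tr.
have rt : r != t by apply: contraTN tr => /eqP->; rewrite ltnn.
(* The same vector in slots r and t: deleting one or the other gives the two terms to be
   compared. *)
pose u := upd (upd v t (N r t)) r (N r t).
have urt : u r = u t by rewrite /u upd_same upd_other ?upd_same// eq_sym.
have := alternating_delete aw rt urt.
have -> : (fun a => u (lift r a)) = (fun a => upd v t (N r t) (lift r a)).
  by apply/funext => a; rewrite /u upd_other// eq_sym neq_lift.
have -> : (fun a => u (lift t a)) = (fun a => upd v r (N r t) (lift t a)).
  apply/funext => a; rewrite /u updC 1?eq_sym// upd_other//.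
  by rewrite eq_sym neq_lift.
exact.
Qed.

(** For r different from a and b both equal arguments remain in F; the two other terms cancel by
    [alternating_delete]. *)
Lemma alternating_alternation (V : vectType R) (F : V -> mform V k) (v : 'I_k.+1 -> V) a b :
  (forall u, alternating (F u)) -> a != b -> v a = v b ->
  \sum_(r < k.+1) (-1) ^+ r * F (v r) (fun c => v (lift r c)) = 0.
Proof.
move=> aF ab vab; rewrite (bigD1 a)//= (bigD1 b)/=; last by rewrite eq_sym.
rewrite addrA [X in _ + X]big1 ?addr0.
  rewrite vab; exact: (alternating_delete (aF (v b)) ab vab).
move=> r /andP[ra rb].
have /unlift_some[c ac _] := ra; have /unlift_some[c' bc' _] := rb.
rewrite ((aF (v r)).2 _ c c') ?mulr0//; last by rewrite -ac -bc'.
by apply: contra ab => /eqP cc; rewrite ac bc' cc.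
Qed.

Lemma nabla_linear w x (u u' : fib A x) c v : local_form w -> W x ->
  nabla w (c *: u + u') v = c * nabla w u v + nabla w u' v.
Proof.
move=> lw Wx; rewrite /nabla mulr_sumr -big_split/=; apply: eq_bigr => J _.
rewrite tact_linear; last exact: smooth_near_on (lw.2 J).
by rewrite mulrDr mulrDl !mulrA [c * _]mulrC.
Qed.

Lemma dform_alternating w x : is_form w -> W x -> alternating (dform L w x).
Proof.
move=> fw Wx; have lw := is_form_local fw.
have -> : dform L w x = fun v =>
    \sum_(r < k.+1) (-1) ^+ r * nabla w (v r) (fun a => v (lift r a)).
  by apply/funext => v; exact: dformE.
split=> [v a c u u'|v a b ab vab]; last first.
  by apply: (alternating_alternation _ ab vab) => u; exact: nabla_alternating.
rewrite mulr_sumr -big_split/=; apply: eq_bigr => r _.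
have an z := (nabla_alternating w (x := x) z).1.
rewrite mulrCA -mulrDr; congr (_ * _).
have [->|ra] := eqVneq r a.
  rewrite !upd_same (nabla_linear _ _ _ _ lw Wx).
  by congr (_ * nabla w u _ + nabla w u' _); apply/funext => b;
     rewrite !upd_other// eq_sym neq_lift.
have /unlift_some[b rb _] := ra.
have E z : (fun l => upd v a z (lift r l)) = upd (fun l => v (lift r l)) b z.
  by apply/funext => l; rewrite /upd {1}rb (inj_eq lift_inj).
by rewrite !E !upd_other// an.
Qed.

Lemma interior_dformE w x (u : fib A x) v : is_form w -> W x ->
  dform L w x (fun a => oapp v u (unlift ord0 a)) =
  nabla w u v - \sum_a nabla w (v a) (upd v a u).
Proof.
move=> fw Wx; rewrite dformE// big_ord_recl expr0 mul1r unlift_none; congr (_ + _).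
  by congr (nabla w u); apply/funext => a; rewrite liftK.
rewrite -sumrN; apply: eq_bigr => a _; rewrite liftK /=.
(* u occupies the initial slot and also that of v a; deleting one or the other moves u into place
   and supplies the sign. *)
pose z b := oapp (upd v a u) u (unlift ord0 b).
have z0a : z ord0 = z (lift ord0 a) by rewrite /z unlift_none liftK /= upd_same.
have n0 : ord0 != lift ord0 a :> 'I_k.+1 by rewrite neq_lift.
have := alternating_delete (nabla_alternating w (v a)) n0 z0a.
rewrite expr0 mul1r.
have -> : (fun b => z (lift ord0 b)) = upd v a u.
  by apply/funext => b; rewrite /z liftK.
have -> : (fun b => z (lift (lift ord0 a) b)) =
    (fun b => oapp v u (unlift ord0 (lift (lift ord0 a) b))).
  apply/funext => b; rewrite /z; case: unliftP => [c|//] /= cb.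
  rewrite upd_other//; apply/eqP => ca; move: (neq_lift (lift ord0 a) b).
  by rewrite cb ca eqxx.
by move=> /eqP; rewrite addrC addr_eq0 => /eqP.
Qed.

End Forms.

End AdaptedFrame.

#[local] Opaque act tact nabla_sec.

(** * Coordinate expressions in an adapted frame *)

Section AdaptedCoordinates.
Context {R : realType} {d : nat} {M : manifold R d} {m : nat}.
Context {A : vbundle M m} (L : lie_algebroid A).
Variables (W : set M) (f : 'I_m -> M -> R) (e : 'I_m -> section A) (i : triv_idx A).
Hypothesis ad : adapted L W f e i.
Implicit Types (g : M -> R) (x y : M) (X Y Z : section A).

Let oW : open W. Proof. by case: ad. Qed.
Let Wi : W `<=` tdom i. Proof. by case: ad. Qed.
Let sf k : smooth (f k). Proof. by case: ad. Qed.
Let se k : smooth_sec (e k). Proof. by case: ad. Qed.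

Definition coframe k (K : 'I_k -> 'I_m) : form A k := wedge_dfun L (fun a => f (K a)).

Arguments coframe {k} K x _.

Lemma dual_etuple y l : W y -> dual (etuple e y) l = dfun L (f l) y.
Proof.
move=> Wy; apply/funext => v; rewrite /dual /covec (coord_etuple ad)//.
Qed.

Lemma wdual_etuple k (K : 'I_k -> 'I_m) y : W y -> wdual (etuple e y) K = coframe K y.
Proof.
move=> Wy; rewrite /wdual /coframe /wedge_dfun; congr wedge1.
by apply/funext => a; rewrite dual_etuple.
Qed.

Lemma coframe_is_form k (K : 'I_k -> 'I_m) : is_form (coframe K).
Proof. by apply: wedge_dfun_is_form. Qed.

(** The generalised Kronecker symbol: the coefficients of a coframe element, constant on W. *)
Definition kronecker k (I J : {ffun 'I_k -> 'I_m}) : R :=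
  \sum_(s : 'S_k) (-1) ^+ s * (I == [ffun a => J (s a)])%:R.

Lemma etupleE k (J : {ffun 'I_k -> 'I_m}) y :
  (fun a => e (J a) y) = (fun a => tnth (etuple e y) (J a)).
Proof. by apply/funext => a; rewrite tnth_etuple. Qed.

Lemma wcoef_coframe k (I J : {ffun 'I_k -> 'I_m}) y : W y ->
  wcoef e (coframe I) J y = kronecker I J.
Proof.
move=> Wy; rewrite /wcoef /eval etupleE -wdual_etuple//.
by rewrite (wdual_tnth (etuple_basis ad Wy)).
Qed.

Lemma wcoef_expand k (w : form A k) J y : W y -> alternating (w y) ->
  wcoef e w J y = k`!%:R^-1 * \sum_I kronecker I J * wcoef e w I y.
Proof.
move=> Wy aw; rewrite {1}/wcoef /eval {1}(alternating_expand (etuple_basis ad Wy) aw).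
rewrite mulr_sumr; apply: eq_bigr => I _.
rewrite -etupleE -/(eval w _ y) -/(wcoef e w I y) -mulrA; congr (_ * _).
by rewrite mulrC [in wdual _ _ _]etupleE (wdual_tnth (etuple_basis ad Wy)).
Qed.

Section MSec.
Variables (k : nat) (xi : msec A k).
Arguments xi : clear implicits.
Hypothesis mxi : is_msec xi.

Definition xcoef (K : 'I_k -> 'I_m) : M -> R := pairing (coframe K) xi.

Lemma smooth_xcoef K : smooth (xcoef K).
Proof. by apply: smooth_pairing => //; exact: coframe_is_form. Qed.

Lemma pairing_coef (w : form A k) y : W y -> alternating (w y) ->
  pairing w xi y = k`!%:R^-1 * \sum_(J : {ffun 'I_k -> 'I_m}) wcoef e w J y * xcoef J y.
Proof.
move=> Wy aw; rewrite /pairing (mvec_pairing (etuple_basis ad Wy) aw (mxi.1 y)).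
congr (_ * _); apply: eq_bigr => J _.
by rewrite wdual_etuple// /wcoef /eval etupleE.
Qed.

End MSec.

Section LieCoframe.
Variable k : nat.
Implicit Types (w : form A k) (J : {ffun 'I_k -> 'I_m}).

Lemma upd_etuple J a l y : upd (fun b => e (J b) y) a (e l y) = (fun b => e (fupd J a l b) y).
Proof. by apply/funext => b; rewrite /upd ffunE; case: ifP. Qed.

Lemma multilinear_upd_expand y (w : mform (fib A y) k) (v : 'I_k -> fib A y) a (u : fib A y) :
  W y -> multilinear w ->
  w (upd v a u) = \sum_l tact L u (f l) * w (upd v a (e l y)).
Proof. by move=> Wy mw; rewrite {1}(etuple_expand ad u Wy) multilinear_sum. Qed.

Lemma lie_coef w X J y : local_form W e w -> W y -> smooth_sec X ->
  lie_form L X w y (fun a => e (J a) y) = act L X (wcoef e w J) y +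
    \sum_a \sum_l act L (e (J a)) (act L X (f l)) y * wcoef e w (fupd J a l) y.
Proof.
move=> lw Wy sX; rewrite (lie_formE ad _ lw Wy sX) (nabla_basis ad _ J lw Wy); congr (_ + _).
apply: eq_bigr => a _.
rewrite (multilinear_upd_expand _ _ _ Wy (lw.1 _ Wy).1); apply: eq_bigr => l _.
rewrite upd_etuple; congr (_ * _).
exact: (tact_nabla_sec ad (e (J a) y) X l Wy).
Qed.

Lemma interior_dform_coef w (u : forall y, fib A y) J y : is_form w -> W y ->
  interior u (dform L w) y (fun a => e (J a) y) =
  \sum_l tact L (u y) (f l) * (act L (e l) (wcoef e w J) y -
    \sum_a act L (e (J a)) (wcoef e w (fupd J a l)) y).
Proof.
move=> fw Wy; have lw := is_form_local ad fw.
rewrite /interior (interior_dformE ad (u y) (fun a => e (J a) y) fw Wy).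
rewrite (nabla_basis ad _ J lw Wy).
rewrite (tactE ad (u y) Wy (smooth_near_on oW Wy (lw.2 J))).
under [RHS]eq_bigr do rewrite mulrBr mulr_sumr.
rewrite sumrB; congr (_ - _).
rewrite [RHS]exchange_big/=; apply: eq_bigr => a _.
rewrite (multilinear_upd_expand _ _ _ Wy (nabla_alternating L e w (e (J a) y)).1).
apply: eq_bigr => l _; rewrite upd_etuple; congr (_ * _).
exact: (nabla_basis ad (e (J a) y) (fupd J a l) lw Wy).
Qed.

(** Coframe elements are parallel, so only derivatives of X contribute to [lie_formE]. They act on
    the columns of a determinant; moving them to the rows yields the differentials of X f_(K a). *)
Lemma lie_coframe (K : 'I_k -> 'I_m) X y : W y -> smooth_sec X ->
  lie_form L X (coframe K) y =
  fun v => \sum_a \sum_l act L (e l) (act L X (f (K a))) y *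
    coframe (upd K a l) y v.
Proof.
move=> Wy sX; apply/funext => v; have lw := is_form_local ad (coframe_is_form K).
rewrite (lie_formE ad _ lw Wy sX).
have -> : nabla L e (coframe K) (X y) v = 0.
  rewrite /nabla big1// => J _.
  have -> : tact L (X y) (wcoef e (coframe K) J) = 0; last by rewrite mulr0 mul0r.
  transitivity (tact L (X y) (fun=> kronecker [ffun a => K a] J)); last exact: tderive_cst.
  apply: near_eq_tderive; apply: filterS (near_W ad Wy) => z Wz.
  have EK : K = [ffun a => K a] :> ('I_k -> 'I_m) by apply/funext => a; rewrite ffunE.
  by rewrite -(wcoef_coframe _ J Wz) {1}EK.
rewrite add0r.
pose psi a : mform (fib A y) 1 := covec (fun u => tact L u (act L X (f (K a)))).
transitivity (\sum_a wedge1 (upd (fun b => dfun L (f (K b)) y) a (psi a)) v); last first.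
  apply: eq_bigr => a _.
  have -> : psi a = fun u => \sum_l act L (e l) (act L X (f (K a))) y * dfun L (f l) y u.
    apply/funext => u; rewrite /psi /covec.
    rewrite (tactE ad (u ord0) Wy (smooth_smooth_near y (smooth_act_f ad (K a) sX))).
    by apply: eq_bigr => l _; rewrite mulrC.
  rewrite wedge1_sum; apply: eq_bigr => l _; congr (_ * wedge1 _ v).
  by apply/funext => b; rewrite /upd; case: ifP.
under [RHS]eq_bigr do rewrite wedge1_upd_row.
pose U := \matrix_(a < k, b < k) dfun L (f (K a)) y (fun=> v b).
pose V := \matrix_(a < k, b < k) psi a (fun=> v b).
transitivity (\sum_b \det (\matrix_(a, c) (if c == b then V a c else U a c))).
  apply: eq_bigr => b _; rewrite /coframe /wedge_dfun /wedge1; congr (\det _).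
  apply/matrixP => a c; rewrite !mxE /upd; case: ifP => [/eqP->|//].
  exact: (tact_nabla_sec ad (v b) X (K a) Wy).
rewrite sum_det_replace_row_col; apply: eq_bigr => a _; congr (\det _).
apply/matrixP => b c; rewrite [LHS]mxE [RHS]mxE.
by case: ifP => ba; rewrite mxE ?(eqP ba).
Qed.

End LieCoframe.

Section Nambu.
Variable p : nat.
Variable Pi : msec A (p + 1).
Arguments Pi : clear implicits.
Hypothesis mPi : is_msec Pi.
Implicit Types (J : {ffun 'I_p -> 'I_m}) (alpha beta : form A p).

Definition Picoef J l : M -> R := xcoef Pi (snoc J l).

Lemma sharp_coef alpha y l : W y -> alternating (alpha y) ->
  tact L (sharp Pi alpha y) (f l) =
  p`!%:R^-1 * \sum_J wcoef e alpha J y * Picoef J l y.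
Proof.
move=> Wy aa; rewrite -(coord_etuple ad)//.
rewrite /sharp (coord_contract (etuple_basis ad Wy) l aa (mPi.1 y)); congr (_ * _).
apply: eq_bigr => J _; rewrite wdual_etuple// /wcoef /eval etupleE.
by [].
Qed.

Lemma sharp_coframe J y l : W y -> tact L (sharp Pi (coframe J) y) (f l) = Picoef J l y.
Proof.
move=> Wy; have [af _] := coframe_is_form J.
have := @vec_of_mvecE R (fib A y) (fun psi => Pi y (wedge (coframe J y) psi))
  (fun u => tact L u (f l))
  (contract_mvec_linear (etuple_basis ad Wy) (af y) (mPi.1 y))
  (tact_linear L (smooth_smooth_near y (sf l))).
move=> H; rewrite [LHS]H.
rewrite /Picoef /xcoef /pairing /coframe /wedge_dfun wedge_wedge1 -dfun_tact.
by rewrite (snoc_comp (fun k => dfun L (f k) y)).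
Qed.

Lemma Picoef_swap J a l y : W y -> Picoef (fupd J a l) (J a) y = - Picoef J l y.
Proof.
move=> Wy; rewrite /Picoef /xcoef /pairing -!wdual_etuple//.
pose K := snoc J l; pose t := tperm (lshift 1 a) (rshift p (ord0 : 'I_1)).
have E : snoc (fupd J a l) (J a) = (fun b => K (t b)).
  apply/funext => b; rewrite /t; case: tpermP => [->|->|].
  - by rewrite snoc_lshift ffunE eqxx /K snoc_rshift.
  - by rewrite snoc_rshift /K snoc_lshift.
  rewrite -[b]splitK; case: (fintype.split b) => c /= nb1 nb2.
    rewrite /K !snoc_lshift ffunE; case: eqP => [ca|//].
    by rewrite ca in nb1.
  by case: nb2; rewrite (ord1 c).
have n0 : lshift 1 a != rshift p (ord0 : 'I_1) by rewrite eq_lrshift.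
have -> : wdual (etuple e y) (snoc (fupd J a l) (J a)) = fun v => - wdual (etuple e y) K v.
  by rewrite E /wdual -(wedge1_swap _ n0).
have a0 : alternating (fun _ : 'I_(p + 1) -> fib A y => 0 : R).
  by split=> // v b c u u'; rewrite mulr0 addr0.
have Pi0 : Pi y (fun=> 0) = 0.
  have := (mPi.1 y) 1 _ _ a0 a0; rewrite (_ : (fun v => _) = fun=> 0); last first.
    by apply/funext => v; rewrite mulr0 addr0.
  by rewrite mul1r => /eqP; rewrite -subr_eq subrr eq_sym => /eqP.
have H := (mPi.1 y) (-1) _ _ (wdual_alternating (etuple e y) K) a0.
have EN : (fun v => -1 * wdual (etuple e y) K v + 0) = fun v => - wdual (etuple e y) K v.
  by apply/funext => v; rewrite mulN1r addr0.
by rewrite EN Pi0 addr0 mulN1r in H.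
Qed.

(** Ensures that [schouten] does not return its default: the expansion of Pi in the frame is a
    decomposition near y. *)
Lemma schouten_value_exists X y : W y -> exists eta, schouten_value L X Pi y eta.
Proof.
move=> Wy; pose T := {ffun 'I_(p + 1) -> 'I_m}.
pose c (r : 'I_#|T|) z := (p + 1)`!%:R^-1 * xcoef Pi (enum_val r) z.
pose Y (r : 'I_#|T|) (a : 'I_(p + 1)) := e ((enum_val r : T) a).
exists (fun w => \sum_(r < #|T|) (act L X (c r) y * w (fun a => Y r a y) +
  c r y * \sum_(a < p + 1) w (upd (fun b => Y r b y) a (bracket L X (Y r a) y)))).
exists #|T|, c, Y; split; last by [].
- by move=> r; apply: smooth_onZ; [exact: openT|exact: smooth_xcoef].
- by move=> r a; exact: se.
apply: filterS (near_W ad Wy) => z Wz w aw.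
rewrite (mvec_pairing (etuple_basis ad Wz) aw (mPi.1 z)) mulr_sumr.
rewrite (reindex (@enum_val _ T)) /=; last by apply: onW_bij; exact: enum_val_bij.
apply: eq_bigr => r _; rewrite /c -mulrA; congr (_ * _).
by rewrite mulrC wdual_etuple// etupleE.
Qed.

Lemma schouten_value_linear X y eta : schouten_value L X Pi y eta -> mvec_linear eta.
Proof.
move=> [N [c [Y [_ _ _ E]]]] a w w' aw aw'; rewrite !E mulr_sumr -big_split/=.
apply: eq_bigr => r _.
have -> : \sum_(b < p + 1)
    (a * w (upd (fun j => Y r j y) b (bracket L X (Y r b) y)) +
     w' (upd (fun j => Y r j y) b (bracket L X (Y r b) y))) =
   a * (\sum_(b < p + 1) w (upd (fun j => Y r j y) b (bracket L X (Y r b) y))) +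
   \sum_(b < p + 1) w' (upd (fun j => Y r j y) b (bracket L X (Y r b) y)).
  by rewrite mulr_sumr -big_split.
move: (w _) (w' _) (\sum_(b < p + 1) w _) (\sum_(b < p + 1) w' _) => *; ring.
Qed.

(** The Leibniz rule for a decomposition of Pi. The right side does not mention the decomposition,
    so the value of the Schouten bracket on a form is well defined. *)
Lemma schouten_pairing X y eta (w : form A (p + 1)) : W y -> smooth_sec X -> is_form w ->
  schouten_value L X Pi y eta ->
  eta (w y) = act L X (pairing w Pi) y - Pi y (lie_form L X w y).
Proof.
move=> Wy sX fw [N [c [Y [sc sY nE E]]]]; have lw := is_form_local ad fw.
have E1 : act L X (pairing w Pi) y = \sum_(r < N) tact L (X y) (fun z => c r z * eval w (Y r) z).
  rewrite act_tact.
  transitivity (tact L (X y) (fun z => \sum_(r < N) c r z * eval w (Y r) z)).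
    apply: near_eq_tderive; apply: filterS nE => z H.
    by apply: H; case: fw.
  apply: tderive_sum => r _; apply: smooth_nearM; apply: smooth_smooth_near => //.
  by apply: smooth_eval.
have E2 : Pi y (lie_form L X w y) = \sum_(r < N) c r y * lie_form L X w y (fun a => Y r a y).
  by apply: (nbhs_singleton nE); exact: (lie_form_alternating ad lw Wy sX).
rewrite E E1 E2 -sumrB; apply: eq_bigr => r _.
have s1 := smooth_smooth_near y (sc r).
have s2 := smooth_smooth_near y (smooth_eval fw (sY r)).
rewrite (tactM L (X y) s1 s2).
have -> : act L X (c r) y = tact L (X y) (c r) by rewrite act_tact.
rewrite (act_eval ad (X y) lw Wy (sY r)) (lie_formE ad _ lw Wy sX).
have -> : \sum_(a < p + 1) w y (upd (fun j => Y r j y) a (bracket L X (Y r a) y)) =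
    \sum_(a < p + 1) w y (upd (fun j => Y r j y) a (nabla_sec L f e (X y) (Y r a))) -
    \sum_(a < p + 1) w y (upd (fun j => Y r j y) a (nabla_sec L f e (Y r a y) X)).
  rewrite -sumrB; apply: eq_bigr => a _.
  rewrite (bracket_nabla ad Wy sX (sY r a)) (multilinearD _ _ _ _ (lw.1 _ Wy).1).
  rewrite -[- nabla_sec _ _ _ _ _]scaleN1r.
  by rewrite [X in _ + X](multilinearZ _ _ _ _ (lw.1 _ Wy).1) mulN1r.
have alg (t c0 wv s s' n : R) :
    t * wv + c0 * (s - s') = c0 * (n + s) + wv * t - c0 * (n + s') by ring.
exact: alg.
Qed.

Lemma mvec_coframe_row (K : 'I_(p + 1) -> 'I_m) y (c : 'I_(p + 1) -> 'I_m -> R) : W y ->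
  Pi y (fun v => \sum_a \sum_l c a l * coframe (upd K a l) y v) =
  \sum_a \sum_l c a l * xcoef Pi (upd K a l) y.
Proof.
move=> Wy.
have aC K' : alternating (coframe K' y) by case: (coframe_is_form K').
rewrite pair_big/=.
have H := @mvec_linear_sum R (fib A y) (p + 1) (Pi y) _
  (index_enum ('I_(p + 1) * 'I_m)%type) xpredT (fun q => c q.1 q.2)
  (fun q => coframe (upd K q.1 q.2) y) (mPi.1 y) (fun q _ => aC _ _).
rewrite -[RHS]H; congr (Pi y); apply/funext => v.
exact: pair_big.
Qed.

Definition Pi_lie (Xc : 'I_m -> M -> R) J l y : R :=
  \sum_k Xc k y * act L (e k) (Picoef J l) y -
  \sum_k Picoef J k y * act L (e k) (Xc l) y -
  \sum_a \sum_k Picoef (fupd J a k) l y * act L (e k) (Xc (J a)) y.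

Hypothesis nPi : nambu L Pi.

Definition sharpc alpha l : M -> R := act L (sharp Pi alpha) (f l).

Lemma smooth_sharpc alpha l : is_form alpha -> smooth (sharpc alpha l).
Proof. by move=> fa; apply: smooth_act => //; exact: smooth_sharp. Qed.

Lemma sharpcE alpha l y : W y -> alternating (alpha y) ->
  sharpc alpha l y = p`!%:R^-1 * \sum_J wcoef e alpha J y * Picoef J l y.
Proof. by move=> Wy aa; rewrite /sharpc act_tact; exact: sharp_coef. Qed.

Definition dformc alpha k J y : R := act L (e k) (wcoef e alpha J) y -
  \sum_a act L (e (J a)) (wcoef e alpha (fupd J a k)) y.

Lemma interior_alternating k (w : form A k.+1) X y : alternating (w y) ->
  alternating (interior X w y).
Proof.
move=> aw; rewrite /interior.
have E (v : 'I_k -> fib A y) a t : (fun b => oapp (upd v a t) (X y) (unlift ord0 b)) =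
    upd (fun b => oapp v (X y) (unlift ord0 b)) (lift ord0 a) t.
  apply/funext => b; rewrite /upd; case: unliftP => [c ->|->] /=.
    by rewrite (inj_eq lift_inj).
  by [].
split=> [v a c u u'|v a b ab vab].
  by rewrite !E aw.1.
apply: (aw.2 _ (lift ord0 a) (lift ord0 b)); first by rewrite (inj_eq lift_inj).
by rewrite !liftK.
Qed.

Lemma interior_dform_sharp alpha beta J y : is_form alpha -> W y ->
  interior (sharp Pi beta) (dform L alpha) y (fun a => e (J a) y) =
  \sum_l sharpc beta l y * dformc alpha l J y.
Proof.
move=> fa Wy; rewrite (interior_dform_coef (sharp Pi beta) J fa Wy).
by apply: eq_bigr => l _; rewrite /sharpc act_tact.
Qed.

(** The Nambu identity with beta = [coframe J], tested on f_l. Its left side is the Schouten bracket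
    paired with the coframe element of (J, l), which [schouten_pairing] and [lie_coframe]
    compute. *)
Lemma nambu_coef alpha J l y : W y -> is_form alpha ->
  Pi_lie (sharpc alpha) J l y =
  - (p`!%:R^-1 * \sum_J' (\sum_k Picoef J k y * dformc alpha k J' y) * Picoef J' l y).
Proof.
move=> Wy fa; pose X := sharp Pi alpha; have sX : smooth_sec X by exact: smooth_sharp.
have fb := coframe_is_form J.
have := nPi.2 alpha (coframe J) fa fb y => N.
have {N} : tact L (vec_of_mvec (contract (coframe J) (schouten L X Pi) y)) (f l) =
   tact L (- sharp Pi (interior (sharp Pi (coframe J)) (dform L alpha)) y) (f l).
  by rewrite -N.
have -> : - sharp Pi (interior (sharp Pi (coframe J)) (dform L alpha)) y =
   0 - sharp Pi (interior (sharp Pi (coframe J)) (dform L alpha)) y by rewrite sub0r.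
have sfl := smooth_smooth_near y (sf l).
rewrite (tactB L _ _ sfl) tact0.
have ai : alternating (interior (sharp Pi (coframe J)) (dform L alpha) y).
  by apply: interior_alternating; exact: (dform_alternating ad fa Wy).
rewrite (sharp_coef l Wy ai) sub0r.
set eta := schouten L X Pi y.
have Veta : schouten_value L X Pi y eta.
  rewrite /eta /schouten; case: xgetP => [z _ //|H].
  by have [z zP] := schouten_value_exists X Wy; exact: (H z zP).
have -> : tact L (vec_of_mvec (contract (coframe J) (schouten L X Pi) y)) (f l) =
    eta (coframe (snoc J l) y).
  have := @vec_of_mvecE R (fib A y) (fun psi => eta (wedge (coframe J y) psi))
    (fun u => tact L u (f l))
    (contract_mvec_linear (etuple_basis ad Wy) (fb.1 y) (schouten_value_linear Veta))
    (tact_linear L sfl).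
  move=> H; rewrite [LHS]H /coframe /wedge_dfun wedge_wedge1 -dfun_tact.
  by rewrite (snoc_comp (fun k => dfun L (f k) y)).
rewrite (schouten_pairing Wy sX (coframe_is_form _) Veta).
rewrite (lie_coframe (snoc J l) Wy sX) mvec_coframe_row// => E.
have -> : Pi_lie (sharpc alpha) J l y = act L X (pairing (coframe (snoc J l)) Pi) y -
  \sum_a \sum_k act L (e k) (act L X (f (snoc J l a))) y * xcoef Pi (upd (snoc J l) a k) y.
  rewrite big_split_ord/= big_ord1 opprD addrA addrAC /Pi_lie; congr (_ - _ - _).
  - rewrite [RHS]act_tact (tactE ad (X y) Wy (smooth_smooth_near y (smooth_xcoef mPi (snoc J l)))).
    by apply: eq_bigr => k _; rewrite /sharpc act_tact.
  - by apply: eq_bigr => k _; rewrite snoc_rshift snoc_upd_r mulrC.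
  - apply: eq_bigr => a _; apply: eq_bigr => k _.
    have E1 : snoc J l (lshift 1 a) = J a by rewrite snoc_lshift.
    have E2 : upd (snoc J l) (lshift 1 a) k = snoc (fupd J a k) l.
      by rewrite snoc_upd_l; congr snoc; apply/funext => b; rewrite /upd ffunE.
    by rewrite E1 E2 mulrC.
rewrite E; congr (- (_ * _)); apply: eq_bigr => J' _; congr (_ * _).
rewrite /wcoef /eval (interior_dform_sharp _ _ fa Wy).
apply: eq_bigr => k _; congr (_ * _).
by rewrite /sharpc act_tact; exact: sharp_coframe.
Qed.

Lemma lbracket_coef alpha beta J y : W y -> is_form alpha -> is_form beta ->
  lbracket L Pi alpha beta y (fun a => e (J a) y) =
  \sum_k sharpc alpha k y * act L (e k) (wcoef e beta J) y +
  \sum_a \sum_k act L (e (J a)) (sharpc alpha k) y * wcoef e beta (fupd J a k) y -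
  \sum_k sharpc beta k y * dformc alpha k J y.
Proof.
move=> Wy fa fb; rewrite /lbracket (interior_dform_sharp _ _ fa Wy); congr (_ - _).
have sX : smooth_sec (sharp Pi alpha) by exact: smooth_sharp.
have lb := is_form_local ad fb.
rewrite (lie_coef J lb Wy sX); congr (_ + _).
rewrite act_tact (tactE ad _ Wy (smooth_near_on oW Wy (lb.2 J))).
by apply: eq_bigr => k _; rewrite /sharpc act_tact.
Qed.

Lemma lbracket_alternating alpha beta y : W y -> is_form alpha -> is_form beta ->
  alternating (lbracket L Pi alpha beta y).
Proof.
move=> Wy fa fb.
have -> : lbracket L Pi alpha beta y = fun v =>
    -1 * interior (sharp Pi beta) (dform L alpha) y v + lie_form L (sharp Pi alpha) beta y v.
  by apply/funext => v; rewrite /lbracket mulN1r addrC.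
apply: alternating_comb.
  by apply: interior_alternating; exact: (dform_alternating ad fa Wy).
apply: (lie_form_alternating ad (is_form_local ad fb) Wy).
exact: smooth_sharp.
Qed.

Section Density.
Variable mu : tform A m.
Arguments mu : clear implicits.
Hypothesis pmu : positive_density mu.

Definition density_coef : M -> R := wcoef e (mu i) [ffun a => a].

Lemma density_local_form : local_form W e (mu i).
Proof.
have [[amu smu _] _] := pmu.
split=> [y /Wi|J]; first exact: amu.
apply: (smooth_on_sub Wi); apply: smooth_on_eval => // y; exact: amu.
Qed.

Lemma density_coefE y : density_coef y = mu i y (fun a => tnth (etuple e y) a).
Proof.
by rewrite /density_coef /wcoef /eval; congr (mu i y); apply/funext => a; rewrite ffunE tnth_etuple.
Qed.

(** Positivity refers to the given frame, and e may have the opposite orientation; the sign of this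
    coefficient is therefore open, and logarithmic derivatives are formed as quotients. *)
Lemma density_coef_neq0 y : W y -> density_coef y != 0.
Proof.
move=> Wy; apply/eqP; rewrite density_coefE => H.
have := pmu.2 i y (Wi Wy).
by rewrite (top_form_eq0 (etuple_basis ad Wy) (density_local_form.1 _ Wy) H) ltxx.
Qed.

Lemma modular_coefE (Mt : msec A p) J y : W y -> is_modular_msec L Pi mu Mt ->
  xcoef Mt J y * density_coef y =
  \sum_k (act L (e k) (Picoef J k) y * density_coef y +
          Picoef J k y * act L (e k) density_coef y).
Proof.
move=> Wy [_ H]; pose id0 : {ffun 'I_m -> 'I_m} := [ffun a => a].
have := H (fun a => f (J a)) (fun a => sf (J a)) i y (Wi Wy) (fun a => e (id0 a) y).
have sX : smooth_sec (sharp Pi (coframe J)).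
  by apply: smooth_sharp => //; exact: coframe_is_form.
have lm := density_local_form.
rewrite /lie_tform -/(coframe J) (lie_coef id0 lm Wy sX).
rewrite -/(eval (mu i) (fun a => e (id0 a)) y) -/(wcoef e (mu i) id0 y) -/density_coef => <-.
rewrite big_split/= [LHS]addrC; congr (_ + _).
  apply: eq_bigr => a _; rewrite ffunE (bigD1 a)//= [X in _ + X]big1 ?addr0.
    rewrite (_ : fupd id0 a a = id0); last first.
      by apply/ffunP => b; rewrite !ffunE; case: eqP => // ->.
    congr (_ * _); apply: near_eq_tderive; apply: filterS (near_W ad Wy) => z Wz.
    by rewrite act_tact sharp_coframe.
  move=> l la; have -> : wcoef e (mu i) (fupd id0 a l) y = 0; last by rewrite mulr0.
  apply: ((lm.1 _ Wy).2 _ a l); first by rewrite eq_sym.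
  by rewrite !ffunE eqxx (negbTE la).
rewrite act_tact (tactE ad _ Wy (smooth_near_on oW Wy (lm.2 id0))).
by apply: eq_bigr => k _; rewrite sharp_coframe.
Qed.

End Density.

End Nambu.

End AdaptedCoordinates.

(** * The ring of smooth functions on an open set *)

(* Functions smooth on [W], made extensional by the value [0] off [W]; the unit
   of this ring is the indicator of [W]. *)
Record localfun (R : realType) (d : nat) (M : manifold R d) (W : set M) (oW : open W) :=
  LocalFun {
  localfun_val :> M -> R;
  localfun_smooth : smooth_on W localfun_val;
  localfun_out : forall x, ~ W x -> localfun_val x = 0
}.

Section LocalFunRing.
Context {R : realType} {d : nat} {M : manifold R d}.
Variables (W : set M) (oW : open W).
Implicit Types (a b c : localfun oW) (g h : M -> R) (x : M).

Lemma localfun_eq a b : (forall x, W x -> a x = b x) -> a = b.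
Proof.
move: a b => [g sg g0] [h sh h0] /= gh.
have {}gh : g = h.
  by apply/funext => x; have [/gh//|nWx] := pselect (W x); rewrite g0// h0.
rewrite -{}gh in sh h0 *.
by rewrite (Prop_irrelevance sg sh) (Prop_irrelevance g0 h0).
Qed.

Definition cutoff (g : M -> R) x : R := if pselect (W x) then g x else 0.

Lemma cutoff_in g x : W x -> cutoff g x = g x.
Proof. by rewrite /cutoff; case: pselect. Qed.

Lemma cutoff_out g x : ~ W x -> cutoff g x = 0.
Proof. by rewrite /cutoff; case: pselect. Qed.

Lemma cutoff_smooth g : smooth_on W g -> smooth_on W (cutoff g).
Proof. by apply: smooth_on_ext => // x Wx; rewrite cutoff_in. Qed.

(** Total, with value 0 on functions that are not smooth, so that ring operations need no proofs as
    arguments. *)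
Definition localize g : localfun oW :=
  if pselect (smooth_on W g) is left sg then LocalFun oW (cutoff_smooth sg) (@cutoff_out g)
  else LocalFun oW (cutoff_smooth (smooth_on_cst W 0)) (@cutoff_out _).

Lemma localizeE g x : smooth_on W g -> W x -> localize g x = g x.
Proof. by rewrite /localize; case: pselect => //= sg _ Wx; rewrite cutoff_in. Qed.

Lemma localize_cstE (t : R) x : W x -> localize (fun=> t) x = t.
Proof. by move=> Wx; rewrite localizeE//; exact: smooth_on_cst. Qed.

Definition localfun_add a b := localize (fun x => a x + b x).
Definition localfun_opp a := localize (fun x => - a x).
Definition localfun_mul a b := localize (fun x => a x * b x).

Lemma localfun_addE a b x : W x -> localfun_add a b x = a x + b x.
Proof.
by move=> Wx; rewrite localizeE//; apply: smooth_onD => //; exact: localfun_smooth.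
Qed.

Lemma localfun_oppE a x : W x -> localfun_opp a x = - a x.
Proof.
by move=> Wx; rewrite localizeE//; apply: smooth_onN => //; exact: localfun_smooth.
Qed.

Lemma localfun_mulE a b x : W x -> localfun_mul a b x = a x * b x.
Proof.
by move=> Wx; rewrite localizeE//; apply: smooth_onM => //; exact: localfun_smooth.
Qed.

Fact localfun_addA : associative localfun_add.
Proof.
by move=> a b c; apply: localfun_eq => x Wx; rewrite !localfun_addE// addrA.
Qed.

Fact localfun_addC : commutative localfun_add.
Proof. by move=> a b; apply: localfun_eq => x Wx; rewrite !localfun_addE// addrC. Qed.

Fact localfun_add0 : left_id (localize (fun=> 0)) localfun_add.
Proof.
by move=> a; apply: localfun_eq => x Wx; rewrite localfun_addE// localize_cstE// add0r.
Qed.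

Fact localfun_addN : left_inverse (localize (fun=> 0)) localfun_opp localfun_add.
Proof.
move=> a; apply: localfun_eq => x Wx.
by rewrite localfun_addE// localfun_oppE// localize_cstE// addNr.
Qed.

Fact localfun_mulA : associative localfun_mul.
Proof.
by move=> a b c; apply: localfun_eq => x Wx; rewrite !localfun_mulE// mulrA.
Qed.

Fact localfun_mulC : commutative localfun_mul.
Proof. by move=> a b; apply: localfun_eq => x Wx; rewrite !localfun_mulE// mulrC. Qed.

Fact localfun_mul1 : left_id (localize (fun=> 1)) localfun_mul.
Proof.
by move=> a; apply: localfun_eq => x Wx; rewrite localfun_mulE// localize_cstE// mul1r.
Qed.

Fact localfun_mulDl : left_distributive localfun_mul localfun_add.
Proof.
move=> a b c; apply: localfun_eq => x Wx.
by rewrite !localfun_mulE// !localfun_addE// !localfun_mulE// mulrDl.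
Qed.

HB.instance Definition _ := gen_eqMixin (localfun oW).
HB.instance Definition _ := gen_choiceMixin (localfun oW).
HB.instance Definition _ := GRing.isZmodule.Build (localfun oW)
  localfun_addA localfun_addC localfun_add0 localfun_addN.
HB.instance Definition _ := GRing.Zmodule_isComPzRing.Build (localfun oW)
  localfun_mulA localfun_mulC localfun_mul1 localfun_mulDl.

Lemma localfunD a b x : W x -> (a + b : localfun oW) x = a x + b x.
Proof. exact: localfun_addE. Qed.

Lemma localfunN a x : W x -> (- a : localfun oW) x = - a x.
Proof. exact: localfun_oppE. Qed.

Lemma localfunB a b x : W x -> (a - b : localfun oW) x = a x - b x.
Proof. by move=> Wx; rewrite localfunD// localfunN. Qed.

Lemma localfunM a b x : W x -> (a * b : localfun oW) x = a x * b x.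
Proof. exact: localfun_mulE. Qed.

Lemma localfun0 x : W x -> (0 : localfun oW) x = 0.
Proof. exact: localize_cstE. Qed.

Lemma localfun1 x : W x -> (1 : localfun oW) x = 1.
Proof. exact: localize_cstE. Qed.

Lemma localfun_nat (t : bool) x : W x -> (t%:R : localfun oW) x = t%:R.
Proof. by case: t; [exact: localfun1|exact: localfun0]. Qed.

Lemma localfun_sum (I : finType) (F : I -> localfun oW) x : W x ->
  (\sum_j F j) x = \sum_j F j x.
Proof.
move=> Wx; elim: (index_enum I) => [|j r IH]; first by rewrite !big_nil localfun0.
by rewrite !big_cons localfunD// IH.
Qed.

Lemma localfun_oppr_eq_id a : a = - a -> a = 0.
Proof.
move=> E; apply: localfun_eq => x Wx; rewrite localfun0//.
have : a x = - a x by rewrite {1}E localfunN.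
by move=> /eqP; rewrite -addr_eq0 -mulr2n mulrn_eq0/= => /eqP.
Qed.

End LocalFunRing.

Section LocalDerivations.
Context {R : realType} {d : nat} {M : manifold R d} {m : nat}.
Context {A : vbundle M m} (L : lie_algebroid A).
Variables (W : set M) (f : 'I_m -> M -> R) (e : 'I_m -> section A) (i : triv_idx A).
Hypothesis ad : adapted L W f e i.
Variable oW : open W.
Implicit Types (g : M -> R) (x y : M) (a b : localfun oW).

Let se k : smooth_sec (e k). Proof. by case: ad. Qed.

Lemma localfun_near a x : W x -> smooth_near x a.
Proof. by move=> Wx; apply: (smooth_near_on oW Wx); exact: localfun_smooth. Qed.

Definition localder k a : localfun oW := localize oW (act L (e k) a).

Lemma localder_actE k a x : W x -> localder k a x = act L (e k) a x.
Proof.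
by move=> Wx; rewrite localizeE//; apply: smooth_on_act => //; exact: localfun_smooth.
Qed.

Lemma localderE k g x : smooth_on W g -> W x ->
  localder k (localize oW g) x = act L (e k) g x.
Proof.
move=> sg Wx; rewrite localder_actE//; apply: near_eq_act.
by apply: filterS (near_W ad Wx) => y Wy; rewrite localizeE.
Qed.

Lemma localder_cst k (t : R) : localder k (localize oW (fun=> t)) = 0.
Proof.
apply: localfun_eq => x Wx; rewrite (localderE k (smooth_on_cst W t) Wx) localfun0//.
by rewrite act_tact; exact: tderive_cst.
Qed.

Fact localder_is_additive k : zmod_morphism (localder k).
Proof.
move=> a b; apply: localfun_eq => x Wx.
rewrite localfunB// !localder_actE//.
have -> : act L (e k) (a - b) x = tact L (e k x) (fun y => a y + -1 * b y).
  rewrite act_tact; apply: near_eq_tderive; apply: filterS (near_W ad Wx) => y Wy.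
  by rewrite localfunB// mulN1r.
have sa := localfun_near a Wx; have sb := localfun_near b Wx.
have -> : tact L (e k x) (fun y => a y + -1 * b y) =
    tact L (e k x) a + tact L (e k x) (fun y => -1 * b y).
  by apply: tderiveD => //; apply: smooth_nearM => //; exact: smooth_near_cst.
by rewrite (tact_scale L _ _ sb) mulN1r !act_tact.
Qed.

Definition localderivation k : {additive localfun oW -> localfun oW} :=
  HB.pack (localder k) (GRing.isZmodMorphism.Build _ _ (localder k) (localder_is_additive k)).

Lemma localderM k a b : localder k (a * b) = localder k a * b + a * localder k b.
Proof.
apply: localfun_eq => x Wx.
rewrite localfunD// !localfunM// !localder_actE//.
have -> : act L (e k) (a * b) x = tact L (e k x) (fun y => a y * b y).
  rewrite act_tact; apply: near_eq_tderive; apply: filterS (near_W ad Wx) => y Wy.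
  by rewrite localfunM.
rewrite (tactM L _ (localfun_near a Wx) (localfun_near b Wx)) !act_tact addrC.
by rewrite [X in X + _]mulrC.
Qed.

(** The bracket of e_k and e_l kills every f_j, as e_k and e_l send it to constants; hence it
    vanishes on W. *)
Lemma localderC k l a : localder k (localder l a) = localder l (localder k a).
Proof.
apply: localfun_eq => x Wx.
have D2 k' l' : localder k' (localder l' a) x = act L (e k') (act L (e l') a) x.
  by apply: localderE => //; apply: smooth_on_act => //; exact: localfun_smooth.
have [_ _ sf _ ef] := ad.
have B0 : bracket L (e k) (e l) x = 0.
  apply: (etuple_inj ad Wx) => j.
  have Z u v : act L (e u) (act L (e v) (f j)) x = 0.
    transitivity (tact L (e u x) (fun=> (v == j)%:R)); last exact: tderive_cst.
    rewrite act_tact; apply: near_eq_tderive; apply: filterS (near_W ad Wx) => y Wy.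
    exact: ef.
  have := act_bracket L (se k) (se l) (smooth_smooth_near x (sf j)).
  rewrite !Z subrr act_tact => ->.
  by rewrite tact0.
have E : act L (e k) (act L (e l) a) x - act L (e l) (act L (e k) a) x = 0.
  transitivity (tact L (bracket L (e k) (e l) x) a).
    by rewrite -act_tact -(act_bracket L (se k) (se l) (localfun_near a Wx)).
  by rewrite B0; exact: tact0.
transitivity (act L (e k) (act L (e l) a) x); first exact: D2.
transitivity (act L (e l) (act L (e k) a) x); last by rewrite -(D2 l k).
by apply/eqP; rewrite -subr_eq0; apply/eqP.
Qed.

End LocalDerivations.

#[local] Opaque localfun_add localfun_opp localfun_mul localize.

(** The symmetry of second derivatives of log r, without a logarithm: s is the inverse of r, and D s
    = - s s D r. *)
Lemma logarithmic_derivative_sym (F : comPzRingType) (D1 D2 : F -> F) (r s : F) :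
  (forall x y, D1 (x * y) = D1 x * y + x * D1 y) ->
  (forall x y, D2 (x * y) = D2 x * y + x * D2 y) ->
  D1 (D2 r) = D2 (D1 r) -> s * r = 1 -> D1 (s * D2 r) = D2 (s * D1 r).
Proof.
move=> D1M D2M DC sr.
have DV (D : F -> F) : (forall x y, D (x * y) = D x * y + x * D y) -> D s = - (s * s * D r).
  move=> DM; have D1' : D 1 = 0.
    by apply: (@addrI _ (D 1)); rewrite addr0; have := DM 1 1; rewrite !mulr1 mul1r.
  have := DM s r; rewrite sr D1' => E.
  have -> : D s = (D s * r + s * D r) * s - s * s * D r.
    by rewrite mulrDl -[_ * r * s]mulrA [r * s]mulrC sr mulr1; ring.
  by rewrite -E mul0r sub0r.
by rewrite D1M D2M (DV D1)// (DV D2)// DC; ring.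
Qed.

(** * The cocycle identity over the domain of an adapted frame *)

Section ModularCocycle.
Context {R : realType} {d : nat} {M : manifold R d} {m : nat}.
Context {A : vbundle M m} (L : lie_algebroid A).
Variables (W : set M) (f : 'I_m -> M -> R) (e : 'I_m -> section A) (i : triv_idx A).
Hypothesis ad : adapted L W f e i.
Variable p : nat.
Variable Pi : msec A (p + 1).
Arguments Pi : clear implicits.
Hypothesis mPi : is_msec Pi.
Hypothesis nPi : nambu L Pi.
Variable mu : tform A m.
Arguments mu : clear implicits.
Hypothesis pmu : positive_density mu.
Variable Mt : msec A p.
Arguments Mt : clear implicits.
Hypothesis mMt : is_modular_msec L Pi mu Mt.
Implicit Types (g : M -> R) (x y : M) (k l : 'I_m) (J : {ffun 'I_p -> 'I_m})
  (alpha beta : form A p).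

Let oW : open W. Proof. by case: ad. Qed.
Let sf k : smooth (f k). Proof. by case: ad. Qed.
Let ef x : W x -> forall k l, act L (e k) (f l) x = (k == l)%:R.
Proof. by case: ad => _ _ _ _ H Wx; exact: H. Qed.

Let F : comPzRingType := localfun oW.
Let D k : {additive F -> F} := localderivation ad oW k.
Let c : F := localize oW (fun=> p`!%:R^-1).
Let PiF J l : F := localize oW (Picoef L f Pi J l).
Let rho := density_coef e i mu.
Let sigma k : F := localize oW (fun x => (rho x)^-1) * D k (localize oW rho).
Let fF k : F := localize oW (f k).
Let delta (I J : {ffun 'I_p -> 'I_m}) : F := localize oW (fun=> kronecker I J).
Let coefF alpha J : F := localize oW (wcoef e alpha J).

Let sPi J l : smooth_on W (Picoef L f Pi J l).
Proof. exact: smooth_smooth_on (smooth_xcoef ad mPi _). Qed.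

Let srho : smooth_on W rho.
Proof. exact: (density_local_form ad pmu).2. Qed.

Let coef_smooth alpha J : is_form alpha -> smooth_on W (wcoef e alpha J).
Proof. by move=> fa; exact: (is_form_local ad fa).2. Qed.

Let DE k g x : smooth_on W g -> W x -> D k (localize oW g) x = act L (e k) g x.
Proof. by move=> sg Wx; exact: (localderE ad oW k sg Wx). Qed.

Let PiFE J l x : W x -> PiF J l x = Picoef L f Pi J l x.
Proof. by move=> Wx; exact: (localizeE oW (sPi J l) Wx). Qed.

Let coefFE alpha J x : is_form alpha -> W x -> coefF alpha J x = wcoef e alpha J x.
Proof. by move=> fa Wx; rewrite /coefF localizeE//; exact: coef_smooth. Qed.

Let cE x : W x -> c x = p`!%:R^-1.
Proof. by move=> Wx; rewrite /c localize_cstE. Qed.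

Let ssharpc alpha l : is_form alpha -> smooth_on W (sharpc L f Pi alpha l).
Proof. by move=> fa; exact: smooth_smooth_on (smooth_sharpc ad mPi l fa). Qed.

Let ham_sharp alpha l : is_form alpha ->
  ham c PiF (coefF alpha) l = localize oW (sharpc L f Pi alpha l).
Proof.
move=> fa; apply: localfun_eq => x Wx.
rewrite [RHS](localizeE oW (ssharpc l fa) Wx).
rewrite (sharpcE ad mPi l Wx (fa.1 x)) /ham (localfunM _ _ Wx) cE// (localfun_sum _ Wx).
by congr (_ * _); apply: eq_bigr => J _; rewrite (localfunM _ _ Wx) PiFE// coefFE.
Qed.

Let dcoef_dform alpha k J x : is_form alpha -> W x ->
  dcoef D (coefF alpha) k J x = dformc L e alpha k J x.
Proof.
move=> fa Wx; rewrite /dcoef /dformc (localfunB _ _ Wx) (localfun_sum _ Wx).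
have H k' J' : D k' (coefF alpha J') x = act L (e k') (wcoef e alpha J') x.
  by apply: DE => //; exact: coef_smooth.
by rewrite H; congr (_ - _); apply: eq_bigr => a _; exact: H.
Qed.

Let lie_PiE (Xc : 'I_m -> M -> R) J l x : (forall k, smooth (Xc k)) -> W x ->
  lie_Pi D PiF (fun k => localize oW (Xc k)) J l x = Pi_lie L f e Pi Xc J l x.
Proof.
move=> sX Wx.
have sXW k : smooth_on W (Xc k) by exact: smooth_smooth_on.
have DX k k' : D k (localize oW (Xc k')) x = act L (e k) (Xc k') x by exact: DE.
have E Y : (\sum_k PiF Y k * D k (localize oW (Xc l))) x =
    \sum_k Picoef L f Pi Y k x * act L (e k) (Xc l) x.
  rewrite (localfun_sum _ Wx); apply: eq_bigr => k _.
  by rewrite (localfunM _ _ Wx) (PiFE _ _ Wx) DX.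
have B3 (a b u : F) : (a - b - u) x = a x - b x - u x.
  by rewrite (localfunB _ _ Wx) (localfunB _ _ Wx).
rewrite /lie_Pi /Pi_lie B3.
congr (_ - _ - _); [|exact: E|].
  rewrite /vact (localfun_sum _ Wx); apply: eq_bigr => k _.
  rewrite (localfunM _ _ Wx); congr (_ * _); first exact: (localizeE oW (sXW k) Wx).
  exact: (DE k (sPi J l) Wx).
rewrite (localfun_sum _ Wx); apply: eq_bigr => a _.
rewrite (localfun_sum _ Wx); apply: eq_bigr => k _.
by rewrite (localfunM _ _ Wx) (PiFE _ _ Wx) DX.
Qed.

Let nambu_form alpha : is_form alpha -> nambu_at D c PiF (coefF alpha).
Proof.
move=> fa J l; apply: localfun_eq => x Wx.
have -> : ham c PiF (coefF alpha) = fun k => localize oW (sharpc L f Pi alpha k).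
  by apply/funext => k; exact: ham_sharp.
rewrite lie_PiE//; last by move=> k; exact: (smooth_sharpc ad mPi k fa).
rewrite (nambu_coef ad mPi nPi J l Wx fa) (localfunN _ Wx) (localfunM _ _ Wx) cE//.
rewrite (localfun_sum _ Wx); congr (- (_ * _)); apply: eq_bigr => J' _.
rewrite (localfunM _ _ Wx) PiFE// (localfun_sum _ Wx).
congr (_ * _); apply: eq_bigr => k _.
by rewrite (localfunM _ _ Wx) PiFE// dcoef_dform.
Qed.

Let delta_coframe I : delta I = coefF (coframe L f I).
Proof.
apply/funext => J; apply: localfun_eq => x Wx.
rewrite coefFE//; last exact: (coframe_is_form ad).
by rewrite (wcoef_coframe ad I J Wx) /delta localize_cstE.
Qed.

Let expandable_form alpha : is_form alpha -> expandable c delta (coefF alpha).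
Proof.
move=> fa J; apply: localfun_eq => x Wx.
rewrite coefFE// (wcoef_expand ad J Wx (fa.1 x)) (localfunM _ _ Wx) cE// (localfun_sum _ Wx).
congr (_ * _); apply: eq_bigr => I _.
by rewrite (localfunM _ _ Wx) coefFE// /delta localize_cstE.
Qed.

Let sigmaC k l : D k (sigma l) = D l (sigma k).
Proof.
have DM' k' (u v : F) : D k' (u * v) = D k' u * v + u * D k' v by exact: (localderM ad).
have DC' (u : F) : D k (D l u) = D l (D k u) by exact: (localderC ad).
pose s : F := localize oW (fun x => (rho x)^-1); pose r : F := localize oW rho.
have sV : smooth_on W (fun x => (rho x)^-1).
  by apply: smooth_onV => // x Wx; exact: (density_coef_neq0 ad pmu Wx).
apply: (logarithmic_derivative_sym (D1 := D k) (D2 := D l) (r := r) (s := s)) => //.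
apply: localfun_eq => x Wx; rewrite (localfunM _ _ Wx) (localfun1 oW Wx).
rewrite (localizeE oW sV Wx) (localizeE oW srho Wx) mulVf//.
exact: (density_coef_neq0 ad pmu Wx).
Qed.

Let modular_coefF J x : W x -> modular_coef D PiF sigma J x = xcoef L f Mt J x.
Proof.
move=> Wx; have r0 := density_coef_neq0 ad pmu Wx.
apply: (mulIf r0); rewrite (modular_coefE ad mPi pmu J Wx mMt).
rewrite /modular_coef (localfun_sum _ Wx) mulr_suml; apply: eq_bigr => k _.
rewrite (localfunD _ _ Wx) (localfunM _ _ Wx) PiFE// /sigma (localfunM _ _ Wx).
have -> : D k (PiF J k) x = act L (e k) (Picoef L f Pi J k) x by exact: DE.
have -> : D k (localize oW rho) x = act L (e k) rho x by exact: DE.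
rewrite localizeE//; last by apply: smooth_onV => // y Wy; exact: (density_coef_neq0 ad pmu Wy).
rewrite mulrDl; congr (_ + _).
by rewrite -mulrA [_ * act _ _ _ _]mulrC -[_ * _ * density_coef _ _ _ _]mulrA mulVf// mulr1.
Qed.

Let modular_funF alpha x : W x -> is_form alpha ->
  modular_fun D c PiF sigma (coefF alpha) x = pairing alpha Mt x.
Proof.
move=> Wx fa; rewrite (pairing_coef ad mMt.1 Wx (fa.1 x)).
rewrite /modular_fun (localfunM _ _ Wx) cE// (localfun_sum _ Wx); congr (_ * _).
by apply: eq_bigr => J _; rewrite (localfunM _ _ Wx) modular_coefF// coefFE.
Qed.

Let br_lbracket alpha beta J x : W x -> is_form alpha -> is_form beta ->
  br D c PiF (coefF alpha) (coefF beta) J x =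
  wcoef e (lbracket L Pi alpha beta) J x.
Proof.
move=> Wx fa fb; rewrite [RHS](lbracket_coef ad mPi J Wx fa fb).
have hE k w : is_form w -> ham c PiF (coefF w) k x = sharpc L f Pi w k x.
  by move=> fw; rewrite ham_sharp// localizeE//; exact: ssharpc.
rewrite /br /vact (localfunB _ _ Wx) (localfunD _ _ Wx) !(localfun_sum _ Wx); congr (_ + _ - _).
- apply: eq_bigr => k _; rewrite (localfunM _ _ Wx) hE//; congr (_ * _).
  by apply: DE => //; exact: coef_smooth.
- apply: eq_bigr => a _; rewrite (localfun_sum _ Wx); apply: eq_bigr => k _.
  rewrite (localfunM _ _ Wx) coefFE// ham_sharp//; congr (_ * _).
  by apply: DE => //; exact: ssharpc.
- by apply: eq_bigr => k _; rewrite (localfunM _ _ Wx) hE// dcoef_dform.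
Qed.

Let vact_ham alpha beta x : W x -> is_form alpha -> is_form beta ->
  vact D (ham c PiF (coefF alpha)) (modular_fun D c PiF sigma (coefF beta)) x =
  act L (sharp Pi alpha) (pairing beta Mt) x.
Proof.
move=> Wx fa fb.
have sp := smooth_pairing fb mMt.1.
rewrite act_tact (tactE ad _ Wx (smooth_smooth_near x sp)) /vact (localfun_sum _ Wx).
apply: eq_bigr => k _; rewrite (localfunM _ _ Wx) ham_sharp//.
rewrite localizeE//; last exact: ssharpc.
rewrite /sharpc act_tact; congr (_ * _).
have -> : modular_fun D c PiF sigma (coefF beta) = localize oW (pairing beta Mt).
  apply: localfun_eq => y Wy; rewrite modular_funF// localizeE//.
  exact: smooth_smooth_on.
by apply: DE => //; exact: smooth_smooth_on.
Qed.

Lemma pairing_lbracket alpha beta x : W x -> is_form alpha -> is_form beta ->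
  pairing (lbracket L Pi alpha beta) Mt x =
  act L (sharp Pi alpha) (pairing beta Mt) x - act L (sharp Pi beta) (pairing alpha Mt) x.
Proof.
move=> Wx fa fb.
rewrite -vact_ham// -vact_ham// -(localfunB _ _ Wx).
rewrite (pairing_coef ad mMt.1 Wx (lbracket_alternating ad mPi Wx fa fb)).
transitivity (modular_fun D c PiF sigma (br D c PiF (coefF alpha) (coefF beta)) x).
  rewrite /modular_fun (localfunM _ _ Wx) cE// (localfun_sum _ Wx); congr (_ * _).
  by apply: eq_bigr => J _; rewrite (localfunM _ _ Wx) br_lbracket// modular_coefF.
have fc I : is_form (coframe L f I : form A p) by exact: (coframe_is_form ad).
(* The pointwise identity is the value at x of an identity in the ring of functions on W; the goals
   that follow are the hypotheses of the algebraic argument. *)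
congr (localfun_val _ x); apply: (@modular_fun_br F m p D _ _ _ c _ PiF _ sigma _ fF _ delta).
- by move=> k u v; exact: (localderM ad).
- by move=> k l u; exact: (localderC ad).
- exact: localfun_oppr_eq_id.
- by move=> k; exact: (localder_cst ad).
- move=> J a k; apply: localfun_eq => y Wy.
  rewrite (localfunN _ Wy) [LHS](PiFE _ _ Wy) (Picoef_swap ad mPi J a k Wy).
  by congr (- _); exact/esym/PiFE.
- exact: sigmaC.
- move=> k l; apply: localfun_eq => y Wy; rewrite (localfun_nat _ _ Wy) -(ef Wy).
  by apply: DE => //; exact: smooth_smooth_on.
- by move=> k I J; exact: (localder_cst ad).
- move=> I l; rewrite delta_coframe ham_sharp//; apply: localfun_eq => y Wy.
  rewrite PiFE// localizeE//; last exact: ssharpc.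
  by rewrite /sharpc act_tact; exact: (sharp_coframe ad mPi).
- by move=> I; rewrite delta_coframe; exact: nambu_form.
- move=> a I; have fs := scale_is_form (sf a) (fc I).
  have -> : (fun J => fF a * delta I J) = coefF (fun y v => f a y * coframe L f I v).
    apply/funext => J; rewrite delta_coframe; apply: localfun_eq => y Wy.
    rewrite (localfunM _ _ Wy) (coefFE _ (fc I) Wy) (coefFE _ fs Wy).
    by rewrite /fF (localizeE oW (smooth_smooth_on _ (sf a)) Wy).
  exact: nambu_form.
- exact: nambu_form.
- exact: nambu_form.
- exact: expandable_form.
- exact: expandable_form.
Qed.

End ModularCocycle.

(** * The modular class *)

Section DensityRatio.
Context {R : realType} {d : nat} {M : manifold R d} {m : nat} {A : vbundle M m}.
Variables mu mu' : tform A m.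
Arguments mu : clear implicits.
Arguments mu' : clear implicits.
Hypothesis pmu : positive_density mu.
Hypothesis pmu' : positive_density mu'.
Implicit Types (x y : M) (i j : triv_idx A).

Definition frame_coef (nu : tform A m) i x : R := nu i x (fun k => tnth (frame i x) k).

Definition density_ratio x : R :=
  let i := projT1 (cid (tdom_cover A x)) in frame_coef mu' i x / frame_coef mu i x.

(** A change of trivialisation multiplies both densities by the same sign, so the chosen
    trivialisation is enough; there, forms of top degree are proportional. *)
Lemma density_ratioE i x v : tdom i x -> mu' i x v = density_ratio x * mu i x v.
Proof.
rewrite /density_ratio; case: (cid _) => j jx /= ix.
have [[aj _ cj] pj] := pmu; have [[aj' _ cj'] pj'] := pmu'.
rewrite (cj _ _ _ ix jx v) (cj' _ _ _ ix jx v) mulrCA; congr (_ * _).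
have r0 : frame_coef mu j x != 0 by rewrite gt_eqF//; exact: pj.
set q := _ / _.
have aw : alternating (fun u => - q * mu j x u + mu' j x u).
  by apply: alternating_comb; [exact: aj|exact: aj'].
have /= := top_form_eq0 (frame_basis jx) aw _ v.
rewrite -!/(frame_coef _ _ _) /q mulNr divfK// addNr => /(_ erefl) /eqP.
by rewrite mulNr addrC subr_eq0 => /eqP.
Qed.

Lemma density_ratio_frame i x : tdom i x ->
  density_ratio x = frame_coef mu' i x / frame_coef mu i x.
Proof.
move=> ix; rewrite {1}/frame_coef (density_ratioE _ ix) mulfK//.
by rewrite gt_eqF//; exact: pmu.2.
Qed.

Lemma density_ratio_gt0 x : 0 < density_ratio x.
Proof.
have [i ix] := tdom_cover A x; rewrite (density_ratio_frame ix).
by apply: divr_gt0; [exact: pmu'.2|exact: pmu.2].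
Qed.

Lemma density_ratio_smooth : smooth density_ratio.
Proof.
apply: smooth_on_local => x _; have [i ix] := tdom_cover A x.
exists (tdom i) => //; have oi := tdom_open i.
apply: (@smooth_on_ext _ _ _ _ (fun y => frame_coef mu' i y * (frame_coef mu i y)^-1)) => //.
  by move=> y iy; rewrite (density_ratio_frame iy).
have [[_ sm _] pm] := pmu; have [[_ sm' _] _] := pmu'.
apply: smooth_onM => //; first exact: (sm' i id).
apply: smooth_onV => //; last exact: (sm i id).
by move=> y iy; rewrite gt_eqF//; exact: pm.
Qed.

Lemma ln_density_ratio_smooth : smooth (fun x => ln (density_ratio x)).
Proof.
apply: smooth_on_ln; [exact: openT| |exact: density_ratio_smooth].
by move=> x _; exact: density_ratio_gt0.
Qed.

End DensityRatio.

(** * The modular cocycle and the change of density *)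

Section ModularClass.
Context {R : realType} {d m p : nat} {M : manifold R d}.
Context {A : vbundle M m} (L : lie_algebroid A) (Pi : msec A (p + 1)).
Arguments Pi : clear implicits.
Hypothesis hspan : dual_locally_spanned_by_differentials L.
Hypothesis nPi : nambu L Pi.
Implicit Types (x y : M) (alpha beta : form A p) (mu : tform A m) (Mt : msec A p).

Let mPi : is_msec Pi. Proof. by case: nPi. Qed.

Lemma modular_cochainP Mt : is_msec Mt -> cochain (modular_cochain Mt).
Proof.
move=> mMt; split=> [s fs|s i c alpha beta fs fa fb x].
  exact: smooth_pairing.
rewrite /modular_cochain (ord1 i) /pairing /upd eqxx.
by apply: (mMt.1 x); [case: fa|case: fb].
Qed.

(** The double sum reduces to the pair (0, 1): deleting the first argument and putting the bracket
    in place of the second leaves the bracket alone. *)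
Lemma lie_diff_modular_cochain Mt s x : lie_diff L Pi (modular_cochain Mt) s x =
  act L (sharp Pi (s ord0)) (pairing (s ord_max) Mt) x -
  act L (sharp Pi (s ord_max)) (pairing (s ord0) Mt) x -
  pairing (lbracket L Pi (s ord0) (s ord_max)) Mt x.
Proof.
have l0 : lift ord0 (ord0 : 'I_1) = ord_max :> 'I_2 by exact: val_inj.
have l1 : lift ord_max (ord0 : 'I_1) = ord0 :> 'I_2 by exact: val_inj.
rewrite /lie_diff /leibniz_diff /modular_cochain /lact.
rewrite big_ord_recl big_ord1 l0 l1 expr0 mul1r expr1 mulN1r; congr (_ + _).
rewrite big_ord_recl big_ord1 !big_mkcond !big_ord_recl !big_ord0 /= !addr0 add0r.
rewrite l0 /upd eqxx expr1 mulN1r big1 ?addr0// => t.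
by case: t => [[|[]]].
Qed.

Lemma modular_cocycle mu Mt : positive_density mu -> is_modular_msec L Pi mu Mt ->
  cocycle L Pi (modular_cochain Mt).
Proof.
move=> pmu mMt; split; first exact: modular_cochainP mMt.1.
move=> s fs x; rewrite lie_diff_modular_cochain.
have [i ix] := tdom_cover A x.
have [W [f [e [ad Wx]]]] := adapted_exists hspan ix.
by rewrite (pairing_lbracket ad mPi nPi pmu mMt Wx (fs _) (fs _)) subrr.
Qed.

Lemma lie_diff_cochain0 (chi : ('I_0 -> form A p) -> M -> R) s x :
  lie_diff L Pi chi s x = act L (sharp Pi (s ord0)) (chi (fun i => s (lift ord0 i))) x.
Proof.
rewrite /lie_diff /leibniz_diff /lact !big_ord1 big_mkcond big_ord1/=.
by rewrite expr0 mul1r addr0.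
Qed.

Lemma HLclass_sub (phi phi' : ('I_1 -> form A p) -> M -> R) chi :
  cochain chi ->
  (forall s, (forall i, is_form (s i)) -> forall x, phi' s x - phi s x = lie_diff L Pi chi s x) ->
  HLclass L Pi phi' `<=` HLclass L Pi phi.
Proof.
move=> cchi E psi [cpsi [chi' cchi' E']]; split=> //.
exists (fun s x => chi s x + chi' s x).
  split=> [s fs|s []//].
  by apply: smooth_onD; [exact: openT|exact: cchi.1|exact: cchi'.1].
move=> s fs x.
have -> : psi s x - phi s x = (phi' s x - phi s x) + (psi s x - phi' s x) by ring.
rewrite (E s fs) (E' s fs) !lie_diff_cochain0 !act_tact.
by apply/esym/tderiveD; apply: smooth_smooth_near; [apply: cchi.1|apply: cchi'.1].
Qed.

(** The reverse inclusion uses the opposite primitive. *)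
Lemma HLclass_eq (phi phi' : ('I_1 -> form A p) -> M -> R) chi :
  cochain chi ->
  (forall s, (forall i, is_form (s i)) -> forall x, phi' s x - phi s x = lie_diff L Pi chi s x) ->
  HLclass L Pi phi = HLclass L Pi phi'.
Proof.
move=> cchi E; apply/seteqP; split; last exact: HLclass_sub cchi E.
apply: (@HLclass_sub _ _ (fun s x => -1 * chi s x)).
  split=> [s fs|s []//].
  by apply: smooth_onZ; [exact: openT|exact: cchi.1].
move=> s fs x; rewrite -opprB (E s fs) !lie_diff_cochain0 !act_tact.
by rewrite tact_scale ?mulN1r//; apply: smooth_smooth_near; apply: cchi.1.
Qed.

Lemma modular_pairing_sub mu mu' Mt Mt' alpha x :
  positive_density mu -> is_modular_msec L Pi mu Mt ->
  positive_density mu' -> is_modular_msec L Pi mu' Mt' -> is_form alpha ->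
  pairing alpha Mt' x - pairing alpha Mt x =
  act L (sharp Pi alpha) (fun y => ln (density_ratio mu mu' y)) x.
Proof.
move=> pmu mMt pmu' mMt' fa.
have [i ix] := tdom_cover A x.
have [W [f [e [ad Wx]]]] := adapted_exists hspan ix.
have [oW Wi _ _ _] := ad.
pose h := density_ratio mu mu'.
have sh : smooth_near x h := smooth_smooth_near x (density_ratio_smooth pmu pmu').
have h0 : 0 < h x := density_ratio_gt0 pmu pmu' x.
have hN0 : h x != 0 by rewrite gt_eqF.
have dE y : W y -> density_coef e i mu' y = h y * density_coef e i mu y.
  by move=> Wy; exact: (density_ratioE pmu pmu' _ (Wi _ Wy)).
have r0 := density_coef_neq0 ad pmu Wx.
have srho : smooth_near x (density_coef e i mu).
  by apply: (smooth_near_on oW Wx); exact: (density_local_form ad pmu).2.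
have actE k : act L (e k) (density_coef e i mu') x =
    h x * act L (e k) (density_coef e i mu) x + density_coef e i mu x * act L (e k) h x.
  rewrite !act_tact -(tactM L _ sh srho); apply: near_eq_tderive.
  by apply: filterS (near_W ad Wx) => y Wy; exact: dE.
(* The coefficient of the second density is h times that of the first, so its logarithmic derivative
   gains that of h. *)
have E (J : {ffun 'I_p -> 'I_m}) : xcoef L f Mt' J x = xcoef L f Mt J x +
    \sum_k Picoef L f Pi J k x * ((h x)^-1 * act L (e k) h x).
  have E1 := modular_coefE ad mPi pmu J Wx mMt.
  have E2 := modular_coefE ad mPi pmu' J Wx mMt'.
  have n0 : h x * density_coef e i mu x != 0 by rewrite mulf_neq0.
  apply: (mulIf n0); rewrite -(dE _ Wx) E2 mulrDl dE// mulrCA E1 mulr_sumr mulr_suml -big_split/=.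
  apply: eq_bigr => k _; rewrite actE.
  move: (act L (e k) (Picoef _ _ _ _ _) x) (Picoef _ _ _ _ _ x) (act L (e k) (density_coef _ _ _) x)
    (act L (e k) h x) (density_coef _ _ _ x) (h x) hN0 => a1 a2 a3 a4 a5 a6 a6n.
  by field.
rewrite (pairing_coef ad mMt'.1 Wx (fa.1 x)) (pairing_coef ad mMt.1 Wx (fa.1 x)).
rewrite -mulrBr -sumrB.
have -> : act L (sharp Pi alpha) (fun y => ln (h y)) x = (h x)^-1 * act L (sharp Pi alpha) h x.
  by rewrite !act_tact; apply: tderive_comp => //; exact: is_derive1_ln.
rewrite act_tact (tactE ad _ Wx sh) [RHS]mulr_sumr.
transitivity (\sum_k (p`!%:R^-1 * \sum_J wcoef e alpha J x * Picoef L f Pi J k x) *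
    ((h x)^-1 * act L (e k) h x)); last first.
  apply: eq_bigr => k _; rewrite mulrCA; congr (_ * (_ * _)).
  exact/esym/(sharp_coef ad mPi k Wx (fa.1 x)).
under [RHS]eq_bigr do rewrite -mulrA mulr_suml.
rewrite -mulr_sumr exchange_big/=; congr (_ * _); apply: eq_bigr => J _.
rewrite E mulrDr addrC addKr mulr_sumr; apply: eq_bigr => k _.
by rewrite mulrA.
Qed.

Lemma modular_class_indep mu mu' Mt Mt' :
  positive_density mu -> is_modular_msec L Pi mu Mt ->
  positive_density mu' -> is_modular_msec L Pi mu' Mt' ->
  HLclass L Pi (modular_cochain Mt) = HLclass L Pi (modular_cochain Mt').
Proof.
move=> pmu mMt pmu' mMt'.
(* A function on M, viewed as a cochain on the empty tuple. *)
apply: (@HLclass_eq _ _ (fun _ x => ln (density_ratio mu mu' x))).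
  by split=> [s _|s []//]; exact: ln_density_ratio_smooth.
move=> s fs x; rewrite lie_diff_cochain0.
exact: (modular_pairing_sub x pmu mMt pmu' mMt' (fs ord0)).
Qed.

End ModularClass.

Theorem theorem5p11 (R : realType) (d m p : nat) (M : manifold R d)
    (A : vbundle M m) (L : lie_algebroid A) (Pi : msec A (p + 1)%N)
    (hpm : is_true (p + 1 <= m)%N)
    (hspan : dual_locally_spanned_by_differentials L)
    (hPi : nambu L Pi) :
  (forall (mu : tform A m) (Mt : msec A p),
     positive_density mu -> is_modular_msec L Pi mu Mt ->
     cocycle L Pi (modular_cochain Mt)) /\
  (forall (mu mu' : tform A m) (Mt Mt' : msec A p),
     positive_density mu -> is_modular_msec L Pi mu Mt ->
     positive_density mu' -> is_modular_msec L Pi mu' Mt' ->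
     HLclass L Pi (modular_cochain Mt) = HLclass L Pi (modular_cochain Mt')).
Proof.
split=> [mu Mt pmu mMt|mu mu' Mt Mt' pmu mMt pmu' mMt'].
  exact: (modular_cocycle hspan hPi pmu mMt).
exact: (modular_class_indep hspan hPi pmu mMt pmu' mMt').
Qed.
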